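(* For every integer $d \ge 2$, there exists a constant $c_d>0$, depending only on $d$, such that for every $n\ge 1$ \[ \int_{\mathbb{B}^d}\left|\sum_{k=1}^n \frac{x_k-x}{|x_k-x|^d}\right| dx \ge c_d\, n^{(d-2)/(d-1)} \] for any points $x_1,\dots,x_n \in \mathbb{S}^{d-1}$. Moreover, for every integer $d \ge 2$, there exists a constant $C_d>0$, depending only on $d$, such that for each $n\ge 1$ there exist points $x_1,\dots,x_n \in \mathbb{S}^{d-1}$ with \[ \int_{\mathbb{B}^d}\left|\sum_{k=1}^n \frac{x_k-x}{|x_k-x|^d}\right| dx \le C_d\, n^{(d-2)/(d-1)}. \] In particular, for $d=3$ the infimum of this integral over all $x_1,\dots,x_n\in\mathbb{S}^{2}$ is of sharp order $\sqrt{n}$, i.e. it is bounded above and below by positive absolute constants times $\sqrt n$.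
   Context: $\mathbb{B}^d$ is the open unit ball of $\mathbb{R}^d$, $\mathbb{S}^{d-1}=\partial\mathbb{B}^d$ is the unit sphere, $|\cdot|$ is the Euclidean norm and $dx$ is Lebesgue measure. *)

(* Defs.v *)
From HB Require Import structures.
From mathcomp Require Import all_boot all_order all_algebra.
From mathcomp Require Import all_classical all_reals all_analysis.

Set Implicit Arguments.
Unset Strict Implicit.
Unset Printing Implicit Defensive.

Import Order.TTheory GRing.Theory Num.Theory.
Import numFieldNormedType.Exports.

Local Open Scope classical_set_scope.
Local Open Scope ring_scope.

Definition measure_rV_display : measure_display -> measure_display.
Proof. exact. Qed.

(* Row vectors carry the product sigma-algebra, as [n.-tuple T] does in the
   library; for [T := R] it is the Borel sigma-algebra of R^n. *)
Section measurable_rV.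
Context {d} {T : sigmaRingType d}.
Variable n : nat.

Let coors : 'I_n -> 'rV[T]_n -> T := fun i x => x ord0 i.

Let rV_set0 : g_sigma_preimage coors set0.
Proof. exact: sigma_algebra0. Qed.

Let rV_setC A : g_sigma_preimage coors A -> g_sigma_preimage coors (~` A).
Proof. exact: sigma_algebraC. Qed.

Let rV_bigcup (F : _^nat) : (forall i, g_sigma_preimage coors (F i)) ->
  g_sigma_preimage coors (\bigcup_i (F i)).
Proof. exact: sigma_algebra_bigcup. Qed.

HB.instance Definition _ := @isMeasurable.Build (measure_rV_display d)
  'rV[T]_n (g_sigma_preimage coors) rV_set0 rV_setC rV_bigcup.

Lemma measurable_coor (i : 'I_n) :
  measurable_fun [set: 'rV[T]_n] (fun x : 'rV[T]_n => x ord0 i).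
Proof.
move=> _ Y mY; rewrite setTI; apply: sub_sigma_algebra => /=.
rewrite -bigcup_seq/=; exists i => /=; first by rewrite mem_index_enum.
by exists Y => //; rewrite setTI.
Qed.

Lemma measurable_fun_coorP d1 (T1 : measurableType d1) (f : T1 -> 'rV[T]_n) :
  (forall i, measurable_fun [set: T1] (fun t => f t ord0 i)) ->
  measurable_fun [set: T1] f.
Proof.
move=> mf _ Y mY; rewrite setTI.
suff sub : @measurable _ 'rV[T]_n `<=` [set A | measurable (f @^-1` A)].
  exact: sub.
apply: smallest_sub.
  split => /=; first by rewrite preimage_set0.
  - by move=> A mA; rewrite setTD preimage_setC; apply: measurableC.
  - by move=> F mF; rewrite preimage_bigcup; apply: bigcup_measurable.
move=> A; rewrite -bigcup_seq/= => -[i _ [B mB <-]].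
rewrite setTI -comp_preimage /=.
by rewrite -[X in measurable X]setTI; apply: mf.
Qed.

End measurable_rV.

Section lebesgue_rV.
Context {R : realType}.

Definition rV_cons n (p : measurableTypeR R * 'rV[R]_n) : 'rV[R]_n.+1 := row_mx p.1%:M p.2.

Definition rV_uncons n (x : 'rV[R]_n.+1) : measurableTypeR R * 'rV[R]_n :=
  (x ord0 ord0, \row_i x ord0 (lift ord0 i)).

Lemma rV_consE0 n (p : measurableTypeR R * 'rV[R]_n) : rV_cons p ord0 ord0 = p.1.
Proof.
rewrite /rV_cons (_ : ord0 = lshift n (ord0 : 'I_1)); last exact: val_inj.
by rewrite (@row_mxEl _ 1 1 n) mxE.
Qed.

Lemma rV_consES n (p : measurableTypeR R * 'rV[R]_n) (i : 'I_n) :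
  rV_cons p ord0 (lift ord0 i) = p.2 ord0 i.
Proof.
rewrite /rV_cons (_ : lift ord0 i = rshift 1 i); last exact: val_inj.
by rewrite (@row_mxEr _ 1 1 n).
Qed.

Lemma rV_consK n : cancel (@rV_cons n) (@rV_uncons n).
Proof.
move=> p; rewrite /rV_uncons rV_consE0 [RHS]surjective_pairing.
by congr pair; apply/rowP => i; rewrite mxE rV_consES.
Qed.

Lemma measurable_rV_cons n : measurable_fun setT (@rV_cons n).
Proof.
apply: measurable_fun_coorP => i.
case: (unliftP ord0 i) => [j|] ->.
  under eq_fun do rewrite rV_consES.
  exact: (measurableT_comp (measurable_coor j) measurable_snd).
under eq_fun do rewrite rV_consE0.
exact: measurable_fst.
Qed.

Lemma measurable_rV_uncons n : measurable_fun setT (@rV_uncons n).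
Proof.
apply/measurable_fun_pairP; split; first exact: measurable_coor.
apply: measurable_fun_coorP => i.
rewrite (_ : (fun _ => _) = fun x : 'rV[R]_n.+1 => x ord0 (lift ord0 i)).
  exact: measurable_coor.
by apply/funext => x /=; rewrite mxE.
Qed.

Section lebesgue_rV_step.
Variables (n : nat) (mu : {sigma_finite_measure set 'rV[R]_n -> \bar R}).

Definition lebesgue_rV_step : set 'rV[R]_n.+1 -> \bar R :=
  pushforward (@lebesgue_measure R \x mu)%E (@rV_cons n).

Let step0 : lebesgue_rV_step set0 = 0%E.
Proof. by rewrite /lebesgue_rV_step /pushforward preimage_set0 measure0. Qed.

Let step_ge0 A : (0 <= lebesgue_rV_step A)%E.
Proof. by have mf := @measurable_rV_cons n; apply: measure_ge0. Qed.

Let step_sigma_additive : semi_sigma_additive lebesgue_rV_step.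
Proof.
by have mf := @measurable_rV_cons n; apply: measure_semi_sigma_additive.
Qed.

HB.instance Definition _ := isMeasure.Build _ _ _ lebesgue_rV_step
  step0 step_ge0 step_sigma_additive.

Let lebesgue_rV_step_sigma_finite : sigma_finite setT lebesgue_rV_step.
Proof.
have /sigma_finiteP[F [FT ndF Foo]] := sigma_finiteT (@lebesgue_measure R).
have /sigma_finiteP[G [GT ndG Goo]] := sigma_finiteT mu.
exists (fun k => @rV_uncons n @^-1` (F k `*` G k)).
  rewrite -preimage_bigcup -[LHS](preimage_setT (@rV_uncons n)).
  congr (_ @^-1` _); rewrite -setXTT FT GT; apply/seteqP; split=> -[x y] /=.
    move=> [[i _ Fix] [j _ Gjy]]; exists (maxn i j) => //; split => /=.
      by move: x Fix; exact/subsetPset/ndF/leq_maxl.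
    by move: y Gjy; exact/subsetPset/ndG/leq_maxr.
  by move=> [i _ [Fix Giy]]; split; exists i.
move=> k; have [mFk Fkoo] := Foo k; have [mGk Gkoo] := Goo k; split.
  rewrite -[X in measurable X]setTI; apply: measurable_rV_uncons => //.
  exact: measurableX.
rewrite /lebesgue_rV_step /pushforward -comp_preimage.
rewrite (_ : _ \o _ = id); last by apply/funext => p /=; rewrite rV_consK.
by rewrite preimage_id product_measure1E// lte_mul_pinfty// ge0_fin_numE.
Qed.

HB.instance Definition _ := Measure_isSigmaFinite.Build _ _ _
  lebesgue_rV_step lebesgue_rV_step_sigma_finite.

End lebesgue_rV_step.

(* The n-fold product of the one-dimensional Lebesgue measure, transported
   along [rV_cons] one coordinate at a time; see [lebesgue_rV_box]. *)
Fixpoint lebesgue_rV n : {sigma_finite_measure set 'rV[R]_n -> \bar R} :=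
  if n is n'.+1 return {sigma_finite_measure set 'rV[R]_n -> \bar R}
  then lebesgue_rV_step (lebesgue_rV n') else \d_(0 : 'rV[R]_0).

Lemma measurable_box n (A : 'I_n -> set R) : (forall i, measurable (A i)) ->
  measurable [set x : 'rV[R]_n | forall i, A i (x ord0 i)].
Proof.
move=> mA; rewrite (_ : mkset _ = \bigcap_(i in [set: 'I_n])
    ((fun x : 'rV[R]_n => x ord0 i) @^-1` A i)).
  apply: fin_bigcap_measurable => // i _.
  by rewrite -[X in measurable X]setTI; apply: measurable_coor.
by apply/seteqP; split=> x /= Ax i; [move=> _ /=|]; apply: Ax.
Qed.

Lemma lebesgue_rV_box n (A : 'I_n -> set R) :
  (forall i, measurable (A i)) ->
  lebesgue_rV n [set x : 'rV[R]_n | forall i, A i (x ord0 i)] =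
  (\prod_(i < n) lebesgue_measure (A i))%E.
Proof.
elim: n A => [|n IHn] A mA.
  rewrite big_ord0 /= diracE mem_set //.
  by move=> [].
rewrite big_ord_recl /= /lebesgue_rV_step /pushforward.
rewrite (_ : _ @^-1` _ = A ord0 `*`
    [set x : 'rV[R]_n | forall i, A (lift ord0 i) (x ord0 i)]).
  rewrite product_measure1E; first congr (_ * _)%E.
  - exact: (IHn (fun i => A (lift ord0 i)) (fun i => mA _)).
  - exact: mA.
  - exact: (@measurable_box n (fun i => A (lift ord0 i)) (fun i => mA _)).
apply/seteqP; split=> p /=.
  move=> Ap; split=> /= [|i]; first by rewrite -(rV_consE0 p).
  by rewrite -rV_consES.
move=> [Ap1 Ap2] i; case: (unliftP ord0 i) => [j|] ->.
  by rewrite rV_consES.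
by rewrite rV_consE0.
Qed.

End lebesgue_rV.

Section electric_field.
Context {R : realType} {d : nat}.
Implicit Types x : 'rV[R]_d.

(* The library's norm [`|x|] on row vectors is the sup norm. *)
Definition enorm x : R := Num.sqrt (\sum_(i < d) x ord0 i ^+ 2).

Definition unit_ball : set 'rV[R]_d := [set x | enorm x < 1].

Definition unit_sphere : set 'rV[R]_d := [set x | enorm x = 1].

Definition efield n (p : 'I_n -> 'rV[R]_d) x : 'rV[R]_d :=
  \sum_(k < n) (enorm (p k - x) ^+ d)^-1 *: (p k - x).

Definition field_integral n (p : 'I_n -> 'rV[R]_d) : \bar R :=
  (\int[lebesgue_rV d]_(x in unit_ball) (enorm (efield p x))%:E)%E.

End electric_field.
Arguments unit_ball R d : clear implicits.
Arguments unit_sphere R d : clear implicits.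

(* Main.v *)
Require Import Defs.
From HB Require Import structures.
From mathcomp Require Import all_boot all_order all_algebra.
From mathcomp Require Import all_classical all_reals all_analysis.
From mathcomp Require Import fingroup perm measurable_realfun ring lra.

Set Implicit Arguments.
Unset Strict Implicit.
Unset Printing Implicit Defensive.

Import Order.TTheory GRing.Theory Num.Theory.
Import numFieldNormedType.Exports.
Local Open Scope classical_set_scope.
Local Open Scope ring_scope.

(** Write [K z] for [z / |z| ^ d], and [n] for [d - 1], the dimension of the
    sphere.  The field is that of [N] equal charges on the unit sphere.  It cannot
    be small because, at the scale [h = N ^ (-1/n)] at which the charges can be
    told apart, each of them is seen separately; it need not be larger because
    charges spread evenly over the sphere cancel, by Newton's theorem, down to that
    same scale.

    Both halves use polar coordinates without a surface measure: the directions
    are the points of the annulus [1 <= |x| < 2], weighted by volume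
    ([ray_formula]).  A multiple of the integral of [g z / |z| ^ d] is the mean,
    over such [x], of the integral of [g (r *: x) / r] along the ray.

    Lower bound.  The field is tested against the gradient [V] of a function [psi]
    with [|V| <= n], with values at least [h / 2] at the charges and small at most
    points of the ball; [psi] is [h * S / (1 + S)] for a sum [S] of
    bumps of width [h] at the charges ([potential]).  From a charge [q] the
    pairing of [V] with [K] is integrated along rays: along a ray it is the
    derivative of [psi], so only [psi q - psi e] remains, with [e] the point where
    the ray leaves the ball ([force_gain]).  For most directions [psi e] is
    negligible: the nearly tangent ones fill a thin slab ([slab_le]), and those with
    [e] near another charge fill a cone of volume of order [h ^ n] ([cone_le]), of
    which there are at most [N], with [N * h ^ n] small.  So each charge
    contributes a multiple of [h] to the integral of the pairing of [V] with the
    whole field, which is at most [n] times the integral of the field: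
    [field_integral_lower_bound] gives [c * N * h = c * N ^ ((n - 1) / n)].  The
    integrals near the charges, which have no sign, are made positive by adding
    [n * |K|] on both sides.

    Upper bound.  The shell [1 <= |y| < 1 + m ^ (-2)], uniformly charged, exerts no
    force inside the ball ([newton]).  It is cut in [2 * d * m ^ n] cells of equal
    volume ([shell_cells]): up to a null set it is the union of [2 * d] congruent
    faces, on each of which the coordinate of largest absolute value is, up to the
    thickness of the shell, a Lipschitz function of the others, and each face is
    cut successively along these.  The
    cells need not all be small, but the sum of their diameters is of order
    [m ^ (n - 1)] because the slabs of each cut are disjoint ([cut_region]).  A
    cell of diameter [D] is replaced by one point of the sphere, near its centroid.
    The linear term in the expansion of [K] around the centroid averages to zero
    over the cell ([kernel_taylor]), so the field changes by order
    [D ^ 2 / |z| ^ (n + 2)] at distance [|z| >= 2 * D], and by order [D] in mean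
    over the ball ([cell_estimate]).  Adding up, the field of the
    [2 * d * m ^ n] points has an integral of order [m ^ (n - 1)], and charges in
    excess of that number cost a constant each ([balanced_charges]).

    For [d = 3] the exponent is [1 / 2], and both bounds pass to the infimum. *)

Lemma le_of_eq {disp : Order.disp_t} {T : porderType disp} (x y : T) : x = y -> (x <= y)%O.
Proof. by move=> ->. Qed.

(** * Measurability of real-valued functions *)

Section measurability.
Context {R : realType} {d : measure_display} {T : measurableType d}.
Implicit Types f g : T -> R.

Lemma mfunC (c : R) : measurable_fun [set: T] (fun=> c).
Proof. exact: measurable_cst. Qed.

Lemma mfunD f g : measurable_fun setT f -> measurable_fun setT g ->
  measurable_fun setT (fun x => f x + g x).
Proof. exact: measurable_funD. Qed.

Lemma mfunM f g : measurable_fun setT f -> measurable_fun setT g ->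
  measurable_fun setT (fun x => f x * g x).
Proof. exact: measurable_funM. Qed.

Lemma mfunN f : measurable_fun setT f -> measurable_fun setT (fun x => - f x).
Proof. exact: measurable_funN. Qed.

Lemma mfunX n f : measurable_fun setT f -> measurable_fun setT (fun x => f x ^+ n).
Proof. exact: measurable_funX. Qed.

Lemma mfun_sum (I : Type) (s : seq I) (F : I -> T -> R) :
  (forall i, measurable_fun setT (F i)) ->
  measurable_fun setT (fun x => \sum_(i <- s) F i x).
Proof. by move=> mF; apply: measurable_sum. Qed.

Lemma mfun_prod (I : Type) (s : seq I) (F : I -> T -> R) :
  (forall i, measurable_fun setT (F i)) ->
  measurable_fun setT (fun x => \prod_(i <- s) F i x).
Proof.
move=> mF; elim: s => [|i s IHs].
  by under eq_fun do rewrite big_nil; apply: mfunC.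
by under eq_fun do rewrite big_cons; apply: mfunM.
Qed.

(** [x^-1] is [x * (x ^+ 2) `^ (- 1)], which also holds at [0]. *)
Lemma mfunV f : measurable_fun setT f -> measurable_fun setT (fun x => (f x)^-1).
Proof.
move=> mf; rewrite (_ : (fun _ => _) = fun x => f x * (f x ^+ 2) `^ (- 1)).
  apply: mfunM => //; apply: (measurableT_comp (f := (@powR R)^~ (- 1))).
    exact: measurable_powR.
  exact: mfunX.
apply/funext => x; rewrite powR_inv1 ?sqr_ge0//.
have [->|f0] := eqVneq (f x) 0; first by rewrite invr0 mul0r.
by rewrite expr2 invfM mulrA divff// mul1r.
Qed.

Lemma mfun_max f g : measurable_fun setT f -> measurable_fun setT g ->
  measurable_fun setT (fun x => Num.max (f x) (g x)).
Proof. exact: measurable_maxr. Qed.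

Lemma mfun_min f g : measurable_fun setT f -> measurable_fun setT g ->
  measurable_fun setT (fun x => Num.min (f x) (g x)).
Proof. exact: measurable_minr. Qed.

Lemma mfun_sqrt f : measurable_fun setT f ->
  measurable_fun setT (fun x => Num.sqrt (f x)).
Proof.
move=> mf; rewrite (_ : (fun _ => _) = fun x => (Num.max (f x) 0) `^ (2^-1)).
  apply: (measurableT_comp (f := (@powR R)^~ 2^-1)); first exact: measurable_powR.
  exact: mfun_max mf (mfunC 0).
apply/funext => x; rewrite powR12_sqrt ?le_max ?lexx ?orbT//.
by case: (leP (f x) 0) => // f0; rewrite sqrtr0 ler0_sqrtr.
Qed.

Lemma mfun_norm f : measurable_fun setT f -> measurable_fun setT (fun x => `|f x|).
Proof. by move=> mf; apply: measurableT_comp. Qed.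

Lemma mfun_lt f g : measurable_fun setT f -> measurable_fun setT g ->
  measurable_fun setT (fun x => f x < g x).
Proof. exact: measurable_fun_ltr. Qed.

Lemma mfun_le f g : measurable_fun setT f -> measurable_fun setT g ->
  measurable_fun setT (fun x => f x <= g x).
Proof. exact: measurable_fun_ler. Qed.

Lemma mfun_and (b c : T -> bool) : measurable_fun setT b -> measurable_fun setT c ->
  measurable_fun setT (fun x => b x && c x).
Proof. exact: measurable_and. Qed.

Lemma mfun_bool (b : T -> bool) : measurable_fun setT b ->
  measurable_fun setT (fun x => (b x)%:R : R).
Proof.
move=> mb; rewrite (_ : (fun _ => _) = fun x => if b x then 1 : R else 0).
  by apply: measurable_fun_ifT => //; apply: mfunC.
by apply/funext => x; case: (b x).
Qed.

Lemma mfun_EFin f : measurable_fun setT f -> measurable_fun setT (fun x => (f x)%:E).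
Proof. by move=> mf; apply/measurable_EFinP. Qed.

Lemma mset_bool (b : T -> bool) : measurable_fun setT b -> measurable [set x | b x].
Proof.
by move=> mb; rewrite -[X in measurable X]setTI; apply: (mb measurableT [set true]).
Qed.

End measurability.

Lemma mfun_coor {R : realType} d (T : measurableType d) n (f : T -> 'rV[R]_n) i :
  measurable_fun setT f -> measurable_fun setT (fun t => f t ord0 i).
Proof. exact: (measurableT_comp (measurable_coor i)). Qed.

Lemma mfun_rV {R : realType} d (T : measurableType d) n (f : T -> 'rV[R]_n) :
  (forall i, measurable_fun setT (fun t => f t ord0 i)) -> measurable_fun setT f.
Proof. exact: measurable_fun_coorP. Qed.

Lemma mfun_enorm {R : realType} d (T : measurableType d) n (f : T -> 'rV[R]_n) :
  measurable_fun setT f -> measurable_fun setT (fun t => enorm (f t)).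
Proof.
by move=> mf; apply/mfun_sqrt/mfun_sum => i; apply/mfunX/mfun_coor.
Qed.

Lemma mfun_rVD {R : realType} d (T : measurableType d) n (f g : T -> 'rV[R]_n) :
  measurable_fun setT f -> measurable_fun setT g ->
  measurable_fun setT (fun t => f t + g t).
Proof.
move=> mf mg; apply: mfun_rV => i; under eq_fun do rewrite mxE.
by apply: mfunD; apply: mfun_coor.
Qed.

Lemma mfun_rVN {R : realType} d (T : measurableType d) n (f : T -> 'rV[R]_n) :
  measurable_fun setT f -> measurable_fun setT (fun t => - f t).
Proof.
move=> mf; apply: mfun_rV => i; under eq_fun do rewrite mxE.
by apply: mfunN; apply: mfun_coor.
Qed.

Lemma mfun_rVZ {R : realType} d (T : measurableType d) n (f : T -> R) (g : T -> 'rV[R]_n) :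
  measurable_fun setT f -> measurable_fun setT g ->
  measurable_fun setT (fun t => f t *: g t).
Proof.
move=> mf mg; apply: mfun_rV => i; under eq_fun do rewrite mxE.
by apply: mfunM => //; apply: mfun_coor.
Qed.

(** Measurability of an expression by its head operator.  The rules for partial
    applications are for the eta-contracted functions that [apply] leaves. *)
Ltac meas := repeat match goal with
 | |- forall _, _ => intro
 | H : measurable_fun setT ?f |- measurable_fun setT ?f => exact: H
 | |- measurable_fun setT (fun _ => ?c) => exact: measurable_cst
 | |- measurable_fun setT (fun x => x) => exact: measurable_id
 | |- measurable_fun setT (fun x => x.1) => exact: measurable_fst
 | |- measurable_fun setT (fun x => x.2) => exact: measurable_snd
 | |- measurable_fun setT fst => exact: measurable_fst
 | |- measurable_fun setT snd => exact: measurable_snd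
 | |- measurable_fun setT (fun x => (_)%:E) => apply: mfun_EFin
 | |- measurable_fun setT (fun x => (_ && _)) => apply: mfun_and
 | |- measurable_fun setT (fun x => (_ < _)) => apply: mfun_lt
 | |- measurable_fun setT (fun x => (_ <= _)) => apply: mfun_le
 | |- measurable_fun setT (fun x => (nat_of_bool _)%:R) => apply: mfun_bool
 | |- measurable_fun setT (fun x => Num.max _ _) => apply: mfun_max
 | |- measurable_fun setT (fun x => Num.min _ _) => apply: mfun_min
 | |- measurable_fun setT (fun x => `|_|) => apply: mfun_norm
 | |- measurable_fun setT (fun x => Num.sqrt _) => apply: mfun_sqrt
 | |- measurable_fun setT (fun x => enorm _) => apply: mfun_enorm
 | |- measurable_fun setT (fun x => (_ : 'rV_ _) ord0 _) => apply: mfun_coor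
 | |- measurable_fun setT (fun x => _^-1) => apply: mfunV
 | |- measurable_fun setT (fun x => _ ^+ _) => apply: mfunX
 | |- measurable_fun setT (GRing.scale ?c) => apply: (mfun_rVZ (f := fun=> c))
 | |- measurable_fun setT (GRing.mul ?c) => apply: (mfunM (f := fun=> c))
 | |- measurable_fun setT (GRing.add ?c) => first
     [apply: (mfun_rVD (f := fun=> c))|apply: (mfunD (f := fun=> c))]
 | |- measurable_fun setT (Order.lt ?c) => apply: (mfun_lt (f := fun=> c))
 | |- measurable_fun setT (Order.le ?c) => apply: (mfun_le (f := fun=> c))
 | |- measurable_fun setT GRing.inv => apply: (mfunV (f := fun x => x))
 | |- measurable_fun setT GRing.opp => first
     [apply: (mfunN (f := fun x => x))|apply: (mfun_rVN (f := fun x => x))]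
 | |- measurable_fun setT enorm => apply: mfun_enorm
 | |- measurable_fun setT (fun x => _ *: _) => apply: mfun_rVZ
 | |- measurable_fun setT (fun x => _ * _) => apply: mfunM
 | |- measurable_fun setT (fun x => \sum_(i <- _) _) => apply: mfun_sum
 | |- measurable_fun setT (fun x => \prod_(i <- _) _) => apply: mfun_prod
 | |- measurable_fun setT (fun x => (_ + _ : 'rV_ _)) => apply: mfun_rVD
 | |- measurable_fun setT (fun x => (- _ : 'rV_ _)) => apply: mfun_rVN
 | |- measurable_fun setT (fun x => _ + _) => apply: mfunD
 | |- measurable_fun setT (fun x => - _) => apply: mfunN
 end.

(** * Invariances of Lebesgue measure *)

(** Boxes form a generating pi-system, so they determine a measure. *)
Lemma lebesgue_rV_unique {R : realType} n (mu : {measure set 'rV[R]_n -> \bar R}) :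
  (forall A : 'I_n -> set R, (forall i, measurable (A i)) ->
    mu [set x : 'rV[R]_n | forall i, A i (x ord0 i)] =
    (\prod_(i < n) lebesgue_measure (A i))%E) ->
  forall Y, measurable Y -> mu Y = lebesgue_rV n Y.
Proof.
move=> muE Y mY.
pose box (A : 'I_n -> set R) := [set x : 'rV[R]_n | forall i, A i (x ord0 i)].
pose G := [set box A | A in [set A | forall i, measurable (A i)]].
pose g k := box (fun=> `]- (k%:R), k%:R[%classic).
have Gm : G `<=` measurable by move=> _ [A mA <-]; exact: measurable_box.
have mG : @measurable _ 'rV[R]_n = <<s G >>.
  apply/seteqP; split; last first.
    by apply: smallest_sub => //; exact: sigma_algebra_measurable.
  apply: smallest_sub; first exact: smallest_sigma_algebra.
  move=> A; rewrite -bigcup_seq/= => -[i _ [B mB <-]].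
  apply: sub_sigma_algebra; exists (fun j => if j == i then B else setT).
    by move=> j; case: ifP.
  apply/seteqP; split => x /=; first by move=> /(_ i); rewrite eqxx.
  by move=> [_ Bx] j; case: eqP => [->|].
have Gg k : G (g k) by exists (fun=> `]- (k%:R), k%:R[%classic).
apply: (measure_unique G g mG _ Gg) => //.
- move=> _ _ [A mA <-] [B mB <-]; exists (fun i => A i `&` B i).
    by move=> i /=; exact: measurableI.
  apply/seteqP; split => x /=; last by move=> [xA xB] i.
  by move=> xAB; split=> i; have [] := xAB i.
- apply/seteqP; split => // x _.
  exists (Num.bound (\sum_i `|x ord0 i|)) => // i /=.
  rewrite in_itv/= -ltr_norml; apply: le_lt_trans (archi_boundP _); last first.
    by rewrite sumr_ge0.
  by rewrite (bigD1 i)//= lerDl sumr_ge0.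
- by move=> _ [A mA <-]; rewrite muE// -lebesgue_rV_box.
move=> k; rewrite muE//.
rewrite (eq_bigr (fun=> (k%:R + k%:R)%:E)).
  by rewrite prodEFin ltry.
move=> i _; rewrite lebesgue_measure_itv/= lte_fin.
have k0 : (0 : R) <= k%:R by [].
by case: ltP => kk; [rewrite -EFinB opprK|congr (_%:E); lra].
Qed.

Lemma lebesgue_measure_affine {R : realType} (c a : R) (A : set R) : c != 0 ->
  measurable A -> lebesgue_measure ((fun x => c * x + a) @^-1` A) =
    (`|c|^-1%:E * lebesgue_measure A)%E.
Proof.
move=> c0 mA.
have mphi : measurable_fun setT (fun x : measurableTypeR R => (c * x + a : measurableTypeR R)).
  by apply: mfunD; [apply: mfunM; [exact: measurable_cst|exact: measurable_id]|exact: measurable_cst].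
have nc : 0 <= `|c| by [].
have ncp : 0 < `|c| by rewrite normr_gt0.
pose mu := mscale (NngNum nc) (pushforward (@lebesgue_measure R) (fun x : measurableTypeR R => (c * x + a : measurableTypeR R))).
suff : lebesgue_measure A = mu mphi A.
  move=> ->; rewrite /mu /mscale /= /pushforward muleA -EFinM mulVf ?mul1e//.
  by rewrite normr_eq0.
rewrite /mu.
apply: lebesgue_measure_unique => //= _ [[u v]] _ <-.
rewrite /mscale /= /pushforward.
have [c1|c1] : 0 < c \/ c < 0 by move: c0; rewrite neq_lt => /orP[]; [right|left].
- rewrite (_ : _ @^-1` _ = `](u - a) / c, (v - a) / c]%classic).
    rewrite !lebesgue_measure_itv/= !lte_fin ltr_pM2r ?invr_gt0// ltrD2r.
    case: ifP => _; rewrite ?mule0// -EFinM gtr0_norm//; congr (_%:E).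
    by field; rewrite gt_eqF.
  apply/seteqP; split => x /=; rewrite !in_itv/= ltr_pdivrMr// ler_pdivlMr// => /andP[? ?];
  apply/andP; split; lra.
- rewrite (_ : _ @^-1` _ = `[(v - a) / c, (u - a) / c[%classic).
    rewrite !lebesgue_measure_itv/= !lte_fin ltr_nM2r ?invr_lt0// ltrD2r.
    case: ifP => _; rewrite ?mule0// -EFinM ltr0_norm//; congr (_%:E).
    by field; rewrite lt_eqF.
  apply/seteqP; split => x /=; rewrite !in_itv/= ?ltr_ndivlMr// ?ler_ndivrMr// => /andP[? ?];
  apply/andP; split; lra.
Qed.

Section affine.
Context {R : realType} {n : nat}.

(** Translations, dilations and signed permutations of the coordinates all have
    this form. *)
Definition affine_perm (s : {perm 'I_n}) (c a : 'I_n -> R) (x : 'rV[R]_n) :=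
  \row_j (c j * x ord0 (s j) + a j).

Lemma mfun_affine_perm s c a : measurable_fun setT (affine_perm s c a).
Proof.
apply: mfun_rV => i; under eq_fun do rewrite mxE.
by apply: mfunD; [apply: mfunM; [exact: mfunC|exact: measurable_coor]|exact: mfunC].
Qed.

(** The image of a box is a box, so uniqueness reduces the claim to one
    coordinate at a time. *)
Lemma lebesgue_rV_affine s c a (Y : set 'rV[R]_n) : (forall j, c j != 0) ->
  measurable Y -> lebesgue_rV n (affine_perm s c a @^-1` Y) =
    ((\prod_j `|c j|)^-1%:E * lebesgue_rV n Y)%E.
Proof.
move=> c0 mY; have mphi := mfun_affine_perm s c a.
have nc : 0 <= \prod_j `|c j| by apply: prodr_ge0.
have nc0 : \prod_j `|c j| != 0 by apply/prodf_neq0 => i _; rewrite normr_eq0.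
pose mu := mscale (NngNum nc) (pushforward (lebesgue_rV n) (affine_perm s c a)).
suff <- : mu mphi Y = lebesgue_rV n Y.
  by rewrite /mu /mscale /= /pushforward muleA -EFinM mulVf ?mul1e.
apply: lebesgue_rV_unique => // A mA.
transitivity ((\prod_j `|c j|)%:E * lebesgue_rV n (affine_perm s c a @^-1` [set x : 'rV[R]_n | forall i, A i (x ord0 i)]))%E => //.
pose B i := (fun x => c (s^-1%g i) * x + a (s^-1%g i)) @^-1` (A (s^-1%g i)).
have mB i : measurable (B i).
  rewrite -[X in measurable X]setTI; apply: (_ : measurable_fun setT _) => //.
  by apply: mfunD; [apply: mfunM; [exact: mfunC|exact: measurable_id]|exact: mfunC].
rewrite (_ : affine_perm s c a @^-1` _ = [set x : 'rV[R]_n | forall i, B i (x ord0 i)]); last first.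
  apply/seteqP; split => x /= Ax i; last by have := Ax (s i); rewrite mxE /B/= permK.
  by have := Ax (s^-1%g i); rewrite mxE permKV.
rewrite lebesgue_rV_box//.
rewrite (eq_bigr (fun i => (`|c (s^-1%g i)|^-1%:E * lebesgue_measure (A (s^-1%g i)))%E)); last first.
  by move=> i _; exact: lebesgue_measure_affine.
rewrite [X in (_ * X)%E](reindex_inj (@perm_inj _ s))/=.
under [X in (_ * X)%E]eq_bigr do rewrite permK.
rewrite big_split/= muleA.
rewrite prodEFin -EFinM prodfV divff// mul1e//.
Qed.

Lemma integral_affine_perm s c a (f : 'rV[R]_n -> \bar R) : (forall j, c j != 0) ->
  measurable_fun setT f -> (forall x, 0 <= f x)%E ->
  (\int[lebesgue_rV n]_x f (affine_perm s c a x) =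
    (\prod_j `|c j|)^-1%:E * \int[lebesgue_rV n]_x f x)%E.
Proof.
move=> c0 mf f0; have mphi := mfun_affine_perm s c a.
have nc : 0 <= (\prod_j `|c j|)^-1 by rewrite invr_ge0; apply: prodr_ge0.
rewrite -[LHS](ge0_integral_pushforward mphi _ measurableT mf)//.
rewrite -[RHS](@ge0_integral_mscale _ _ _ _ _ measurableT (NngNum nc))//.
apply: eq_measure_integral => Y mY _.
exact: lebesgue_rV_affine.
Qed.

End affine.

(** * Integrals over product spaces *)

Section lebesgue_rV_integrals.
Context {R : realType}.

Lemma integral_shift n (a : 'rV[R]_n) (f : 'rV[R]_n -> \bar R) :
  measurable_fun setT f -> (forall x, 0 <= f x)%E ->
  (\int[lebesgue_rV n]_x f (x + a)%R = \int[lebesgue_rV n]_x f x)%E.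
Proof.
move=> mf f0.
have := @integral_affine_perm R n 1%g (fun=> 1) (fun j => a ord0 j) f (fun=> oner_neq0 _) mf f0.
rewrite big1 ?normr1// invr1 mul1e => <-; apply: eq_integral => x _; congr f.
by apply/rowP => j; rewrite !mxE perm1 mul1r.
Qed.

Lemma integral_scale n (c : R) (f : 'rV[R]_n -> \bar R) : c != 0 ->
  measurable_fun setT f -> (forall x, 0 <= f x)%E ->
  (\int[lebesgue_rV n]_x f (c *: x) = (`|c| ^+ n)^-1%:E * \int[lebesgue_rV n]_x f x)%E.
Proof.
move=> c0 mf f0.
have := @integral_affine_perm R n 1%g (fun=> c) (fun=> 0) f (fun=> c0) mf f0.
rewrite prodr_const card_ord => <-; apply: eq_integral => x _; congr f.
by apply/rowP => j; rewrite !mxE perm1 addr0.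
Qed.

Lemma integral_perm n (s : {perm 'I_n}) (f : 'rV[R]_n -> \bar R) :
  measurable_fun setT f -> (forall x, 0 <= f x)%E ->
  (\int[lebesgue_rV n]_x f (col_perm s x) = \int[lebesgue_rV n]_x f x)%E.
Proof.
move=> mf f0.
have := @integral_affine_perm R n s (fun=> 1) (fun=> 0) f (fun=> oner_neq0 _) mf f0.
rewrite big1 ?normr1// invr1 mul1e => <-; apply: eq_integral => x _; congr f.
by apply/rowP => j; rewrite !mxE mul1r addr0.
Qed.

Lemma integral_rV_cons n (f : 'rV[R]_n.+1 -> \bar R) :
  measurable_fun setT f -> (forall x, 0 <= f x)%E ->
  (\int[lebesgue_rV n.+1]_x f x =
   \int[lebesgue_measure]_s \int[lebesgue_rV n]_y f (rV_cons (s, y)))%E.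
Proof.
move=> mf f0 /=.
have mcons := @measurable_rV_cons R n.
rewrite [LHS](ge0_integral_pushforward mcons _ measurableT mf)//.
rewrite preimage_setT (fubini_tonelli1 (f \o @rV_cons R n))//.
  exact: measurableT_comp.
by move=> x; exact: f0.
Qed.

(** The variables of the factors are separated one coordinate at a time. *)
Lemma integral_rV_prod_le n (g : 'I_n -> R -> R) (M : R) : 0 <= M ->
  (forall i, measurable_fun setT (g i)) -> (forall i s, 0 <= g i s) ->
  (forall i, \int[lebesgue_measure]_s (g i s)%:E <= M%:E)%E ->
  (\int[lebesgue_rV n]_x (\prod_i g i (x ord0 i))%:E <= (M ^+ n)%:E)%E.
Proof.
move=> M0; elim: n g => [|n IH] g mg g0 gM.
  rewrite expr0; under eq_integral do rewrite big_ord0.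
  by rewrite integral_cst//= diracT mule1.
have mprod m (h : 'I_m -> R -> R) : (forall i, measurable_fun setT (h i)) ->
    measurable_fun setT (fun x : 'rV[R]_m => \prod_i h i (x ord0 i)).
  move=> mh; apply: mfun_prod => i; apply: (measurableT_comp (mh i)).
  exact: measurable_coor.
rewrite integral_rV_cons; last 2 first.
- by apply: mfun_EFin; exact: mprod.
- by move=> x; rewrite lee_fin prodr_ge0.
pose I := (\int[lebesgue_rV n]_y (\prod_(i < n) g (lift ord0 i) (y ord0 i))%:E)%E.
have Es s : (\int[lebesgue_rV n]_y (\prod_i g i (rV_cons (s, y) ord0 i))%:E =
    (g ord0 s)%:E * I)%E.
  rewrite -ge0_integralZl_EFin//; last 2 first.
  - by move=> y _; rewrite lee_fin prodr_ge0.
  - by apply: mfun_EFin; apply: (mprod n (fun i => g (lift ord0 i))) => i; exact: mg.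
  apply: eq_integral => y _; rewrite big_ord_recl rV_consE0 EFinM.
  by under eq_bigr do rewrite rV_consES.
under eq_integral do rewrite Es.
rewrite exprS EFinM.
have Iy : (0 <= I <= (M ^+ n)%:E)%E.
  apply/andP; split; last by exact: (IH _ (fun i => mg _) (fun i => g0 _) (fun i => gM _)).
  by apply: integral_ge0 => y _; rewrite lee_fin prodr_ge0.
move/andP: Iy => [Iy0 IyM].
rewrite ge0_integralZr//; last 2 first.
- by apply: mfun_EFin; exact: mg.
- by move=> s _; rewrite lee_fin.
by apply: lee_pmul => //; apply: integral_ge0 => s _; rewrite lee_fin.
Qed.

End lebesgue_rV_integrals.

Lemma ge0_le_integralT {R : realType} d (T : measurableType d)
    (mu : {measure set T -> \bar R}) (f g : T -> R) :
  (forall x, 0 <= f x) -> measurable_fun setT f -> measurable_fun setT g ->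
  (forall x, f x <= g x) -> (\int[mu]_x (f x)%:E <= \int[mu]_x (g x)%:E)%E.
Proof.
move=> f0 mf mg fg; apply: ge0_le_integral; first exact: measurableT.
- by move=> x _; rewrite lee_fin.
- exact: mfun_EFin.
- exact: mfun_EFin.
- by move=> x _; rewrite lee_fin.
Qed.

Lemma ge0_integralDT {R : realType} d (T : measurableType d)
    (mu : {measure set T -> \bar R}) (f g : T -> R) :
  (forall x, 0 <= f x) -> measurable_fun setT f ->
  (forall x, 0 <= g x) -> measurable_fun setT g ->
  (\int[mu]_x (f x + g x)%:E = \int[mu]_x (f x)%:E + \int[mu]_x (g x)%:E)%E.
Proof.
move=> f0 mf g0 mg; rewrite -ge0_integralD//.
- by move=> x _; rewrite lee_fin.
- exact: mfun_EFin.
- by move=> x _; rewrite lee_fin.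
- exact: mfun_EFin.
Qed.

Section integral_bool.
Context {R : realType} {d : measure_display} {T : measurableType d}.
Variable mu : {measure set T -> \bar R}.

Lemma integral_bool (b : T -> bool) (f : T -> R) :
  (\int[mu]_x ((b x)%:R * f x)%:E = \int[mu]_(x in [set x | b x]) (f x)%:E)%E.
Proof.
rewrite [RHS]integral_mkcond; apply: eq_integral => x _; rewrite patchE.
case: (boolP (b x)) => bx; first by rewrite mem_set// mul1r.
by rewrite memNset ?mul0r//; exact/negP.
Qed.

Lemma measure_le (A B : set T) : measurable A -> measurable B -> A `<=` B ->
  (mu A <= mu B)%E.
Proof. by move=> mA mB AB; apply: le_measure => //; exact: mem_set. Qed.

End integral_bool.

(** The hypotheses are pointwise on the closed interval, so that formulas with a
    singularity outside of it can be integrated. *)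
Lemma FTC_is_derive {R : realType} (f F : R -> R) (a b : R) : a <= b ->
  (forall x : R, a <= x <= b -> is_derive x 1 F (f x)) ->
  (forall x : R, a <= x <= b -> {for x, continuous f}) ->
  (\int[lebesgue_measure]_(x in `[a, b]) (f x)%:E = (F b - F a)%:E)%E.
Proof.
move=> ab dF cf; move: ab; rewrite le_eqVlt => /predU1P[<-|ab].
  by rewrite set_itv1 integral_set1 subrr.
have dF1 x : a <= x <= b -> derivable F x 1 by move=> /dF [].
have cF x : a <= x <= b -> {for x, continuous F}.
  by move=> xab; apply: differentiable_continuous; apply/derivable1_diffP/dF1.
rewrite (continuous_FTC2 (F := F) ab)//.
- apply: continuous_in_subspaceT => x; move/set_mem; rewrite /= in_itv; exact: cf.
- split.
  + by move=> x; rewrite in_itv/= => /andP[ax xb]; apply: dF1; rewrite !ltW.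
  + by apply: cvg_at_right_filter; apply: cF; rewrite lexx ltW.
  + by apply: cvg_at_left_filter; apply: cF; rewrite lexx ltW.
- move=> x; rewrite in_itv/= => /andP[ax xb]; rewrite derive1E.
  have xab : a <= x <= b by rewrite !ltW.
  by have := dF x xab => ?; rewrite derive_val.
Qed.

(** * Derivatives of functions of one real variable *)

Section derivatives.
Context {R : realType}.
Implicit Types (f g : R -> R) (x : R).

Lemma der_cst c x : is_derive x 1 (fun=> c : R) 0.
Proof. exact: is_derive_cst. Qed.

Lemma der_id x : is_derive x 1 (fun t : R => t) 1.
Proof. exact: is_derive_id. Qed.

Lemma derD f g x a b : is_derive x 1 f a -> is_derive x 1 g b ->
  is_derive x 1 (fun t => f t + g t) (a + b).
Proof. exact: is_deriveD. Qed.

Lemma derN f x a : is_derive x 1 f a -> is_derive x 1 (fun t => - f t) (- a).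
Proof. exact: is_deriveN. Qed.

Lemma derM f g x a b : is_derive x 1 f a -> is_derive x 1 g b ->
  is_derive x 1 (fun t => f t * g t) (a * g x + f x * b).
Proof.
move=> df dg; apply: (is_derive_eq (is_deriveM df dg)).
by rewrite addrC /GRing.scale/= mulrC.
Qed.

Lemma derX n f x a : is_derive x 1 f a ->
  is_derive x 1 (fun t => f t ^+ n) (n%:R * f x ^+ n.-1 * a).
Proof.
move=> df; elim: n => [|n IH].
  under eq_fun do rewrite expr0; rewrite !mul0r; exact: der_cst.
under eq_fun do rewrite exprS.
apply: (is_derive_eq (derM df IH)).
by case: n {IH} => [|n]; rewrite /= ?exprS -?natr1; ring.
Qed.

Lemma derV f x a : f x != 0 -> is_derive x 1 f a ->
  is_derive x 1 (fun t => (f t)^-1) (- a / f x ^+ 2).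
Proof.
move=> fx0 df; apply: (is_derive_eq (is_deriveV fx0 df)).
by rewrite /GRing.scale/= mulNr mulrC mulNr.
Qed.

Lemma der_sum (I : Type) (s : seq I) (F : I -> R -> R) (D : I -> R) x :
  (forall i, is_derive x 1 (F i) (D i)) ->
  is_derive x 1 (fun t => \sum_(i <- s) F i t) (\sum_(i <- s) D i).
Proof.
move=> dF; elim: s => [|i s IH].
  rewrite big_nil; under eq_fun do rewrite big_nil; exact: der_cst.
rewrite big_cons; under eq_fun do rewrite big_cons; exact: derD.
Qed.

Lemma der_continuous f x a : is_derive x 1 f a -> {for x, continuous f}.
Proof.
by case=> df _; apply: differentiable_continuous; apply/derivable1_diffP.
Qed.

Lemma contM f g x : {for x, continuous f} -> {for x, continuous g} ->
  {for x, continuous (fun t => f t * g t)}.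
Proof. exact: continuousM. Qed.

Lemma contV f x : f x != 0 -> {for x, continuous f} ->
  {for x, continuous (fun t => (f t)^-1)}.
Proof. exact: continuousV. Qed.

Lemma cont_cst (c : R) x : {for x, continuous (fun=> c)}.
Proof. exact: cst_continuous. Qed.

Lemma cont_sum (I : Type) (s : seq I) (F : I -> R -> R) x :
  (forall i, {for x, continuous (F i)}) ->
  {for x, continuous (fun t => \sum_(i <- s) F i t)}.
Proof.
move=> cF; rewrite /prop_for; elim: s => [|i s IH].
  under eq_fun do rewrite big_nil; exact: cst_continuous.
under eq_fun do rewrite big_cons; exact: continuousD (cF i) IH.
Qed.

End derivatives.

(** * Euclidean norm *)

Section euclid.
Context {R : realType} {n : nat}.
Implicit Types x y : 'rV[R]_n.

Definition dot x y : R := \sum_i x ord0 i * y ord0 i.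

Lemma dotC x y : dot x y = dot y x.
Proof. by apply: eq_bigr => i _; rewrite mulrC. Qed.

Lemma dotDl x y z : dot (x + y) z = dot x z + dot y z.
Proof. by rewrite -big_split; apply: eq_bigr => i _; rewrite mxE mulrDl. Qed.

Lemma dotZl c x z : dot (c *: x) z = c * dot x z.
Proof. by rewrite mulr_sumr; apply: eq_bigr => i _; rewrite mxE mulrA. Qed.

Lemma dotNl x z : dot (- x) z = - dot x z.
Proof. by rewrite -scaleN1r dotZl mulN1r. Qed.

Lemma dotDr x y z : dot z (x + y) = dot z x + dot z y.
Proof. by rewrite !(dotC z) dotDl. Qed.

Lemma dotZr c x z : dot z (c *: x) = c * dot z x.
Proof. by rewrite !(dotC z) dotZl. Qed.

Lemma dot0 x : dot x 0 = 0.
Proof. by rewrite -(scale0r x) dotZr mul0r. Qed.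

Lemma dotNr x z : dot z (- x) = - dot z x.
Proof. by rewrite !(dotC z) dotNl. Qed.

Lemma dot_suml (I : Type) (s : seq I) (F : I -> 'rV[R]_n) y :
  dot (\sum_(i <- s) F i) y = \sum_(i <- s) dot (F i) y.
Proof.
elim/big_ind2: _ => [|u v w z <- <-|//]; last by rewrite dotDl.
by rewrite /dot big1// => i _; rewrite mxE mul0r.
Qed.

Lemma enormE x : enorm x ^+ 2 = dot x x.
Proof.
rewrite sqr_sqrtr; last by apply: sumr_ge0 => i _; exact: sqr_ge0.
by apply: eq_bigr => i _; rewrite expr2.
Qed.

Lemma enorm_ge0 x : 0 <= enorm x.
Proof. exact: sqrtr_ge0. Qed.

Lemma enormZ c x : enorm (c *: x) = `|c| * enorm x.
Proof.
rewrite /enorm -sqrtr_sqr -sqrtrM ?sqr_ge0// mulr_sumr.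
by congr Num.sqrt; apply: eq_bigr => i _; rewrite mxE exprMn.
Qed.

Lemma enormN x : enorm (- x) = enorm x.
Proof. by rewrite -scaleN1r enormZ normrN1 mul1r. Qed.

Lemma enormBC x y : enorm (x - y) = enorm (y - x).
Proof. by rewrite -enormN opprB. Qed.

Lemma enorm0 : enorm (0 : 'rV[R]_n) = 0.
Proof. by rewrite -(scale0r 0) enormZ normr0 mul0r. Qed.

Lemma enorm_eq0 x : (enorm x == 0) = (x == 0).
Proof.
apply/idP/eqP => [|->]; last by rewrite enorm0.
rewrite -sqrf_eq0 enormE psumr_eq0 => [/allP x0|i _]; last by rewrite -expr2 sqr_ge0.
apply/rowP => i; have := x0 i (mem_index_enum _).
by rewrite mxE -expr2 sqrf_eq0 => /eqP.
Qed.

Lemma enorm_coor x i : `|x ord0 i| <= enorm x.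
Proof.
rewrite -(@ler_pXn2r _ 2) ?nnegrE ?enorm_ge0// enormE /dot (bigD1 i)//= -expr2 real_normK ?num_real//.
by rewrite lerDl sumr_ge0// => j _; rewrite -expr2 sqr_ge0.
Qed.

Lemma enorm_le_sum x : enorm x <= \sum_i `|x ord0 i|.
Proof.
rewrite -(@ler_pXn2r _ 2) ?nnegrE ?enorm_ge0 ?sumr_ge0// enormE.
rewrite [leRHS]expr2 mulr_suml; apply: ler_sum => i _.
rewrite -expr2 -real_normK ?num_real// expr2 ler_wpM2l//.
by rewrite (bigD1 i)//= lerDl sumr_ge0.
Qed.

Lemma dot_le x y : `|dot x y| <= enorm x * enorm y.
Proof.
have [->|y0] := eqVneq y 0.
  by rewrite enorm0 mulr0 /dot big1 ?normr0// => i _; rewrite mxE mulr0.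
have yy0 : 0 < dot y y by rewrite -enormE exprn_gt0// lt_def enorm_eq0 y0 enorm_ge0.
rewrite -(@ler_pXn2r _ 2) ?nnegrE ?mulr_ge0 ?enorm_ge0// exprMn !enormE real_normK ?num_real//.
rewrite -subr_ge0 -(pmulr_rge0 _ yy0).
have := sqr_ge0 (enorm (dot y y *: x - dot x y *: y)); rewrite enormE.
rewrite dotDl !dotDr !(dotNl, dotNr) !(dotZl, dotZr) (dotC y x).
by congr (0 <= _); ring.
Qed.

Lemma enormD x y : enorm (x + y) <= enorm x + enorm y.
Proof.
rewrite -(@ler_pXn2r _ 2) ?nnegrE ?addr_ge0 ?enorm_ge0// enormE.
rewrite dotDl !dotDr (dotC y x) sqrrD -!enormE.
by have := le_trans (ler_norm _) (dot_le x y); rewrite mulr2n; lra.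
Qed.

Lemma enormB x y : enorm (x - y) <= enorm x + enorm y.
Proof. by rewrite -(enormN y) enormD. Qed.

Lemma enormD_ge x y : enorm x - enorm y <= enorm (x + y).
Proof. by rewrite lerBlDr -(enormN y) (le_trans _ (enormD _ _))// addrK. Qed.

Lemma enormB_sq x y : enorm (x + y) ^+ 2 = enorm x ^+ 2 + 2 * dot x y + enorm y ^+ 2.
Proof. by rewrite !enormE dotDl !dotDr (dotC y x); ring. Qed.

Lemma enorm_delta i : enorm (delta_mx ord0 i : 'rV[R]_n) = 1.
Proof.
rewrite /enorm (bigD1 i)//= big1 ?addr0; first by rewrite mxE !eqxx expr1n sqrtr1.
by move=> j ji; rewrite mxE eqxx (negbTE ji) expr0n.
Qed.

End euclid.

(** * Integration along rays *)

Section ray.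
Context {R : realType} {d : nat}.
Hypothesis d0 : (0 < d)%N.
Local Notation lam := (@lebesgue_rV R d).

Definition shell (t : R) (x : 'rV[R]_d) := (1 <= enorm x) && (enorm x < 1 + t).

(** The integral of [r ^- d.+1] over [a / 2 <= r <= a] is [kappa / a ^+ d]. *)
Definition kappa : R := (2 ^+ d - 1) / d%:R.

Lemma kappa_gt0 : 0 < kappa.
Proof. by rewrite divr_gt0 ?ltr0n// subr_gt0 exprn_egt1 ?ltr1n// -lt0n. Qed.

Lemma mfun_shell (t : R) d1 (T : measurableType d1) (f : T -> 'rV[R]_d) :
  measurable_fun setT f -> measurable_fun setT (fun x => shell t (f x)).
Proof. by move=> mf; rewrite /shell; meas. Qed.

Lemma integral_annulus_power (a : R) : 0 < a ->
  (\int[lebesgue_measure]_(r in `[(a / 2)%R, a]) ((r ^+ d.+1)^-1)%:E =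
   (kappa / a ^+ d)%:E)%E.
Proof.
move=> a0.
have d0' : (d%:R : R) != 0 by rewrite pnatr_eq0 -lt0n.
have rN0 r : a / 2 <= r <= a -> r != 0.
  by move=> /andP[r0 _]; rewrite gt_eqF// (lt_le_trans _ r0)// divr_gt0.
have dF r : a / 2 <= r <= a -> is_derive r 1 (fun r => - (d%:R * r ^+ d)^-1) (r ^+ d.+1)^-1.
  move=> /rN0 r0; have dr0 : d%:R * r ^+ d != 0 by rewrite mulf_neq0// expf_neq0.
  apply: (is_derive_eq (derN (derV (f := fun r => d%:R * r ^+ d) dr0 (derM (der_cst _ r) (derX d (der_id r)))))).
  move: d0'; case: d d0 => // m _ /=; set N : R := m.+1%:R => N0; rewrite !exprS; field.
  by rewrite nat1r pnatr_eq0 r0 expf_neq0.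
have cf r : a / 2 <= r <= a -> {for r, continuous (fun r : R => (r ^+ d.+1)^-1)}.
  move=> /rN0 r0; apply: der_continuous.
  exact: (derV (f := fun r => r ^+ d.+1) (expf_neq0 _ r0) (derX _ (der_id r))).
rewrite (FTC_is_derive _ dF cf); last by rewrite ler_pdivrMr// ler_peMr// ?ler1n// ltW.
congr (_%:E); rewrite /kappa exprMn exprVn; field.
by rewrite d0' expf_neq0// gt_eqF.
Qed.

(** Polar coordinates without a surface measure: the directions are the points
    of the annulus [shell 1], weighted by volume.  For fixed [r] the dilation by
    [r] turns the volume of the annulus into [r ^- d] times that of its image,
    and a point [z] lies in the dilated annulus exactly for [r] in an interval
    with endpoints [enorm z / 2] and [enorm z]. *)
Lemma ray_formula (g : 'rV[R]_d -> R) : measurable_fun setT g ->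
  (forall z, 0 <= g z) ->
  (kappa%:E * \int[lam]_z (g z / enorm z ^+ d)%:E =
   \int[lam]_x \int[lebesgue_measure]_r
     ((shell 1 x && (0 < r))%:R * (g (r *: x) / r))%:E)%E.
Proof.
move=> mg g0.
have mgf d1 (T : measurableType d1) (f : T -> 'rV[R]_d) : measurable_fun setT f ->
    measurable_fun setT (fun x => g (f x)) by move=> mf; apply: (measurableT_comp mg).
rewrite (fubini_tonelli (fun p : 'rV[R]_d * measurableTypeR R =>
   ((shell 1 p.1 && (0 < p.2))%:R * (g (p.2 *: p.1) / p.2))%:E))/=; last 2 first.
- apply: mfun_EFin; apply: mfunM; first by apply: mfun_bool; apply: mfun_and; [apply: mfun_shell|]; meas.
  by apply: mfunM; [apply: mgf|]; meas.
- move=> [x r] /=; rewrite lee_fin; case: (ltP 0 r) => [r0|_]; last by rewrite andbF mul0r.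
  by rewrite !mulr_ge0// ?invr_ge0 ?ltW.
have scaled (r : R) : (\int[lam]_x ((shell 1 x && (0 < r))%:R * (g (r *: x) / r))%:E =
   \int[lam]_z (((0 < r) && shell 1 (r^-1 *: z))%:R * (g z / r ^+ d.+1))%:E)%E.
  have [r0|r0] := ltP 0 r; last first.
    by apply: eq_integral => z _; rewrite andbF !mul0r.
  have mF : measurable_fun setT (fun z : 'rV[R]_d => ((shell 1 (r^-1 *: z))%:R * (g z / r))%:E : \bar R).
    apply: mfun_EFin; apply: mfunM; first by apply: mfun_bool; apply: mfun_shell; meas.
    by meas.
  have F0 (z : 'rV[R]_d) : (0 <= ((shell 1 (r^-1 *: z))%:R * (g z / r))%:E)%E.
    by rewrite lee_fin !mulr_ge0// ?invr_ge0 ?ltW.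
  transitivity (\int[lam]_x ((shell 1 (r^-1 *: (r *: x)))%:R * (g (r *: x) / r))%:E)%E.
    apply: eq_integral => x _.
    by rewrite scalerA mulVf ?scale1r ?andbT// gt_eqF.
  rewrite (@integral_scale _ _ r (fun z : 'rV[R]_d => ((shell 1 (r^-1 *: z))%:R * (g z / r))%:E))// ?gt_eqF//.
  rewrite -ge0_integralZl_EFin// ?invr_ge0 ?exprn_ge0//.
  apply: eq_integral => z _; rewrite -EFinM gtr0_norm//; congr (_%:E) => /=.
  by rewrite exprS invfM; ring.
transitivity (\int[lebesgue_measure]_r \int[lam]_z
    (((0 < r) && shell 1 (r^-1 *: z))%:R * (g z / r ^+ d.+1))%:E)%E; last first.
  by apply: eq_integral => r _; rewrite scaled.
rewrite -(fubini_tonelli (fun p : 'rV[R]_d * measurableTypeR R =>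
   (((0 < p.2) && shell 1 (p.2^-1 *: p.1))%:R * (g p.1 / p.2 ^+ d.+1))%:E))/=; last 2 first.
- apply: mfun_EFin; apply: mfunM; first by apply: mfun_bool; apply: mfun_and; [|apply: mfun_shell]; meas.
  by apply: mfunM; [apply: mgf|]; meas.
- move=> [x r] /=; rewrite lee_fin; case: (ltP 0 r) => [r0|_]; last by rewrite mul0r.
  by rewrite !mulr_ge0// ?invr_ge0 ?exprn_ge0 ?ltW.
rewrite -ge0_integralZl_EFin//; last 3 first.
- by move=> z _; rewrite lee_fin mulr_ge0// invr_ge0 exprn_ge0// enorm_ge0.
- by meas.
- exact: ltW kappa_gt0.
apply: eq_integral => z _; rewrite -EFinM.
have [z0|z0] := eqVneq (enorm z) 0.
  rewrite z0 expr0n gtn_eqF// invr0 !mulr0.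
  under eq_integral => r _.
    rewrite /shell enormZ z0 mulr0 leNgt ltr01/= andbF mul0r.
    over.
  by rewrite integral0.
have {}z0 : 0 < enorm z by rewrite lt_def z0 enorm_ge0.
transitivity (g z * (kappa / enorm z ^+ d))%:E; first by congr (_%:E); ring.
have mV : measurable_fun setT (fun r : R => ((r ^+ d.+1)^-1)%:E) by meas.
rewrite EFinM -integral_annulus_power// -integral_itv_obnd_cbnd; last exact: measurable_funTS.
rewrite -ge0_integralZl//; last 3 first.
- exact: measurable_funTS.
- move=> r /=; rewrite in_itv/= lee_fin => /andP[r0 _].
  by rewrite invr_ge0 exprn_ge0// (le_trans _ (ltW r0))// divr_ge0 ?enorm_ge0.
- by rewrite lee_fin.
rewrite [LHS]integral_mkcond; apply: eq_integral => r _; rewrite patchE.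
rewrite mem_setE in_itv/= /shell enormZ.
have [r0|r0] := ltP 0 r; last first.
  by rewrite mul0r ltNge (le_trans r0)//= divr_ge0// enorm_ge0.
rewrite gtr0_norm ?invr_gt0// !(mulrC r^-1) ler_pdivlMr// mul1r !ltr_pdivrMr// (mulrC r) andbC.
rewrite (_ : (1 + 1 : R) = 2)//.
by case: ifP => _; rewrite ?mul1r ?mul0r.
Qed.

Lemma measurable_shell (t : R) : measurable [set x | shell t x].
Proof. exact: mset_bool (@mfun_shell t _ _ (fun x => x) (@measurable_id _ _ _)). Qed.

Lemma lebesgue_bounded (Q : set 'rV[R]_d) (L : R) : measurable Q ->
  (forall x i, Q x -> `|x ord0 i| <= L) -> (lam Q < +oo)%E.
Proof.
move=> mQ QL.
have mB (i : 'I_d) : measurable (`[- L, L]%classic : set R) by [].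
apply: (@le_lt_trans _ _ (lam [set x | forall i, `[- L, L]%classic (x ord0 i)])).
  apply: measure_le => //; first exact: (measurable_box mB).
  by move=> x Qx i; rewrite /= in_itv/= -ler_norml QL.
rewrite (lebesgue_rV_box mB).
rewrite (eq_bigr (fun=> (Num.max 0 (L + L))%:E)); first by rewrite prodEFin ltry.
move=> i _; rewrite lebesgue_measure_itv/= lte_fin.
by case: ltP => h; [rewrite -EFinB opprK|]; congr (_%:E); apply/esym;
  [apply/max_idPr|apply/max_idPl]; lra.
Qed.

Lemma shell_coor (t : R) (x : 'rV[R]_d) i : shell t x -> `|x ord0 i| <= 1 + t.
Proof. by move=> /andP[_ /ltW]; apply: le_trans; exact: enorm_coor. Qed.

Lemma shell_fin (t : R) : (lam [set x | shell t x] < +oo)%E.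
Proof.
apply: (@lebesgue_bounded _ (1 + t)); first exact: measurable_shell.
by move=> x i /shell_coor.
Qed.

(** The shell contains a box lying along the first coordinate axis. *)
Lemma shell_gt0 (t : R) : 0 < t -> (0 < lam [set x | shell t x])%E.
Proof.
move=> t0; pose i0 := Ordinal d0.
have dR : 0 < (d%:R : R) by rewrite ltr0n.
pose A (i : 'I_d) : set R := if i == i0 then `[1, 1 + t / 2]%classic else `[0, t / (4 * d%:R)]%classic.
have mA i : measurable (A i) by rewrite /A; case: ifP.
apply: (@lt_le_trans _ _ (lam [set x | forall i, A i (x ord0 i)])).
  rewrite (lebesgue_rV_box mA).
  rewrite (eq_bigr (fun i => (if i == i0 then t / 2 else t / (4 * d%:R))%:E)).
    rewrite prodEFin lte_fin prodr_gt0// => i _; case: ifP => _; rewrite divr_gt0//.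
    by rewrite mulr_gt0.
  move=> i _; rewrite /A; case: ifP => _; rewrite lebesgue_measure_itv/= lte_fin.
    by rewrite ltrDl divr_gt0// -EFinB addrAC subrr add0r.
  by rewrite divr_gt0 ?mulr_gt0// -EFinB subr0.
apply: measure_le; [exact: (measurable_box mA)|exact: measurable_shell|].
move=> x Ax; apply/andP; split.
  have := Ax i0; rewrite /A eqxx /= in_itv/= => /andP[x1 _].
  by rewrite (le_trans x1)// (le_trans (ler_norm _))// enorm_coor.
apply: (le_lt_trans (enorm_le_sum _)).
apply: (@le_lt_trans _ _ (1 + t / 2 + \sum_(i < d) t / (4 * d%:R))); last first.
  rewrite sumr_const card_ord -[_ *+ d]mulr_natr -addrA ltrD2l.
  rewrite (_ : t / (4 * d%:R) * d%:R = t / 4); first by lra.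
  by field; rewrite gt_eqF.
rewrite (bigD1 i0)//=; apply: lerD.
  have := Ax i0; rewrite /A eqxx /= in_itv/= => /andP[x1 x2].
  by rewrite ger0_norm// (le_trans _ x1).
apply: (@le_trans _ _ (\sum_(i < d | i != i0) t / (4 * d%:R))).
  apply: ler_sum => i /negbTE ii0; have := Ax i.
  by rewrite /A ii0 /= in_itv/= => /andP[y1 y2]; rewrite ger0_norm.
by rewrite [X in _ <= X](bigD1 i0)//= lerDr divr_ge0 ?mulr_ge0 ?(ltW t0).
Qed.

Definition vol_annulus : R := fine (lam [set x | shell 1 x]).

Lemma vol_annulusE : lam [set x | shell 1 x] = vol_annulus%:E.
Proof. by rewrite fineK// ge0_fin_numE ?shell_fin. Qed.

Lemma vol_annulus_gt0 : 0 < vol_annulus.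
Proof. by rewrite -lte_fin -vol_annulusE shell_gt0. Qed.

(** The constant that passes from a bound along every ray to a bound in space. *)
Definition ray_cst : R := vol_annulus / kappa.

Lemma ray_cst_gt0 : 0 < ray_cst.
Proof. by rewrite divr_gt0 ?vol_annulus_gt0 ?kappa_gt0. Qed.

Lemma ray_le (g : 'rV[R]_d -> R) (M : R) : measurable_fun setT g ->
  (forall z, 0 <= g z) -> 0 <= M ->
  (forall x, shell 1 x ->
    \int[lebesgue_measure]_r ((0 < r)%R%:R * (g (r *: x) / r))%:E <= M%:E)%E ->
  (\int[lam]_z (g z / enorm z ^+ d)%:E <= (ray_cst * M)%:E)%E.
Proof.
move=> mg g0 M0 gM.
have k0 := kappa_gt0.
rewrite -(@lee_pmul2l _ kappa%:E)//.
rewrite ray_formula// -EFinM (_ : kappa * _ = M * vol_annulus); last first.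
  by rewrite /ray_cst; field; rewrite gt_eqF.
rewrite EFinM -vol_annulusE -integral_cst; last exact: measurable_shell.
rewrite [X in (_ <= X)%E]integral_mkcond; apply: ge0_le_integral => //.
- move=> x _; apply: integral_ge0 => r _; rewrite lee_fin.
  case: (ltP 0 r) => [r0|_]; last by rewrite andbF mul0r.
  by rewrite !mulr_ge0// ?invr_ge0 ltW.
- apply: (measurable_fun_fubini_tonelli_F (fun p : 'rV[R]_d * measurableTypeR R =>
   ((shell 1 p.1 && (0 < p.2))%:R * (g (p.2 *: p.1) / p.2))%:E)).
    apply: mfun_EFin; apply: mfunM; first by apply: mfun_bool; apply: mfun_and; [apply: mfun_shell|]; meas.
    by apply: mfunM; [apply: (measurableT_comp mg)|]; meas.
  move=> [x r]; rewrite lee_fin /=.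
  case: (ltP 0 r) => [r0|_]; last by rewrite andbF mul0r.
  by rewrite !mulr_ge0// ?invr_ge0 ltW.
- by apply/(measurable_restrictT _ (measurable_shell 1)); exact: measurable_cst.
move=> x _; rewrite patchE; case: (boolP (shell 1 x)) => Ax.
  by rewrite mem_set//; exact: gM.
rewrite memNset; last exact/negP.
by under eq_integral do rewrite mul0r; rewrite integral0.
Qed.

Lemma integral_itv_cst (a b c : R) : a <= b ->
  (\int[lebesgue_measure]_(x in `]a, b[) c%:E = (c * (b - a))%:E)%E.
Proof.
move=> ab; rewrite integral_cst//= lebesgue_measure_itv/= lte_fin.
move: ab; rewrite le_eqVlt => /predU1P[->|ab]; first by rewrite ltxx subrr mulr0 mule0.
by rewrite ab -EFinB -EFinM.
Qed.

(** In polar coordinates the integrand is constant along each ray, and the ray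
    has length at most [b]. *)
Lemma integral_kernel_ball (b : R) : 0 < b ->
  (\int[lam]_z ((enorm z < b)%R%:R * enorm z / enorm z ^+ d)%:E <= (ray_cst * b)%:E)%E.
Proof.
move=> b0; apply: (@ray_le (fun z => (enorm z < b)%R%:R * enorm z)).
- by meas.
- by move=> z; rewrite mulr_ge0// enorm_ge0.
- exact: ltW.
move=> x /andP[x1 _]; have x0 : 0 < enorm x by rewrite (lt_le_trans _ x1).
rewrite (_ : b%:E = \int[lebesgue_measure]_(r in `]0%R, (b / enorm x)%R[) (enorm x)%:E)%E; last first.
  by rewrite integral_itv_cst ?divr_ge0 ?(ltW b0) ?(ltW x0)// subr0 mulrCA divff ?mulr1// gt_eqF.
rewrite [X in (_ <= X)%E]integral_mkcond; apply: le_of_eq; apply: eq_integral => r _.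
rewrite patchE mem_setE in_itv/= enormZ.
have [r0|r0] := ltP 0 r; last by rewrite mul0r.
rewrite gtr0_norm// ltr_pdivlMr//; case: (r * enorm x < b) => /=; last by rewrite !(mul0r, mulr0).
by congr (_%:E); field; rewrite gt_eqF.
Qed.

(** Along each ray the integrand is [r ^- 2] up to scaling; the upper bound
    [B] keeps the interval of integration compact. *)
Lemma integral_kernel_tail (b B : R) : 0 < b -> b < B ->
  (\int[lam]_z (((b <= enorm z) && (enorm z < B))%R%:R * (enorm z)^-1 / enorm z ^+ d)%:E
    <= (ray_cst * b^-1)%:E)%E.
Proof.
move=> b0 bB; apply: (@ray_le (fun z => ((b <= enorm z) && (enorm z < B))%R%:R * (enorm z)^-1)).
- by meas.
- by move=> z; rewrite mulr_ge0// invr_ge0 enorm_ge0.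
- by rewrite invr_ge0 ltW.
move=> x /andP[x1 _]; have x0 : 0 < enorm x by rewrite (lt_le_trans _ x1).
have B0 : 0 < B by rewrite (lt_trans b0).
have rN0 r : b / enorm x <= r <= B / enorm x -> r != 0.
  by move=> /andP[r0 _]; rewrite gt_eqF// (lt_le_trans _ r0)// divr_gt0.
have dF r : b / enorm x <= r <= B / enorm x ->
    is_derive r 1 (fun r => - (enorm x * r)^-1) (enorm x * r ^+ 2)^-1.
  move=> /rN0 r0; have dr0 : enorm x * r != 0 by rewrite mulf_neq0// gt_eqF.
  apply: (is_derive_eq (derN (derV (f := fun r => enorm x * r) dr0 (derM (der_cst _ r) (der_id r))))).
  by field; rewrite r0 gt_eqF.
have cf r : b / enorm x <= r <= B / enorm x -> {for r, continuous (fun r : R => (enorm x * r ^+ 2)^-1)}.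
  move=> /rN0 r0; apply: der_continuous.
  apply: (derV (f := fun r => enorm x * r ^+ 2)).
  by rewrite mulf_neq0 ?expf_neq0// gt_eqF.
apply: (@le_trans _ _ (\int[lebesgue_measure]_(r in `[(b / enorm x)%R, (B / enorm x)%R])
    ((enorm x * r ^+ 2)^-1)%:E)%E); last first.
  rewrite (FTC_is_derive _ dF cf); last by rewrite ler_pM2r ?invr_gt0// ltW.
  have cancel u : enorm x * (u / enorm x) = u by field; rewrite gt_eqF.
  by rewrite lee_fin !cancel opprK addrC gerBl invr_ge0 ltW.
have mV : measurable_fun setT (fun r : R => ((enorm x * r ^+ 2)^-1)%:E) by meas.
rewrite [X in (_ <= X)%E]integral_mkcond; apply: ge0_le_integral => //.
- move=> r _; rewrite lee_fin; have [r0|r0] := ltP 0 r; last by rewrite mul0r.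
  by rewrite !mulr_ge0// invr_ge0 ?enorm_ge0// ltW.
- by meas.
- apply/(measurable_restrictT _ (measurable_itv _)).
  exact: measurable_funTS.
move=> r _; rewrite patchE mem_setE in_itv/= enormZ.
have [r0|r0] := ltP 0 r; last first.
  by rewrite mul0r; case: ifP => _//; rewrite lee_fin invr_ge0 mulr_ge0 ?sqr_ge0 ?enorm_ge0.
rewrite gtr0_norm// ler_pdivrMr// ler_pdivlMr//.
case: (boolP (b <= _)) => br; last by rewrite !mul0r mulr0.
case: (ltP (r * enorm x) B) => rB; rewrite /= ?mul0r ?mulr0.
  by rewrite (ltW rB) lee_fin !mul1r expr2 !invfM; apply: le_of_eq; ring.
by case: ifP => _//; rewrite lee_fin invr_ge0 mulr_ge0 ?sqr_ge0 ?enorm_ge0.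
Qed.

End ray.

(** * Newton's shell theorem *)

Section newton.
Context {R : realType} {d : nat}.
Hypothesis d0 : (0 < d)%N.
Local Notation lam := (@lebesgue_rV R d).
Implicit Types x y z : 'rV[R]_d.

Definition kernel z i : R := z ord0 i / enorm z ^+ d.

Lemma mfun_kernel i d1 (T : measurableType d1) (f : T -> 'rV[R]_d) :
  measurable_fun setT f -> measurable_fun setT (fun t => kernel (f t) i).
Proof. by move=> mf; rewrite /kernel; meas. Qed.

Lemma kernel_le z i : `|kernel z i| <= enorm z / enorm z ^+ d.
Proof.
rewrite normrM normfV (ger0_norm (exprn_ge0 _ (enorm_ge0 _))).
by rewrite ler_wpM2r ?invr_ge0 ?exprn_ge0 ?enorm_ge0// enorm_coor.
Qed.

(** The line through [x] in the direction [xi] meets a spherical shell around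
    the ball in two segments exchanged by the reflection in the foot of the
    perpendicular from the centre, hence of the same length. *)
Lemma shell_chord t x xi : enorm x < 1 -> xi != 0 ->
  lebesgue_measure [set r | (0 < r) && shell t (r *: xi + x)] =
  lebesgue_measure [set r | (0 < r) && shell t (- r *: xi + x)].
Proof.
move=> x1 xi0.
have xi20 : 0 < dot xi xi by rewrite -enormE exprn_gt0// lt_def enorm_eq0 xi0 enorm_ge0.
pose b := dot x xi / dot xi xi.
have sym (r : R) : enorm (- r *: xi + x) = enorm ((r - 2 * b) *: xi + x).
  apply/eqP; rewrite -(@eqrXn2 _ 2) ?enorm_ge0// !enormB_sq; apply/eqP.
  rewrite !enormE !dotZl !dotZr (dotC xi x).
  by rewrite /b; field; rewrite gt_eqF.
have side (r : R) : 1 <= enorm (- r *: xi + x) -> 0 < r * (r - 2 * b).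
  rewrite -(@ler_pXn2r _ 2) ?nnegrE ?enorm_ge0// expr1n enormB_sq => h.
  have : enorm x ^+ 2 < 1 by rewrite expr_lt1 ?enorm_ge0.
  move: h; rewrite !enormE !dotZl !dotZr (dotC xi x) => h h'.
  rewrite -(pmulr_rgt0 _ xi20).
  have -> : dot xi xi * (r * (r - 2 * b)) = - r * (- r * dot xi xi) + 2 * (- r * dot x xi).
    by rewrite /b; field; rewrite gt_eqF.
  by lra.
have mU : measurable [set r | (0 < r) && shell t (r *: xi + x)].
  apply: mset_bool; apply: mfun_and; first by meas.
  by apply: mfun_shell; meas.
have := lebesgue_measure_affine (- (2 * b)) (oner_neq0 R) mU.
rewrite normr1 invr1 mul1e => <-; congr lebesgue_measure.
apply/seteqP; split => r /=; rewrite mul1r => /andP[r0]; rewrite /shell => h.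
  rewrite sym h andbT; have /andP[+ _] := h; rewrite -sym => /side.
  by rewrite pmulr_lgt0.
rewrite -sym h andbT; have /andP[/side + _] := h.
by rewrite pmulr_rgt0.
Qed.

Let ray_part (s : R) t x i xi : R -> R := fun r =>
  (shell 1 xi && (0 < r))%:R *
  ((shell t (r *: xi + x))%:R * Num.max 0 (s * (r *: xi) ord0 i) / r).

Let pull (s : R) t x i y : R :=
  (shell t y)%:R * Num.max 0 (s * (y - x) ord0 i) / enorm (y - x) ^+ d.

(** Polar coordinates centred at [x] turn the positive part of the force into an
    integral, over the directions [xi] with [0 < s * xi ord0 i], of the length of
    the chord from [x] along [xi].  Opposite chords have the same length. *)
Lemma newton_parts (s : R) t x i : enorm x < 1 ->
  (\int[lam]_y (pull s t x i y)%:E =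
   \int[lam]_y (pull (- s) t x i y)%:E)%E.
Proof.
move=> x1; have polar (s' : R) : ((@kappa R d)%:E *
    \int[lam]_y (pull s' t x i y)%:E =
    \int[lam]_xi \int[lebesgue_measure]_r (ray_part s' t x i xi r)%:E)%E.
  rewrite /pull -(integral_shift x); last 2 first.
  - apply: mfun_EFin; apply: mfunM; last by meas.
    by apply: mfunM; [apply: mfun_bool; apply: mfun_shell|]; meas.
  - move=> y; rewrite lee_fin !mulr_ge0// ?le_max ?lexx//.
    by rewrite invr_ge0 exprn_ge0 ?enorm_ge0.
  under eq_integral do rewrite addrK.
  apply: (@ray_formula _ _ _ (fun z => (shell t (z + x))%:R * Num.max 0 (s' * z ord0 i))) => //.
  - by apply: mfunM; [apply: mfun_bool; apply: mfun_shell|]; meas.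
  - by move=> z; rewrite mulr_ge0// le_max lexx.
have mray (s' : R) : measurable_fun setT (fun p : 'rV[R]_d * measurableTypeR R => (ray_part s' t x i p.1 p.2)%:E).
  apply: mfun_EFin; apply: mfunM.
    by apply: mfun_bool; apply: mfun_and; [apply: mfun_shell|]; meas.
  apply: mfunM; last by meas.
  by apply: mfunM; [apply: mfun_bool; apply: mfun_shell|]; meas.
have ray0 (s' : R) (p : 'rV[R]_d * measurableTypeR R) : (0 <= (ray_part s' t x i p.1 p.2)%:E)%E.
  rewrite lee_fin /ray_part; case: (ltP 0 p.2) => [r0|_]; last by rewrite andbF mul0r.
  by rewrite !mulr_ge0// ?le_max ?lexx// invr_ge0 ltW.
have k0 := kappa_gt0 (R := R) d0.
have cancel (X : \bar R) : X = (((@kappa R d)^-1)%:E * ((@kappa R d)%:E * X))%E.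
  by rewrite muleA -EFinM mulVf ?mul1e// gt_eqF.
rewrite [LHS]cancel [RHS]cancel !polar; congr (_ * _)%E.
pose G s' xi : \bar R := (\int[lebesgue_measure]_r (ray_part s' t x i xi r)%:E)%E.
have mG s' : measurable_fun setT (G s').
  exact: (measurable_fun_fubini_tonelli_F _ (mray s') (ray0 s')).
have G0 s' xi : (0 <= G s' xi)%E.
  by apply: integral_ge0 => r _; exact: (ray0 s' (xi, r)).
have N1 : (- 1 : R) != 0 by rewrite oppr_eq0 oner_neq0.
have := integral_scale N1 (mG (- s)) (G0 (- s)).
rewrite normrN1 expr1n invr1 mul1e => <-; apply: eq_integral => xi _.
rewrite scaleN1r /G /ray_part /shell enormN -/(shell 1 xi).
have [Axi|] := boolP (shell 1 xi); last first.
  by move=> _; under eq_integral do rewrite mul0r; under [RHS]eq_integral do rewrite mul0r.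
have xi0 : xi != 0.
  by apply: contraTneq Axi => ->; rewrite /shell enorm0 lt_geF.
have chord s' eta : (\int[lebesgue_measure]_r ((0 < r)%R%:R *
    ((shell t (r *: eta + x))%:R * Num.max 0 (s' * (r *: eta) ord0 i) / r))%:E =
   (Num.max 0 (s' * eta ord0 i))%:E *
   lebesgue_measure [set r | (0 < r)%R && shell t (r *: eta + x)])%E.
  rewrite -integral_cst; last first.
    by apply: mset_bool; apply: mfun_and; [|apply: mfun_shell]; meas.
  rewrite /cst -integral_bool; apply: eq_integral => r _; congr (_%:E).
  have [r0|r0] := ltP 0 r; last by rewrite !mul0r.
  rewrite andTb mul1r mxE mulrCA -{1}(mulr0 r) -maxr_pMr ?(ltW r0)//.
  by field; rewrite gt_eqF.
have := chord s xi; rewrite /shell => ->; have := chord (- s) (- xi); rewrite /shell => ->.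
rewrite mxE mulrNN; congr (_ * _)%E; rewrite -/(shell t).
have := @shell_chord t x xi x1 xi0; rewrite /shell => ->; congr lebesgue_measure.
by apply/seteqP; split => r /=; rewrite scaleNr scalerN.
Qed.

Lemma newton_part_fin (s : R) t x i : `|s| = 1 -> 0 < t -> enorm x < 1 ->
  (\int[lam]_y (pull s t x i y)%:E
    < +oo)%E.
Proof.
move=> s1 t0 x1; rewrite /pull; apply: (@le_lt_trans _ _ (@ray_cst R d * (2 + t))%:E); last exact: ltry.
rewrite -(integral_shift x); last 2 first.
- apply: mfun_EFin; apply: mfunM; last by meas.
  by apply: mfunM; [apply: mfun_bool; apply: mfun_shell|]; meas.
- move=> y; rewrite lee_fin !mulr_ge0// ?le_max ?lexx//.
  by rewrite invr_ge0 exprn_ge0 ?enorm_ge0.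
apply: le_trans (integral_kernel_ball d0 _); last by rewrite addr_gt0.
apply: ge0_le_integralT; last first.
  move=> z; rewrite addrK ler_wpM2r ?invr_ge0 ?exprn_ge0 ?enorm_ge0//.
  case: (boolP (shell t (z + x))) => zx; last by rewrite mul0r mulr_ge0 ?enorm_ge0.
  rewrite (_ : enorm z < 2 + t).
    rewrite !mul1r ge_max enorm_ge0/= (le_trans (ler_norm _))// normrM s1 mul1r.
    exact: enorm_coor.
  have /andP[_ zx1] := zx; have := enormB (z + x) x; rewrite addrK; lra.
- by meas.
- apply: mfunM; last by meas.
  by apply: mfunM; [apply: mfun_bool; apply: mfun_shell|]; meas.
by move=> z; rewrite !mulr_ge0// ?le_max ?lexx// invr_ge0 exprn_ge0 ?enorm_ge0.
Qed.

(** The positive and the negative part have the same finite integral. *)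
Lemma newton t x i : 0 < t -> enorm x < 1 ->
  (\int[lam]_(y in [set y | shell t y]) (kernel (y - x) i)%:E = 0)%E.
Proof.
move=> t0 x1; rewrite integral_mkcond integralE.
have part (s : R) (y : 'rV[R]_d) : (pull s t x i y)%:E =
    maxe (s%:E * ((fun y => (kernel (y - x) i)%:E) \_ [set y | shell t y]) y)%E 0%E.
  rewrite /pull patchE; case: (boolP (shell t y)) => ty.
    rewrite mem_set// -EFinM -EFin_max; congr (_%:E).
    rewrite mul1r maxr_pMl ?invr_ge0 ?exprn_ge0 ?enorm_ge0// mul0r maxC.
    by rewrite /kernel mulrA.
  by rewrite memNset ?mul0r ?mule0 ?maxxx//; exact/negP.
have -> : (\int[lam]_y ((fun y => (kernel (y - x) i)%:E) \_ [set y | shell t y])^\+ y =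
    \int[lam]_y (pull 1 t x i y)%:E)%E.
  by apply: eq_integral => y _; rewrite part mul1e funeposE.
have -> : (\int[lam]_y ((fun y => (kernel (y - x) i)%:E) \_ [set y | shell t y])^\- y =
    \int[lam]_y (pull (- 1) t x i y)%:E)%E.
  by apply: eq_integral => y _; rewrite part EFinN mulN1e funenegE.
rewrite newton_parts// subee// ge0_fin_numE; last first.
  apply: integral_ge0 => y _; rewrite part; rewrite le_max lexx orbT//.
by apply: newton_part_fin => //; rewrite normrN1.
Qed.

End newton.

(** * Thin slabs and thin cones *)

Section slab_cone.
Context {R : realType} {n : nat}.
Local Notation lam := (@lebesgue_rV R n.+1).
Implicit Types x p e : 'rV[R]_n.+1.

Let box2 x : R := \prod_l (`|x ord0 l| <= 2)%R%:R.

Let mbox2 d1 (T : measurableType d1) (f : T -> 'rV[R]_n.+1) :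
  measurable_fun setT f -> measurable_fun setT (fun t => box2 (f t)).
Proof. by move=> mf; rewrite /box2; meas. Qed.

Let box2_ge0 x : 0 <= box2 x. Proof. exact: prodr_ge0. Qed.

Let box2_perm (s : {perm 'I_n.+1}) x : box2 (col_perm s x) = box2 x.
Proof.
rewrite /box2 [RHS](reindex_inj (@perm_inj _ s))/=.
by apply: eq_bigr => i _; rewrite mxE.
Qed.

Let shell_box2 x : (shell 1 x)%:R <= box2 x.
Proof.
have [sx|_] := boolP (shell 1 x); last by [].
rewrite /box2 big1// => l _; have := shell_coor l sx.
by rewrite (_ : 1 + 1 = 2 :> R)// => ->.
Qed.

Lemma dot_col_perm (s : {perm 'I_n.+1}) x y : dot (col_perm s x) (col_perm s y) = dot x y.
Proof.
rewrite /dot [RHS](reindex_inj (@perm_inj _ s))/=.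
by apply: eq_bigr => i _; rewrite !mxE.
Qed.

Lemma enorm_col_perm (s : {perm 'I_n.+1}) x : enorm (col_perm s x) = enorm x.
Proof.
by apply/eqP; rewrite -(@eqrXn2 _ 2) ?enorm_ge0// !enormE dot_col_perm.
Qed.

Lemma col_perm_tpermK (i j : 'I_n.+1) x : col_perm (tperm i j) (col_perm (tperm i j) x) = x.
Proof. by apply/rowP => l; rewrite !mxE tpermK. Qed.

Let integral_abs2 : (\int[lebesgue_measure]_s ((`|s : R| <= 2)%R%:R)%:E = (4 : R)%:E)%E.
Proof.
transitivity (\int[lebesgue_measure]_(s in `[(- 2)%R, 2%R]) cst (1%:E : \bar R) s)%E.
  rewrite [RHS]integral_mkcond; apply: eq_integral => s _.
  by rewrite patchE mem_setE in_itv/= ler_norml; case: ifP.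
rewrite integral_cst//= mul1e lebesgue_measure_itv/= lte_fin ifT; last lra.
by rewrite -EFinB; congr (_%:E); lra.
Qed.

Let integral_abs_le2 (k : nat) :
  (\int[lebesgue_rV k]_y (\prod_l (`|y ord0 l| <= 2)%R%:R)%:E <= (4 ^+ k)%:E :> \bar R)%E.
Proof.
apply: (@integral_rV_prod_le R k (fun _ s => (`|s| <= 2)%R%:R)) => //.
- by move=> i; meas.
by move=> i; rewrite integral_abs2.
Qed.

Let mslab p (c : R) : measurable_fun setT (fun x => (box2 x * (`|dot p x| < c)%R%:R)%:E).
Proof. by apply: mfun_EFin; apply: mfunM; [exact: mbox2|rewrite /dot; meas]. Qed.

(** Integrating first over coordinate [ord0], the slab meets each line in an
    interval of length [2 * c / `|p ord0 ord0|]. *)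
Let slab0 p (c : R) : 0 < c -> p ord0 ord0 != 0 ->
  (\int[lam]_x (box2 x * (`|dot p x| < c)%R%:R)%:E <=
     (2 * c / `|p ord0 ord0| * 4 ^+ n)%:E)%E.
Proof.
move=> c0 p0.
have mf := mslab p c.
have f0 x : (0 <= (box2 x * (`|dot p x| < c)%R%:R)%:E)%E by rewrite lee_fin mulr_ge0.
have mcons := @measurable_rV_cons R n.
rewrite integral_rV_cons//.
rewrite (fubini_tonelli (fun q => (box2 (rV_cons q) * (`|dot p (rV_cons q)| < c)%R%:R)%:E)); last 2 first.
- exact: (measurableT_comp mf mcons).
- by move=> q; exact: f0.
pose w : \bar R := (2 * c / `|p ord0 ord0|)%:E.
have w0 : (0 <= w)%E by rewrite lee_fin divr_ge0// mulr_ge0// ltW.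
apply: (@le_trans _ _ (\int[lebesgue_rV n]_y (w * (\prod_l (`|y ord0 l| <= 2)%R%:R)%:E))%E); last first.
  rewrite ge0_integralZl//; last 2 first.
  - by meas.
  - by move=> y _; rewrite lee_fin prodr_ge0.
  by rewrite [X in (_ <= X)%E]EFinM; apply: lee_wpmul2l.
apply: ge0_le_integral => //.
- by move=> y _; apply: integral_ge0 => s _; exact: f0.
- apply: (measurable_fun_fubini_tonelli_G (fun q => (box2 (rV_cons q) * (`|dot p (rV_cons q)| < c)%R%:R)%:E)).
    exact: (measurableT_comp mf mcons).
  by move=> q; exact: f0.
- by apply: emeasurable_funM => //; apply: mfun_EFin; meas.
move=> y _.
pose b := \sum_(l < n) p ord0 (lift ord0 l) * y ord0 l.
have dotE (s : R) : dot p (rV_cons (s, y)) = p ord0 ord0 * s + b.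
  rewrite /dot big_ord_recl rV_consE0; congr (_ + _).
  by apply: eq_bigr => l _; rewrite rV_consES.
have mpre : measurable ((fun s : R => p ord0 ord0 * s + b) @^-1` `]- c, c[%classic).
  rewrite -[X in measurable X]setTI; apply: (_ : measurable_fun setT _) => //.
  by apply: mfunD; [apply: mfunM; [exact: mfunC|exact: measurable_id]|exact: mfunC].
have -> : w = lebesgue_measure ((fun s : R => p ord0 ord0 * s + b) @^-1` `]- c, c[%classic).
  rewrite lebesgue_measure_affine// lebesgue_measure_itv/= lte_fin ifT; last lra.
  by rewrite -EFinB -EFinM /w; congr (_%:E); field; rewrite normr_eq0.
rewrite [X in (_ <= X)%E]muleC -integral_cst//.
rewrite [X in (_ <= X)%E]integral_mkcond; apply: ge0_le_integral => //.
- have msy : measurable_fun setT (fun s : measurableTypeR R => (s, y)) by apply: measurable_fun_pair.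
  exact: (measurableT_comp mf (measurableT_comp mcons msy)).
- by apply/(measurable_restrictT _ mpre); exact: measurable_cst.
move=> s _; rewrite patchE.
have -> : box2 (rV_cons (s, y)) = (`|s| <= 2)%R%:R * \prod_l (`|y ord0 l| <= 2)%R%:R.
  rewrite /box2 big_ord_recl rV_consE0; congr (_ * _).
  by apply: eq_bigr => l _; rewrite rV_consES.
rewrite dotE; have [bs|bs] := boolP (`|p ord0 ord0 * s + b| < c).
  rewrite mem_set; last by rewrite /= in_itv/= -ltr_norml.
  by rewrite mulr1 lee_fin ler_piMl ?prodr_ge0// lern1 leq_b1.
by rewrite mulr0; case: ifP => _ //; rewrite lee_fin prodr_ge0.
Qed.

(** Some coordinate of a unit vector is at least [n.+1%:R^-1] in absolute value;
    a transposition makes it the first one. *)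
Lemma slab_le p (c : R) : 0 < c -> enorm p = 1 ->
  (\int[lam]_x ((shell 1 x)%:R * (`|dot p x| < c)%R%:R)%:E <=
     (2 * n.+1%:R * 4 ^+ n * c)%:E)%E.
Proof.
move=> c0 p1.
have [i pi] : exists i, n.+1%:R^-1 <= `|p ord0 i|.
  apply: contrapT => /forallNP small.
  have : enorm p < \sum_(i < n.+1) n.+1%:R^-1.
    apply: (le_lt_trans (enorm_le_sum p)); apply: ltr_sum.
      by apply/hasP; exists ord0 => //; exact: mem_index_enum.
    by move=> i _; rewrite ltNge; apply/negP/small.
  by rewrite p1 sumr_const card_ord -[_ *+ n.+1]mulr_natr mulVf ?ltxx.
have pi0 : 0 < `|p ord0 i| by rewrite (lt_le_trans _ pi)// invr_gt0.
pose s := tperm ord0 i.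
have mf := mslab p c.
apply: (@le_trans _ _ (\int[lam]_x (box2 x * (`|dot p x| < c)%R%:R)%:E)%E).
  apply: ge0_le_integral => //.
  - apply: mfun_EFin; apply: mfunM; last by rewrite /dot; meas.
    by apply: mfun_bool; apply: mfun_shell; meas.
  - by move=> x _; rewrite lee_fin ler_wpM2r.
rewrite -(integral_perm s)//; last by move=> x; rewrite lee_fin mulr_ge0.
have -> : (\int[lam]_x (box2 (col_perm s x) * (`|dot p (col_perm s x)| < c)%R%:R)%:E =
    \int[lam]_x (box2 x * (`|dot (col_perm s p) x| < c)%R%:R)%:E)%E.
  apply: eq_integral => x _; rewrite box2_perm -(dot_col_perm s p).
  by rewrite col_perm_tpermK.
have sp : (col_perm s p) ord0 ord0 = p ord0 i by rewrite mxE tpermL.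
apply: le_trans (slab0 c0 _) _; first by rewrite sp -normr_gt0.
rewrite sp lee_fin.
have pN : `|p ord0 i|^-1 <= n.+1%:R by rewrite -[leRHS]invrK lef_pV2 ?posrE ?invr_gt0.
rewrite (_ : _ * 4 ^+ n = 2 * 4 ^+ n * c * `|p ord0 i|^-1); last by ring.
rewrite (_ : 2 * n.+1%:R * 4 ^+ n * c = 2 * 4 ^+ n * c * n.+1%:R); last by ring.
by rewrite ler_wpM2l// !mulr_ge0 ?exprn_ge0// ltW.
Qed.

Lemma integral_cauchy (h c b : R) : 0 < h -> 0 < c ->
  (\int[lebesgue_measure]_s ((`|s| <= 2)%R%:R * (h ^+ 2 / (h ^+ 2 + c ^+ 2 * (s - b) ^+ 2)))%:E
    <= (pi * h / c)%:E)%E.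
Proof.
move=> h0 c0.
have den (s : R) : 0 < h ^+ 2 + c ^+ 2 * (s - b) ^+ 2.
  by rewrite ltr_pwDl ?exprn_gt0// mulr_ge0 ?sqr_ge0.
have dF (s : R) : - 2 <= s <= 2 -> is_derive s 1 (fun s => h / c * atan (c / h * (s - b)))
    (h ^+ 2 / (h ^+ 2 + c ^+ 2 * (s - b) ^+ 2)).
  move=> _.
  have dlin : is_derive s 1 (fun s => c / h * (s - b)) (0 * (s - b) + c / h * (1 + - 0)).
    exact: (derM (der_cst _ _) (derD (der_id _) (derN (der_cst _ _)))).
  have datan := @is_derive1_comp _ atan (fun s => c / h * (s - b)) s _ _ (is_derive1_atan _) dlin.
  apply: (is_derive_eq (derM (der_cst (h / c) _) datan)).
  field.
  by rewrite !gt_eqF//; have := den s; rewrite exprMn.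
have cf (s : R) : - 2 <= s <= 2 -> {for s, continuous (fun s => h ^+ 2 / (h ^+ 2 + c ^+ 2 * (s - b) ^+ 2))}.
  move=> _; have dden := derD (der_cst (h ^+ 2) s) (derM (der_cst (c ^+ 2) s)
    (derX 2 (derD (der_id s) (derN (der_cst b s))))).
  have dinv := derV (f := fun s => h ^+ 2 + c ^+ 2 * (s - b) ^+ 2) (lt0r_neq0 (den s)) dden.
  exact: der_continuous (derM (der_cst (h ^+ 2) s) dinv).
rewrite integral_bool (_ : [set s : R | `|s| <= 2] = `[(- 2)%R, 2%R]%classic); last first.
  by apply/seteqP; split => s /=; rewrite in_itv/= ler_norml.
rewrite (FTC_is_derive _ dF cf); last by lra.
rewrite lee_fin -mulrBr.
have := @atan_ltpi2 R (c / h * (2 - b)); have := @atan_gtNpi2 R (c / h * (- 2 - b)).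
move=> a1 a2; rewrite (_ : pi * h / c = h / c * pi); last by ring.
by rewrite ler_pM2l ?divr_gt0//; lra.
Qed.

(** With [x ord0 ord0] fixed, the integrand is bounded by a product of Cauchy
    densities in the other coordinates, centred on the line through [e]. *)
Let cone0 e (tau h : R) (T : 'rV[R]_n.+1 -> R) : 0 < tau -> 0 < h ->
  measurable_fun setT T -> (forall l, `|e ord0 l| <= `|e ord0 ord0|) ->
  (\int[lam]_x ((shell 1 x)%:R * (tau <= T x)%R%:R *
      (h ^+ 2 / (h ^+ 2 + enorm (T x *: x - e) ^+ 2)) ^+ n)%:E <=
    (4 * (2 * pi * h / tau) ^+ n)%:E)%E.
Proof.
move=> tau0 h0 mT emax; pose c := tau / 2; have c0 : 0 < c by rewrite divr_gt0.
pose a l := e ord0 l / e ord0 ord0.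
have ea l : e ord0 l = a l * e ord0 ord0.
  have [e0|e0] := eqVneq (e ord0 ord0) 0; last by rewrite /a divfK.
  by have := emax l; rewrite e0 mulr0 normr0 normr_le0 => /eqP.
have a1 l : `|a l| <= 1.
  have [e0|e0] := eqVneq (e ord0 ord0) 0; first by rewrite /a e0 invr0 mulr0 normr0.
  by rewrite /a normrM normfV ler_pdivrMr ?normr_gt0// mul1r.
pose g (s : R) (l : 'I_n) (u : R) := (`|u| <= 2)%R%:R *
  (h ^+ 2 / (h ^+ 2 + c ^+ 2 * (u - a (lift ord0 l) * s) ^+ 2)).
have den (u : R) : 0 < h ^+ 2 + c ^+ 2 * u ^+ 2.
  by rewrite ltr_pwDl ?exprn_gt0// mulr_ge0 ?sqr_ge0.
have g0 s l u : 0 <= g s l u by rewrite mulr_ge0// divr_ge0 ?sqr_ge0// ltW.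
have mshell : measurable_fun setT (fun x : 'rV[R]_n.+1 => (shell 1 x)%:R : R).
  by apply: mfun_bool; apply: mfun_shell; meas.
apply: (@le_trans _ _ (\int[lam]_x ((`|x ord0 ord0| <= 2)%R%:R *
    \prod_(l < n) g (x ord0 ord0) l (x ord0 (lift ord0 l)))%:E)%E).
  apply: ge0_le_integral => //.
  - move=> x _; rewrite lee_fin mulr_ge0// exprn_ge0// divr_ge0 ?sqr_ge0//.
    by rewrite addr_ge0 ?sqr_ge0.
  - by apply: mfun_EFin; apply: mfunM; [apply: mfunM|]; meas.
  - by apply: mfun_EFin; rewrite /g; meas.
  move=> x _; rewrite lee_fin.
  have rhs0 : 0 <= (`|x ord0 ord0| <= 2)%R%:R *
    \prod_(l < n) g (x ord0 ord0) l (x ord0 (lift ord0 l)) by rewrite mulr_ge0// prodr_ge0.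
  have [sx|_] := boolP (shell 1 x); last by rewrite !mul0r.
  have [Tx|_] := boolP (tau <= T x); last by rewrite mulr0 mul0r.
  have x2 l : `|x ord0 l| <= 2 by have := shell_coor l sx; rewrite (_ : 1 + 1 = 2 :> R).
  rewrite x2 !mul1r.
  apply: (@le_trans _ _ (\prod_(l < n) (h ^+ 2 / (h ^+ 2 + enorm (T x *: x - e) ^+ 2)))).
    by rewrite prodr_const card_ord.
  apply: ler_prod => l _; rewrite divr_ge0 ?addr_ge0 ?sqr_ge0//= /g x2 mul1r.
  rewrite ler_pM2l ?exprn_gt0// lef_pV2 ?posrE//; last by rewrite ltr_pwDl ?exprn_gt0 ?sqr_ge0.
  rewrite lerD2l -exprMn -[leLHS]real_normK ?num_real// ler_pXn2r ?nnegrE ?enorm_ge0//.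
  set L := lift ord0 l; set v := T x *: x - e.
  have vE : T x * (x ord0 L - a L * x ord0 ord0) = v ord0 L - a L * v ord0 ord0.
    by rewrite /v !mxE ea; ring.
  have := ler_normB (v ord0 L) (a L * v ord0 ord0); rewrite -vE normrM.
  have v1 := enorm_coor v L; have v2 : `|a L * v ord0 ord0| <= enorm v.
    by rewrite normrM (le_trans _ (enorm_coor v ord0))// ler_piMl.
  have T0 : 0 < T x by rewrite (lt_le_trans tau0).
  rewrite (gtr0_norm T0) => h1; rewrite normrM (gtr0_norm c0) /c.
  have : tau * `|x ord0 L - a L * x ord0 ord0| <= T x * `|x ord0 L - a L * x ord0 ord0|.
    by rewrite ler_wpM2r.
  by move=> h2; lra.
have mg : measurable_fun setT (fun x : 'rV[R]_n.+1 => ((`|x ord0 ord0| <= 2)%R%:R *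
    \prod_(l < n) g (x ord0 ord0) l (x ord0 (lift ord0 l)))%:E).
  by apply: mfun_EFin; rewrite /g; meas.
rewrite integral_rV_cons//; last by move=> x; rewrite lee_fin mulr_ge0// prodr_ge0.
pose M := 2 * pi * h / tau.
have M0 : 0 <= M by rewrite divr_ge0 ?(ltW tau0)// !mulr_ge0 ?pi_ge0 ?ltW.
apply: (@le_trans _ _ (\int[lebesgue_measure]_s ((M ^+ n)%:E * ((`|s| <= 2)%R%:R)%:E))%E); last first.
  rewrite ge0_integralZl_EFin ?exprn_ge0//; last by meas.
  rewrite (_ : 4 * _ = M ^+ n * 4); last by rewrite mulrC.
  rewrite EFinM; apply: lee_wpmul2l; first by rewrite lee_fin exprn_ge0.
  by rewrite integral_abs2.
have mcons := @measurable_rV_cons R n.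
apply: ge0_le_integral => //.
- by move=> s _; apply: integral_ge0 => y _; rewrite lee_fin mulr_ge0// prodr_ge0.
- apply: (measurable_fun_fubini_tonelli_F (fun q => ((`|rV_cons q ord0 ord0| <= 2)%R%:R *
    \prod_(l < n) g (rV_cons q ord0 ord0) l (rV_cons q ord0 (lift ord0 l)))%:E)).
    exact: (measurableT_comp mg mcons).
  by move=> q; rewrite lee_fin mulr_ge0// prodr_ge0.
- by apply: emeasurable_funM => //; apply: mfun_EFin; meas.
move=> s _; rewrite -EFinM mulrC EFinM.
have [s2|s2] := boolP (`|s| <= 2); last first.
  rewrite mul0e; under eq_integral do rewrite rV_consE0 (negbTE s2) mul0r.
  by rewrite integral0.
rewrite mul1e.
under eq_integral => y _.
  rewrite rV_consE0 s2 mul1r; under eq_bigr do rewrite rV_consES.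
  over.
apply: (@integral_rV_prod_le R n (g s) M) => //.
  by move=> l; rewrite /g; meas.
move=> l; have := integral_cauchy (a (lift ord0 l) * s) h0 c0.
by rewrite (_ : pi * h / c = M)// /M /c; field; rewrite gt_eqF.
Qed.

(** A thin neighbourhood of a line through the origin has small volume: a
    point [x] with [T x *: x] near [e] has its coordinates determined, up to
    [2 / tau] times that distance, by the one in which [e] is largest. *)
Lemma cone_le e (tau h : R) (T : 'rV[R]_n.+1 -> R) : 0 < tau -> 0 < h ->
  measurable_fun setT T ->
  (\int[lam]_x ((shell 1 x)%:R * (tau <= T x)%R%:R *
      (h ^+ 2 / (h ^+ 2 + enorm (T x *: x - e) ^+ 2)) ^+ n)%:E <=
    (4 * (2 * pi * h / tau) ^+ n)%:E)%E.
Proof.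
move=> tau0 h0 mT.
have mshell : measurable_fun setT (fun x : 'rV[R]_n.+1 => (shell 1 x)%:R : R).
  by apply: mfun_bool; apply: mfun_shell; meas.
pose i := [arg max_(l > ord0) `|e ord0 l|]%O.
pose s := tperm ord0 i.
have mcol : measurable_fun setT (fun x : 'rV[R]_n.+1 => col_perm s x).
  by apply: mfun_rV => l; under eq_fun do rewrite mxE; exact: measurable_coor.
rewrite -(integral_perm s); last 2 first.
- by apply: mfun_EFin; apply: mfunM; [apply: mfunM|]; meas.
- move=> x; rewrite lee_fin mulr_ge0// exprn_ge0// divr_ge0 ?sqr_ge0//.
  by rewrite addr_ge0 ?sqr_ge0.
have emax l : `|(col_perm s e) ord0 l| <= `|(col_perm s e) ord0 ord0|.
  by rewrite !mxE tpermL /i; case: arg_maxP => // j _ /(_ (s l)); apply.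
have mTs := measurableT_comp mT mcol.
apply: le_trans (cone0 tau0 h0 mTs emax); apply: le_of_eq; apply: eq_integral => x _.
congr (_%:E); congr (_ * _ * _ ^+ _); first by rewrite /shell enorm_col_perm.
congr (_ / (_ + _ ^+ 2)); rewrite -(enorm_col_perm s); congr enorm.
by apply/rowP => l; rewrite !mxE /s tpermK.
Qed.

End slab_cone.

(** * Lower bound *)

Section test_potential.
Context {R : realType} {d N : nat}.
Variables (m : nat) (h : R) (p : 'I_N -> 'rV[R]_d).
Hypothesis h0 : 0 < h.
Implicit Types x y z : 'rV[R]_d.

(** The power [m] will be the dimension of the sphere: it makes the bump decay
    fast enough for its mean over the directions to be of order [h ^+ m]. *)
Definition bump z : R := (h ^+ 2 / (h ^+ 2 + enorm z ^+ 2)) ^+ m.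

Definition bump_sum y : R := \sum_k bump (y - p k).

(** A smooth substitute for [h] times the indicator of the [h]-neighbourhood of
    the points, whose slope stays bounded when many points cluster. *)
Definition potential y : R := h - h / (1 + bump_sum y).

Definition grad_bump z : 'rV[R]_d := (- (2 * m%:R) / (h ^+ 2 + enorm z ^+ 2) * bump z) *: z.

Definition grad_potential y : 'rV[R]_d :=
  (h / (1 + bump_sum y) ^+ 2) *: \sum_k grad_bump (y - p k).

Lemma bump_den z : 0 < h ^+ 2 + enorm z ^+ 2.
Proof. by rewrite ltr_pwDl ?exprn_gt0 ?sqr_ge0. Qed.

Lemma bump_ge0 z : 0 <= bump z.
Proof. by rewrite exprn_ge0// divr_ge0 ?sqr_ge0// ltW// bump_den. Qed.

Lemma bump0 : bump 0 = 1.
Proof. by rewrite /bump enorm0 expr0n addr0 divff ?expr1n// expf_neq0// gt_eqF. Qed.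

Lemma bump_sum_ge0 y : 0 <= bump_sum y.
Proof. by apply: sumr_ge0 => k _; exact: bump_ge0. Qed.

Lemma potential_den y : 0 < 1 + bump_sum y.
Proof. by rewrite ltr_pwDl// bump_sum_ge0. Qed.

Lemma potential_point k : h / 2 <= potential (p k).
Proof.
rewrite /potential lerBrDl addrC -lerBrDl.
rewrite (_ : h - h / 2 = h / 2); last by field.
rewrite ler_pM2l// lef_pV2 ?posrE ?potential_den//.
rewrite -[leLHS]/(1 + 1) lerD2l /bump_sum (bigD1 k)//= subrr bump0 lerDl.
by apply: sumr_ge0 => j _; exact: bump_ge0.
Qed.

Lemma potential_le1 y : potential y <= h.
Proof. by rewrite gerBl divr_ge0 ?ltW// potential_den. Qed.

Lemma potential_le_sum y : potential y <= h * bump_sum y.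
Proof.
have S0 := bump_sum_ge0 y; have D0 := potential_den y.
rewrite (_ : potential y = h * (bump_sum y / (1 + bump_sum y))); last first.
  by rewrite /potential; field; rewrite gt_eqF.
rewrite ler_wpM2l ?(ltW h0)// ler_pdivrMr// mulrDr mulr1 lerDl.
exact: mulr_ge0.
Qed.

Lemma enorm_sum (I : Type) (s : seq I) (F : I -> 'rV[R]_d) :
  enorm (\sum_(i <- s) F i) <= \sum_(i <- s) enorm (F i).
Proof.
elim/big_ind2: _ => [|u a v b ua vb|//]; first by rewrite enorm0.
exact: le_trans (enormD _ _) (lerD ua vb).
Qed.

(** The slope of a bump is controlled by the bump itself, because
    [2 * h * enorm z <= h ^+ 2 + enorm z ^+ 2]. *)
Lemma enorm_grad_bump z : enorm (grad_bump z) <= m%:R / h * bump z.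
Proof.
have D0 := bump_den z; rewrite enormZ normrM (ger0_norm (bump_ge0 z)).
rewrite normrM normrN normfV (gtr0_norm D0) normrM !normr_nat mulrAC ler_wpM2r ?bump_ge0//.
rewrite mulrAC ler_pdivrMr// [X in _ <= X]mulrAC ler_pdivlMr//.
have := sqr_ge0 (h - enorm z); rewrite sqrrB => hz.
rewrite (_ : _ * h = m%:R * (2 * enorm z * h)); last by ring.
rewrite ler_wpM2l//.
by move: hz; rewrite mulr2n; lra.
Qed.

(** The bound does not depend on the number of points: the sum of the slopes is
    at most a multiple of [bump_sum], which the denominator
    [(1 + bump_sum y) ^+ 2] absorbs. *)
Lemma enorm_grad_potential y : enorm (grad_potential y) <= m%:R.
Proof.
have S0 := bump_sum_ge0 y; have D0 := potential_den y.
rewrite enormZ ger0_norm ?divr_ge0 ?sqr_ge0 ?(ltW h0)//.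
apply: (@le_trans _ _ (h / (1 + bump_sum y) ^+ 2 * (m%:R / h * bump_sum y))).
  rewrite ler_wpM2l ?divr_ge0 ?sqr_ge0 ?(ltW h0)// (le_trans (enorm_sum _ _))//.
  by rewrite mulr_sumr; apply: ler_sum => k _; exact: enorm_grad_bump.
rewrite (_ : _ * _ = m%:R * (bump_sum y / (1 + bump_sum y) ^+ 2)); last first.
  by field; rewrite !gt_eqF.
rewrite ler_piMr// ler_pdivrMr ?exprn_gt0// mul1r.
by have := sqr_ge0 (bump_sum y); lra.
Qed.

Section along_ray.
Variables (q x : 'rV[R]_d).

Lemma der_enorm_sq z (r : R) : is_derive r 1 (fun r : R => enorm (r *: x + z) ^+ 2)
  (2 * dot x (r *: x + z)).
Proof.
rewrite (_ : (fun _ => _) = fun r => r ^+ 2 * dot x x + (2 * dot x z) * r + dot z z); last first.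
  by apply/funext => t; rewrite enormE dotDl !dotDr !dotZl !dotZr (dotC z x); ring.
apply: (is_derive_eq (derD (derD (derM (derX 2 (der_id r)) (der_cst (dot x x) r))
  (derM (der_cst (2 * dot x z) r) (der_id r))) (der_cst (dot z z) r))).
by rewrite dotDr dotZr; ring.
Qed.

Lemma der_bump z (r : R) : is_derive r 1 (fun r : R => bump (r *: x + z))
  (dot x (grad_bump (r *: x + z))).
Proof.
have D0 := lt0r_neq0 (bump_den (r *: x + z)).
have dD := derD (der_cst (h ^+ 2) r) (der_enorm_sq z r).
have dV := derV (f := fun r => h ^+ 2 + enorm (r *: x + z) ^+ 2) D0 dD.
apply: (is_derive_eq (derX m (derM (der_cst (h ^+ 2) r) dV))).
rewrite /grad_bump dotZr /bump; case: m => [|m']; first by rewrite !(mulr0, mul0r, oppr0).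
rewrite [_ ^+ m'.+1]exprS /=; move: D0; set u := h ^+ 2 + _ => u0.
set B := _ ^+ m'; set D := dot _ _; rewrite -/u; field.
by rewrite u0.
Qed.

Lemma der_bump_sum (r : R) : is_derive r 1 (fun r : R => bump_sum (r *: x + q))
  (\sum_k dot x (grad_bump (r *: x + q - p k))).
Proof.
rewrite /bump_sum; apply: der_sum => k.
under eq_fun do rewrite -addrA; rewrite -addrA; exact: der_bump.
Qed.

Lemma der_potential (r : R) : is_derive r 1 (fun r : R => potential (r *: x + q))
  (dot x (grad_potential (r *: x + q))).
Proof.
have D0 := lt0r_neq0 (potential_den (r *: x + q)).
have dV := derV (f := fun r => 1 + bump_sum (r *: x + q)) D0 (derD (der_cst 1 r) (der_bump_sum r)).
apply: (is_derive_eq (derD (der_cst h r) (derN (derM (der_cst h r) dV)))).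
rewrite dotZr [in RHS]dotC dot_suml; under [in RHS]eq_bigr do rewrite dotC.
by field.
Qed.

Lemma cont_dot_grad (r : R) : {for r, continuous (fun r : R => dot x (grad_potential (r *: x + q)))}.
Proof.
have cbump z : {for r, continuous (fun r : R => bump (r *: x + z))}.
  exact: der_continuous (der_bump z r).
have cS : {for r, continuous (fun r : R => bump_sum (r *: x + q))}.
  exact: der_continuous (der_bump_sum r).
have cgrad z : {for r, continuous (fun r : R => dot x (grad_bump (r *: x + z)))}.
  suff : {for r, continuous (fun r : R =>
      (- (2 * m%:R) / (h ^+ 2 + enorm (r *: x + z) ^+ 2) * bump (r *: x + z)) *
      (r * dot x x + dot x z))}.
    rewrite /prop_for; congr continuous_at.
    by apply/funext => t; rewrite dotZr dotDr dotZr.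
  apply: contM; last first.
    exact: der_continuous (derD (derM (der_id r) (der_cst (dot x x) r)) (der_cst (dot x z) r)).
  apply: contM; last exact: cbump.
  apply: contM; first exact: cont_cst.
  apply: (contV (f := fun r => h ^+ 2 + enorm (r *: x + z) ^+ 2)).
    exact: lt0r_neq0 (bump_den _).
  exact: der_continuous (derD (der_cst (h ^+ 2) r) (der_enorm_sq z r)).
suff : {for r, continuous (fun r : R => h / (1 + bump_sum (r *: x + q)) ^+ 2 *
    \sum_k dot x (grad_bump (r *: x + (q - p k))))}.
  rewrite /prop_for; congr continuous_at; apply/funext => t; rewrite dotZr [in RHS]dotC dot_suml.
  by congr (_ * _); apply: eq_bigr => k _; rewrite dotC addrA.
apply: contM; last by apply: cont_sum => k; exact: cgrad.
apply: contM; first exact: cont_cst.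
apply: (contV (f := fun r => (1 + bump_sum (r *: x + q)) ^+ 2)).
  by rewrite expf_neq0// lt0r_neq0// potential_den.
exact: der_continuous (derX 2 (derD (der_cst 1 r) (der_bump_sum r))).
Qed.

End along_ray.

End test_potential.

Section point_force.
Context {R : realType} {n N : nat}.
Local Notation d := n.+1.
Local Notation lam := (@lebesgue_rV R d).
Variables (h eta : R) (p : 'I_N -> 'rV[R]_d) (q : 'rV[R]_d).
Hypotheses (h0 : 0 < h) (eta0 : 0 < eta) (q1 : enorm q = 1).
Implicit Types x y z : 'rV[R]_d.
Local Notation V := (grad_potential n h p).
Local Notation psi := (potential n h p).

(** The nonzero root of [enorm (r *: x + q) = 1] in [r]. *)
Definition exit_time x : R := - (2 * dot q x) / enorm x ^+ 2.

Lemma mfun_exit_time : measurable_fun setT exit_time.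
Proof. by rewrite /exit_time /dot; meas. Qed.

Lemma exit_time_gt0 x : x != 0 -> (0 < exit_time x) = (dot q x < 0).
Proof.
move=> x0; rewrite /exit_time pmulr_lgt0; last first.
  by rewrite invr_gt0 exprn_gt0// lt_def enorm_eq0 x0 enorm_ge0.
by rewrite oppr_gt0 pmulr_rlt0.
Qed.

Lemma ray_in_ball x (r : R) : x != 0 -> 0 < r ->
  (enorm (r *: x + q) < 1) = (r < exit_time x).
Proof.
move=> x0 r0; have xx0 : 0 < enorm x ^+ 2.
  by rewrite exprn_gt0// lt_def enorm_eq0 x0 enorm_ge0.
rewrite -(@ltr_pXn2r _ 2) ?nnegrE ?enorm_ge0// expr1n enormB_sq q1 expr1n.
rewrite enormZ (gtr0_norm r0) dotZl (dotC x q) exprMn ltr_pdivlMr//.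
rewrite (_ : _ + 1 = r * (r * enorm x ^+ 2 + 2 * dot q x) + 1); last by ring.
by rewrite -ltrBrDr subrr pmulr_rlt0// -ltrBrDr sub0r.
Qed.

Lemma ray_integral x (f F : R -> R) : x != 0 ->
  (forall r : R, is_derive r 1 F (f r)) ->
  (forall r : R, {for r, continuous f}) ->
  (\int[lebesgue_measure]_r ((0 < r)%R%:R * ((enorm (r *: x + q) < 1)%R%:R * f r))%:E
   = ((0 < exit_time x)%R%:R * (F (exit_time x) - F 0))%:E)%E.
Proof.
move=> x0 dF cf.
have mf : measurable_fun setT f.
  exact: continuous_measurable_fun cf.
transitivity (\int[lebesgue_measure]_(r in `]0%R, exit_time x[) (f r)%:E)%E.
  rewrite [RHS]integral_mkcond; apply: eq_integral => r _.
  rewrite patchE mem_setE in_itv/=; have [r0|r0] := ltP 0 r; last by rewrite mul0r.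
  by rewrite mul1r ray_in_ball//; case: (r < exit_time x); rewrite ?mul1r ?mul0r.
have [T0|T0] := ltP 0 (exit_time x); last first.
  by rewrite mul0r set_itv_ge ?integral_set0// bnd_simp -leNgt.
rewrite mul1r integral_itv_obnd_cbnd; last exact: measurable_funTS (mfun_EFin mf).
rewrite integral_itv_bndo_bndc; last exact: measurable_funTS (mfun_EFin mf).
exact: (FTC_is_derive (ltW T0) (fun r _ => dF r) (fun r _ => cf r)).
Qed.

Definition in_ball y : R := (enorm y < 1)%R%:R.

Lemma mfun_dot d1 (T : measurableType d1) (f g : T -> 'rV[R]_d) :
  measurable_fun setT f -> measurable_fun setT g ->
  measurable_fun setT (fun t => dot (f t) (g t)).
Proof. by move=> mf mg; rewrite /dot; meas. Qed.

(** The field of a charge at [q] paired with a field [W] of length at most [n%:R],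
    plus the term with [n%:R] that makes the sum nonnegative. *)
Definition force W y : R :=
  in_ball y * (n%:R * enorm (y - q) - dot (y - q) (W y)) / enorm (y - q) ^+ d.

Lemma mfun_in_ball d1 (T : measurableType d1) (f : T -> 'rV[R]_d) :
  measurable_fun setT f -> measurable_fun setT (fun t => in_ball (f t)).
Proof. by move=> mf; rewrite /in_ball; meas. Qed.

Lemma mfun_in_ballM (f : 'rV[R]_d -> R) : measurable_fun setT f ->
  measurable_fun setT (fun y => in_ball y * f y).
Proof. by move=> mf; apply: mfunM => //; apply: mfun_in_ball; meas. Qed.

Section force.
Variables (W : 'rV[R]_d -> 'rV[R]_d) (F : 'rV[R]_d -> R -> R).
Hypotheses (mW : measurable_fun setT W) (Wn : forall y, enorm (W y) <= n%:R).
Hypothesis dF : forall x (r : R),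
  is_derive r 1 (F x) (n%:R * enorm x - dot x (W (r *: x + q))).
Hypothesis cW : forall x (r : R),
  {for r, continuous (fun r : R => dot x (W (r *: x + q)))}.

Let slope_ge0 z y : 0 <= n%:R * enorm z - dot z (W y).
Proof.
rewrite subr_ge0 (le_trans (ler_norm _))// (le_trans (dot_le _ _))// mulrC.
by rewrite ler_wpM2r ?enorm_ge0.
Qed.

Lemma mfun_force : measurable_fun setT (force W).
Proof.
apply: mfunM; last by meas.
by apply: mfun_in_ballM; apply: mfunD; [meas|apply: mfunN; rewrite /dot; meas].
Qed.

Lemma force_ge0 y : 0 <= force W y.
Proof. by rewrite /force !mulr_ge0// invr_ge0 exprn_ge0 ?enorm_ge0. Qed.

Let ray_force x : shell 1 x ->
  (\int[lebesgue_measure]_r ((0 < r)%R%:R *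
     (in_ball (r *: x + q) * (n%:R * enorm (r *: x) - dot (r *: x) (W (r *: x + q))) / r))%:E
   = ((0 < exit_time x)%R%:R * (F x (exit_time x) - F x 0))%:E)%E.
Proof.
move=> Ax; have x0 : x != 0.
  by apply: contraTneq Ax => ->; rewrite /shell enorm0 lt_geF.
have cf (r : R) : {for r, continuous (fun r : R => n%:R * enorm x - dot x (W (r *: x + q)))}.
  have := continuousD (@cont_cst R (n%:R * enorm x) r) (contM (@cont_cst R (- 1) r) (@cW x r)).
  rewrite /prop_for; congr continuous_at; apply/funext => t.
  by rewrite fctE mulN1r.
rewrite -(ray_integral x0 (dF x) cf).
apply: eq_integral => r _; congr (_%:E).
have [r0|r0] := ltP 0 r; last by rewrite !mul0r.
rewrite !mul1r enormZ dotZl (gtr0_norm r0) /in_ball.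
by field; rewrite gt_eqF.
Qed.

Lemma exit_work_ge0 x :
  0 <= (shell 1 x)%:R * ((0 < exit_time x)%R%:R * (F x (exit_time x) - F x 0)).
Proof.
have [Ax|_] := boolP (shell 1 x); last by rewrite mul0r.
rewrite -lee_fin mul1r -ray_force//; apply: integral_ge0 => r _; rewrite lee_fin.
have [r0|_] := ltP 0 r; last by rewrite mul0r.
by rewrite !mulr_ge0// invr_ge0 ltW.
Qed.

(** Along a ray the integrand is the derivative of [F x]. *)
Lemma integral_force : ((@kappa R d)%:E * \int[lam]_y (force W y)%:E =
  \int[lam]_x ((shell 1 x)%:R * ((0 < exit_time x)%R%:R *
    (F x (exit_time x) - F x 0)))%:E)%E.
Proof.
rewrite -(integral_shift q); last 2 first.
- by apply: mfun_EFin; exact: mfun_force.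
- by move=> y; rewrite lee_fin force_ge0.
rewrite /force; under eq_integral do rewrite addrK.
rewrite (@ray_formula _ _ _ (fun z => in_ball (z + q) * (n%:R * enorm z - dot z (W (z + q)))))//; last 2 first.
- apply: mfunM; first by apply: mfun_in_ball; meas.
  apply: mfunD; first by meas.
  by apply: mfunN; apply: mfun_dot; [meas|apply: (measurableT_comp mW); meas].
- by move=> z; rewrite mulr_ge0.
apply: eq_integral => x _; have [Ax|Ax] := boolP (shell 1 x).
  by rewrite mul1r; exact: ray_force.
by rewrite mul0r; under eq_integral do rewrite mul0r; rewrite integral0.
Qed.

End force.

(** A bound, in units of [h], for the potential at the point where the ray from
    [q] in the direction [x] leaves the ball. *)
Definition exit_bound x : R := (shell 1 x)%:R *
  ((`|dot q x| < eta)%R%:R +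
   \sum_j (eta / 2 <= exit_time x)%R%:R * bump n h (exit_time x *: x - (p j - q))).

Lemma mfun_bump d1 (T : measurableType d1) (f : T -> 'rV[R]_d) :
  measurable_fun setT f -> measurable_fun setT (fun t => bump n h (f t)).
Proof. by move=> mf; rewrite /bump; meas. Qed.

Lemma mfun_grad_potential d1 (T : measurableType d1) (f : T -> 'rV[R]_d) :
  measurable_fun setT f -> measurable_fun setT (fun t => V (f t)).
Proof.
move=> mf; rewrite /grad_potential /grad_bump; apply: mfun_rVZ.
  by rewrite /bump_sum /bump; meas.
apply: mfun_rV => i; under eq_fun do rewrite summxE.
by apply: mfun_sum => k; rewrite /bump; meas.
Qed.

(** At a point where a ray leaves the ball either the ray is nearly tangent to
    the sphere, or the potential is controlled by the bumps seen from [q]. *)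
Lemma potential_exit x : shell 1 x -> 0 < exit_time x ->
  psi (exit_time x *: x + q) <= h * exit_bound x.
Proof.
move=> Ax T0; rewrite /exit_bound Ax mul1r.
have [|far] := ltP `|dot q x| eta.
  move=> _; apply: (le_trans (potential_le1 _ _ h0 _)); rewrite ler_peMr ?(ltW h0)//.
  by rewrite lerDl sumr_ge0// => j _; rewrite mulr_ge0// bump_ge0.
have -> : (eta / 2 <= exit_time x).
  have x0 : x != 0 by apply: contraTneq Ax => ->; rewrite /shell enorm0 lt_geF.
  have /andP[x1 x2] := Ax.
  have xx0 : 0 < enorm x ^+ 2 by rewrite exprn_gt0// (lt_le_trans _ x1).
  have xx4 : enorm x ^+ 2 <= 4.
    have : enorm x <= 2 by rewrite ltW.
    rewrite -(@ler_pXn2r _ 2) ?nnegrE ?enorm_ge0//; have -> : (2 ^+ 2 = 4 :> R) by ring.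
    by [].
  rewrite /exit_time ler_pdivlMr//.
  have dq : dot q x < 0 by rewrite -exit_time_gt0.
  rewrite ltr0_norm// in far.
  have : eta / 2 * enorm x ^+ 2 <= eta / 2 * 4 by rewrite ler_wpM2l// divr_ge0// ltW.
  by lra.
rewrite add0r; under eq_bigr do rewrite mul1r opprB addrA addrAC.
apply: (le_trans (potential_le_sum _ _ h0 _)).
rewrite ler_wpM2l ?(ltW h0)//; apply: ler_sum => j _.
by apply: le_of_eq; congr bump; rewrite addrAC.
Qed.

Lemma mfun_potential d1 (T : measurableType d1) (f : T -> 'rV[R]_d) :
  measurable_fun setT f -> measurable_fun setT (fun t => psi (f t)).
Proof. by move=> mf; rewrite /potential /bump_sum /bump; meas. Qed.

Lemma mfun_shell1 : measurable_fun setT (fun x : 'rV[R]_d => (shell 1 x)%:R : R).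
Proof. by apply: mfun_bool; apply: mfun_shell; meas. Qed.

Lemma exit_bound_ge0 x : 0 <= exit_bound x.
Proof.
by rewrite mulr_ge0// addr_ge0// sumr_ge0// => j _; rewrite mulr_ge0// bump_ge0.
Qed.

Lemma mfun_exit_bound : measurable_fun setT exit_bound.
Proof.
have mT := mfun_exit_time; apply: mfunM; first exact: mfun_shell1.
apply: mfunD; first by rewrite /dot; meas.
by apply: mfun_sum => j; apply: mfunM; [meas|apply: mfun_bump; meas].
Qed.

Definition force_pot := force V.

Definition force_abs := force (fun=> 0).

Lemma mfun_force_pot : measurable_fun setT force_pot.
Proof. by apply: mfun_force; apply: mfun_grad_potential; meas. Qed.

Lemma force_pot_ge0 y : 0 <= force_pot y.
Proof. by apply: force_ge0 => z; exact: enorm_grad_potential. Qed.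

Lemma force_absE y : force_abs y = in_ball y * (n%:R * enorm (y - q)) / enorm (y - q) ^+ d.
Proof. by rewrite /force_abs /force dot0 subr0. Qed.

Lemma mfun_force_abs : measurable_fun setT force_abs.
Proof. by apply: mfun_force; meas. Qed.

Lemma force_abs_ge0 y : 0 <= force_abs y.
Proof. by apply: force_ge0 => z; rewrite enorm0. Qed.

(** On every ray from [q] that enters the ball the potential drops from [psi q],
    at least [h / 2], to its value at the exit. *)
Lemma force_gain : h / 2 <= psi q ->
  ((@kappa R d)%:E * \int[lam]_y (force_abs y)%:E +
     (h / 2)%:E * \int[lam]_x ((shell 1 x)%:R * (dot q x < 0)%R%:R)%:E <=
   (@kappa R d)%:E * \int[lam]_y (force_pot y)%:E + h%:E * \int[lam]_x (exit_bound x)%:E)%E.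
Proof.
have E (A a b X k : R) : k / 2 <= a -> b <= X -> A - 0 + k / 2 <= A - b - (0 - a) + X by lra.
move=> hq; have mT := mfun_exit_time; have mS := mfun_shell1.
pose Fa x (r : R) := n%:R * enorm x * r.
pose Fp x (r : R) := n%:R * enorm x * r - psi (r *: x + q).
pose work (F : 'rV[R]_d -> R -> R) x := (shell 1 x)%:R *
  ((0 < exit_time x)%R%:R * (F x (exit_time x) - F x 0)).
have V0 y : enorm (V y) <= n%:R by exact: enorm_grad_potential.
have Z0 (y : 'rV[R]_d) : enorm (0 : 'rV[R]_d) <= n%:R by rewrite enorm0.
have dFa x (r : R) : is_derive r 1 (Fa x) (n%:R * enorm x - dot x 0).
  by apply: (is_derive_eq (derM (der_cst (n%:R * enorm x) r) (der_id r))); rewrite dot0; ring.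
have dFp x (r : R) : is_derive r 1 (Fp x) (n%:R * enorm x - dot x (V (r *: x + q))).
  apply: (is_derive_eq (derD (derM (der_cst (n%:R * enorm x) r) (der_id r))
    (derN (der_potential n p h0 q x r)))); by ring.
have cV x (r : R) := @cont_dot_grad R d N n h p h0 q x r.
have cZ x (r : R) := @cont_cst R (dot x 0) r.
have mV : measurable_fun setT V by apply: mfun_grad_potential; meas.
have mZ := @measurable_cst _ _ 'rV[R]_d 'rV[R]_d setT 0.
rewrite /force_abs /force_pot (integral_force mZ Z0 dFa cZ) (integral_force mV V0 dFp cV).
have workE F : (\int[lam]_x ((shell 1 x)%:R * ((0 < exit_time x)%R%:R *
    (F x (exit_time x) - F x 0)))%:E = \int[lam]_x (work F x)%:E)%E by [].
have mhalf : measurable_fun setT (fun x => (shell 1 x)%:R * (dot q x < 0)%R%:R : R).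
  by apply: mfunM => //; rewrite /dot; meas.
have mexit := mfun_exit_bound.
have ma : measurable_fun setT (work Fa) by apply: mfunM => //; rewrite /Fa; meas.
have mp : measurable_fun setT (work Fp).
  have mpsi := mfun_potential; apply: mfunM => //; rewrite /Fp.
  by apply: mfunM; [meas|apply: mfunD; [|apply: mfunN]; apply: mfunD; [meas|apply/mfunN/mpsi; meas
    |meas|apply/mfunN/mpsi; meas]].
have Zl (c : R) (g : 'rV[R]_d -> R) : 0 <= c -> measurable_fun setT g -> (forall x, 0 <= g x) ->
    (c%:E * \int[lam]_x (g x)%:E = \int[lam]_x (c * g x)%:E)%E.
  move=> c0 mg g0; rewrite -ge0_integralZl_EFin//; last exact: mfun_EFin.
  by move=> x _; rewrite lee_fin.
rewrite !workE (Zl _ _ (ltW h0) mexit exit_bound_ge0).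
rewrite (Zl _ (fun x => (shell 1 x)%:R * (dot q x < 0)%R%:R))//; last first.
  by rewrite divr_ge0 ?(ltW h0).
have half0 x : 0 <= h / 2 * ((shell 1 x)%:R * (dot q x < 0)%R%:R).
  by rewrite mulr_ge0 ?divr_ge0 ?(ltW h0)// mulr_ge0.
have exit0 x : 0 <= h * exit_bound x by rewrite mulr_ge0 ?exit_bound_ge0// ltW.
have wa0 x : 0 <= work Fa x by exact: (exit_work_ge0 Z0 dFa cZ).
have wp0 x : 0 <= work Fp x by exact: (exit_work_ge0 V0 dFp cV).
have mhalf' := mfunM (mfunC (h / 2)) mhalf; have mexit' := mfunM (mfunC h) mexit.
rewrite -!ge0_integralDT//; apply: ge0_le_integralT; [|exact: mfunD|exact: mfunD|].
  by move=> x; exact: addr_ge0.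
move=> x; have hx := exit0 x; rewrite /work /Fa /Fp.
have [Ax|_] := boolP (shell 1 x); last by rewrite !mul0r mulr0 !add0r.
have x0 : x != 0 by apply: contraTneq Ax => ->; rewrite /shell enorm0 lt_geF.
rewrite !mul1r -(exit_time_gt0 x0); case: ltP => xT; last by rewrite !mul0r mulr0 !add0r.
have := potential_exit Ax xT; rewrite /= ?mul1r ?mulr1 scale0r add0r mulr0 => hp.
exact: E.
Qed.

End point_force.

Section lower_bound.
Context {R : realType} {n : nat}.
Local Notation d := n.+1.
Local Notation lam := (@lebesgue_rV R d).
Implicit Types x y z q : 'rV[R]_d.

Lemma integral_kernel_at q (L : R) : enorm q <= L ->
  (\int[lam]_y (in_ball y * (enorm (y - q) / enorm (y - q) ^+ d))%:E <= (@ray_cst R d * (1 + L))%:E)%E.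
Proof.
move=> qL; have L0 : 0 <= L := le_trans (enorm_ge0 q) qL.
rewrite -(integral_shift q); last 2 first.
- by apply: mfun_EFin; apply: mfun_in_ballM; meas.
- by move=> y; rewrite lee_fin !mulr_ge0// ?enorm_ge0// invr_ge0 exprn_ge0 ?enorm_ge0.
apply: le_trans (integral_kernel_ball _ _) => //; last by rewrite ltr_pwDl.
apply: ge0_le_integral => //.
- by move=> z _; rewrite lee_fin !mulr_ge0// ?enorm_ge0// invr_ge0 exprn_ge0 ?enorm_ge0.
- by apply: mfun_EFin; apply: mfunM; [apply: mfun_in_ball|]; meas.
- by meas.
move=> z _; rewrite addrK lee_fin mulrA ler_wpM2r ?invr_ge0 ?exprn_ge0 ?enorm_ge0//.
rewrite ler_wpM2r ?enorm_ge0// /in_ball ler_nat.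
case: (ltP (enorm (z + q)) 1) => zq//=; rewrite (_ : enorm z < 1 + L)//.
have := enormB (z + q) q; rewrite addrK => /le_lt_trans -> //.
by rewrite ltr_leD.
Qed.

Lemma force_abs_fin q : enorm q = 1 -> (\int[lam]_y (force_abs q y)%:E < +oo)%E.
Proof.
move=> q1.
have -> : (\int[lam]_y (force_abs q y)%:E =
    \int[lam]_y (n%:R%:E * (in_ball y * (enorm (y - q) / enorm (y - q) ^+ d))%:E))%E.
  by apply: eq_integral => y _; rewrite -EFinM; congr (_%:E); rewrite force_absE; ring.
rewrite ge0_integralZl_EFin//; last 2 first.
- by move=> y _; rewrite lee_fin !mulr_ge0// ?enorm_ge0// invr_ge0 exprn_ge0 ?enorm_ge0.
- by apply: mfun_EFin; apply: mfun_in_ballM; meas.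
apply: (@le_lt_trans _ _ (n%:R%:E * (@ray_cst R d * 2)%:E)%E); last by rewrite -EFinM ltry.
by apply: lee_wpmul2l => //; apply: integral_kernel_at; rewrite q1.
Qed.

(** The two half shells have equal volume, and what lies between them is
    contained in a thin slab. *)
Lemma half_shell q (c : R) : 0 < c -> enorm q = 1 ->
  (((@vol_annulus R d - 2 * n.+1%:R * 4 ^+ n * c) / 2)%:E <=
   \int[lam]_x ((shell 1 x)%:R * (dot q x < 0)%R%:R)%:E)%E.
Proof.
move=> c0 q1.
have mS := @mfun_shell1 R n.
have mb (b : 'rV[R]_d -> bool) : measurable_fun setT b ->
    measurable_fun setT (fun x => ((shell 1 x)%:R * (b x)%:R)%:E : \bar R).
  by move=> mb; apply: mfun_EFin; apply: mfunM => //; exact: mfun_bool.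
have b0 (b : 'rV[R]_d -> bool) x : (0 <= ((shell 1 x)%:R * (b x)%:R)%:E :> \bar R)%E.
  by rewrite lee_fin mulr_ge0.
have mdot : measurable_fun setT (dot q) by rewrite /dot; meas.
have mD := mb _ (mfun_lt mdot (mfunC 0)); have D0 := b0 (fun x => dot q x < 0).
have mE := mb _ (mfun_lt (mfun_norm mdot) (mfunC c)); have E0 := b0 (fun x => `|dot q x| < c).
have mF := mb _ (mfun_lt (mfunC 0) mdot); have F0 := b0 (fun x => 0 < dot q x).
set H := (\int[lam]_x _)%E.
have flip : (\int[lam]_x ((shell 1 x)%:R * (0 < dot q x)%R%:R)%:E = H)%E.
  have N1 : (- 1 : R) != 0 by rewrite oppr_eq0 oner_neq0.
  have := integral_scale N1 mD D0; rewrite normrN1 expr1n invr1 mul1e => flip; rewrite /H -flip.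
  apply: eq_integral => x _; rewrite scaleN1r dotNr oppr_lt0.
  by rewrite /shell enormN.
have total : ((@vol_annulus R d)%:E <= H + H + (2 * n.+1%:R * 4 ^+ n * c)%:E)%E.
  apply: (@le_trans _ _ (H + H + \int[lam]_x ((shell 1 x)%:R * (`|dot q x| < c)%R%:R)%:E)%E); last first.
    by rewrite leeD2l// slab_le.
  rewrite -[X in (_ + X + _)%E]flip /H -ge0_integralD// -ge0_integralD//; last 2 first.
  - by move=> x _; rewrite adde_ge0.
  - exact: emeasurable_funD.
  have -> : ((@vol_annulus R d)%:E = \int[lam]_x ((shell 1 x)%:R * 1)%:E)%E.
    rewrite integral_bool -vol_annulusE.
    exact: esym (etrans (integral_cst _ (measurable_shell 1) 1%E) (mul1e _)).
  apply: ge0_le_integral => //.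
  - by meas.
  - by apply: emeasurable_funD => //; exact: emeasurable_funD.
  move=> x _; rewrite -!EFinD -!mulrDr lee_fin ler_wpM2l// -!natrD ler1n.
  case: (ltgtP (dot q x) 0) => [_|_|->]; rewrite ?addn0 ?add0n//=.
  by rewrite normr0 c0.
have Hfin : (H < +oo)%E.
  apply: (@le_lt_trans _ _ (@vol_annulus R d)%:E); last exact: ltry.
  rewrite -vol_annulusE -[X in (_ <= X)%E]mul1e -(integral_cst _ (measurable_shell 1) 1%E).
  rewrite -(integral_bool _ (fun x => shell 1 x) (fun=> 1)) /H.
  apply: ge0_le_integral => //; first by meas.
  by move=> x _; rewrite lee_fin ler_wpM2l// lern1 leq_b1.
have H0 : (0 <= H)%E by apply: integral_ge0 => x _.
move: total; rewrite -(@fineK _ H) ?ge0_fin_numE// -!EFinD !lee_fin.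
by rewrite ler_pdivrMr// => ?; lra.
Qed.

(** Nearly tangent directions fill a thin slab; the directions whose exit point
    is within about [h] of [p j] fill a thin cone, of volume of order [h ^+ n]. *)
Lemma exit_bound_le N (h eta : R) (p : 'I_N -> 'rV[R]_d) q : 0 < h -> 0 < eta ->
  enorm q = 1 ->
  (\int[lam]_x (exit_bound h eta p q x)%:E <=
   (2 * n.+1%:R * 4 ^+ n * eta + N%:R * (4 * (4 * pi * h / eta) ^+ n))%:E)%E.
Proof.
move=> h0 eta0 q1; have mT := mfun_exit_time q; have mS := @mfun_shell1 R n.
pose F j x : R := (shell 1 x)%:R * (eta / 2 <= exit_time q x)%R%:R *
  bump n h (exit_time q x *: x - (p j - q)).
have F0 j x : 0 <= F j x by rewrite !mulr_ge0// bump_ge0.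
have mF j : measurable_fun setT (fun x => (F j x)%:E).
  apply: mfun_EFin; apply: mfunM; last by apply: mfun_bump; meas.
  by apply: mfunM => //; meas.
have -> : (\int[lam]_x (exit_bound h eta p q x)%:E = \int[lam]_x
    (((shell 1 x)%:R * (`|dot q x| < eta)%R%:R)%:E + \sum_j (F j x)%:E))%E.
  apply: eq_integral => x _; rewrite sumEFin -EFinD; congr (_%:E).
  rewrite /exit_bound mulrDr mulr_sumr; congr (_ + _).
  by apply: eq_bigr => j _; rewrite mulrA.
have mD : measurable_fun setT (fun x => ((shell 1 x)%:R * (`|dot q x| < eta)%R%:R)%:E : \bar R).
  by apply: mfun_EFin; apply: mfunM => //; rewrite /dot; meas.
have msum : measurable_fun setT (fun x => (\sum_j (F j x)%:E)%E) by exact: emeasurable_sum.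
rewrite ge0_integralD//; last first.
  by move=> x _; apply: sume_ge0 => j _; rewrite lee_fin.
rewrite EFinD; apply: leeD; first exact: slab_le.
rewrite ge0_integral_sum//; last by move=> j x _; rewrite lee_fin.
apply: (@le_trans _ _ (\sum_(j < N) (4 * (4 * pi * h / eta) ^+ n)%:E)%E).
  apply: lee_sum => j _; apply: le_trans (cone_le _ _ h0 mT) _; first by rewrite divr_gt0.
  apply: le_of_eq; congr (_ * _ ^+ _)%:E.
  by field; rewrite gt_eqF.
by rewrite sumEFin sumr_const card_ord -[_ *+ N]mulr_natl.
Qed.

Lemma efield_dot N (p : 'I_N -> 'rV[R]_d) y v :
  dot (efield p y) v = \sum_k dot (p k - y) v / enorm (y - p k) ^+ d.
Proof.
rewrite dot_suml; apply: eq_bigr => k _.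
by rewrite dotZl enormBC mulrC.
Qed.

(** With [eta] small and [h] below the typical spacing of [N] points, the
    exceptional directions use up less than half of the gain. *)
Lemma force_pot_gain N (h eta : R) (p : 'I_N -> 'rV[R]_d) k : 0 < h -> 0 < eta ->
  (forall j, enorm (p j) = 1) ->
  2 * n.+1%:R * 4 ^+ n * eta = @vol_annulus R d / 20 ->
  N%:R * (4 * (4 * pi * h / eta) ^+ n) <= @vol_annulus R d / 16 ->
  ((@kappa R d)%:E * \int[lam]_y (force_abs (p k) y)%:E + (h * @vol_annulus R d / 8)%:E <=
   (@kappa R d)%:E * \int[lam]_y (force_pot h p (p k) y)%:E)%E.
Proof.
move=> h0 eta0 p1 etaE conE; have a0 := @vol_annulus_gt0 R d isT.
set a := vol_annulus in etaE conE a0 *.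
have := force_gain h0 eta0 (p1 k) (potential_point n p h0 k).
have := exit_bound_le p h0 eta0 (p1 k); have := half_shell eta0 (p1 k).
rewrite -/a etaE.
set H := (\int[lam]_x ((shell 1 x)%:R * _)%:E)%E; set X := (\int[lam]_x (exit_bound _ _ _ _ x)%:E)%E.
set KA := (_%:E * \int[lam]_y (force_abs _ y)%:E)%E.
set KP := (_%:E * \int[lam]_y (force_pot _ _ _ y)%:E)%E.
move=> H1 X1 gain.
have {}X1 : (h%:E * X <= (h * (a * (9 / 80)))%:E)%E.
  rewrite EFinM; apply: lee_wpmul2l; first by rewrite lee_fin ltW.
  by apply: (le_trans X1); rewrite lee_fin; lra.
have {}H1 : ((h * (a * (19 / 80)))%:E <= (h / 2)%:E * H)%E.
  rewrite (_ : h * _ = h / 2 * ((a - a / 20) / 2)); last by field.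
  by rewrite EFinM; apply: lee_wpmul2l => //; rewrite lee_fin divr_ge0// ltW.
have : (KA + (h * (a * (19 / 80)))%:E <= KP + (h * (a * (9 / 80)))%:E)%E.
  by apply: le_trans (le_trans gain _); [exact: leeD2l|exact: leeD2l].
rewrite -leeBlDr//; apply: le_trans; rewrite -addeA -EFinB; apply: leeD2l.
by rewrite lee_fin; apply: le_of_eq; field.
Qed.

(** Summing the gains over the charges, the terms [force_abs] are finite and
    cancel; what remains is the pairing of the gradient with the total field, at
    most [n%:R * enorm (efield p y)]. *)
Lemma field_lower_bound N (h eta : R) (p : 'I_N -> 'rV[R]_d) : 0 < h -> 0 < eta ->
  (forall j, enorm (p j) = 1) ->
  2 * n.+1%:R * 4 ^+ n * eta = @vol_annulus R d / 20 ->
  N%:R * (4 * (4 * pi * h / eta) ^+ n) <= @vol_annulus R d / 16 ->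
  ((N%:R * (h * @vol_annulus R d / 8))%:E <=
   (@kappa R d * n%:R)%:E * \int[lam]_y (in_ball y * enorm (efield p y))%:E)%E.
Proof.
move=> h0 eta0 p1 etaE conE.
have k0 : 0 < @kappa R d by exact: kappa_gt0.
have mE : measurable_fun setT (fun y => (in_ball y * enorm (efield p y))%:E).
  apply: mfun_EFin; apply: mfun_in_ballM.
  apply: mfun_enorm; rewrite /efield; apply: mfun_rV => i.
  by under eq_fun do rewrite summxE; apply: mfun_sum => k; meas.
have mA k : measurable_fun setT (fun y => (force_abs (p k) y)%:E).
  by apply: mfun_EFin; exact: mfun_force_abs.
have mP k : measurable_fun setT (fun y => (force_pot h p (p k) y)%:E).
  by apply: mfun_EFin; exact: mfun_force_pot.
have E0 y : (0 <= (in_ball y * enorm (efield p y))%:E)%E.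
  by rewrite lee_fin mulr_ge0// enorm_ge0.
have A0 k y : (0 <= (force_abs (p k) y)%:E)%E by rewrite lee_fin force_abs_ge0.
have P0 k y : (0 <= (force_pot h p (p k) y)%:E)%E by rewrite lee_fin force_pot_ge0.
have pairing y : \sum_k force_pot h p (p k) y <=
    n%:R * (in_ball y * enorm (efield p y)) + \sum_k force_abs (p k) y.
  rewrite -lerBlDr -sumrB; under eq_bigr do
    rewrite force_absE /force_pot /force -mulrBl -mulrBr addrAC subrr add0r -dotNl opprB -mulrA.
  rewrite -mulr_sumr -efield_dot mulrCA ler_wpM2l// (le_trans (ler_norm _))//.
  rewrite (le_trans (dot_le _ _))// mulrC ler_wpM2r ?enorm_ge0//.
  exact: enorm_grad_potential.
set I := (\int[lam]_y (in_ball y * _)%:E)%E.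
have total : (\sum_k \int[lam]_y (force_pot h p (p k) y)%:E <=
    n%:R%:E * I + \sum_k \int[lam]_y (force_abs (p k) y)%:E)%E.
  have mnE : measurable_fun setT (fun y => (n%:R%:E * (in_ball y * enorm (efield p y))%:E)%E).
    by apply: emeasurable_funM => //; exact: measurable_cst.
  have msA : measurable_fun setT (fun y => (\sum_k (force_abs (p k) y)%:E)%E) by exact: emeasurable_sum.
  have msP : measurable_fun setT (fun y => (\sum_k (force_pot h p (p k) y)%:E)%E) by exact: emeasurable_sum.
  have nE0 y : (0 <= n%:R%:E * (in_ball y * enorm (efield p y))%:E)%E by rewrite mule_ge0.
  have sA0 y : (0 <= \sum_k (force_abs (p k) y)%:E)%E by exact: sume_ge0.
  have sP0 y : (0 <= \sum_k (force_pot h p (p k) y)%:E)%E by exact: sume_ge0.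
  rewrite -!ge0_integral_sum// -ge0_integralZl_EFin// -ge0_integralD//.
  apply: ge0_le_integral => //; first exact: emeasurable_funD.
  by move=> y _; rewrite !sumEFin -EFinM -EFinD lee_fin.
pose fa k := fine (\int[lam]_y (force_abs (p k) y)%:E)%E.
have faE k : (\int[lam]_y (force_abs (p k) y)%:E = (fa k)%:E)%E.
  by rewrite fineK// ge0_fin_numE ?force_abs_fin// integral_ge0.
have gain k := force_pot_gain k h0 eta0 p1 etaE conE.
have : (\sum_k ((@kappa R d)%:E * (fa k)%:E + (h * @vol_annulus R d / 8)%:E) <=
    (@kappa R d)%:E * (n%:R%:E * I + \sum_k (fa k)%:E))%E.
  apply: (@le_trans _ _ ((@kappa R d)%:E * \sum_k \int[lam]_y (force_pot h p (p k) y)%:E)%E).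
    rewrite ge0_sume_distrr; last by move=> k _; exact: integral_ge0.
    by apply: lee_sum => k _; rewrite -faE.
  apply: lee_wpmul2l; first by rewrite lee_fin ltW.
  by apply: le_trans total _; rewrite (eq_bigr _ (fun k _ => faE k)).
have I0 : (0 <= I)%E by exact: integral_ge0.
rewrite big_split/= !sumEFin sumr_const card_ord -mulr_sumr.
have fa0 : 0 <= \sum_k fa k.
  by apply: sumr_ge0 => k _; rewrite fine_ge0// integral_ge0.
rewrite ge0_muleDr ?mule_ge0// muleA -!EFinM.
by rewrite [X in (_ <= X)%E]addeC -[_ *+ N]mulr_natl leeD2lE.
Qed.

(** The best scale [h] is of order [N%:R `^ (- n%:R^-1)], the spacing of [N] points
    on a sphere of dimension [n]: each charge then gains a multiple of [h]. *)
Lemma field_integral_lower_bound : (0 < n)%N -> exists2 c : R, 0 < c &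
  forall N (p : 'I_N -> 'rV[R]_d), (0 < N)%N -> (forall k, enorm (p k) = 1) ->
    ((c * N%:R `^ ((d%:R - 2) / (d%:R - 1)))%:E <= field_integral p)%E.
Proof.
move=> n0; have a0 := @vol_annulus_gt0 R d isT; set a := vol_annulus in a0.
have k0 : 0 < @kappa R d by exact: kappa_gt0.
have nR0 : 0 < (n%:R : R) by rewrite ltr0n.
have pi0 := pi_gt0 R.
pose s : R := 2 * n.+1%:R * 4 ^+ n.
have s0 : 0 < s by rewrite !mulr_gt0 ?exprn_gt0.
pose eta := a / 20 / s; have eta0 : 0 < eta by rewrite !divr_gt0.
have etaE : s * eta = a / 20 by rewrite /eta mulrC divfK// gt_eqF.
(* [mu <= 1] gives [mu ^+ n <= mu <= a / 64]. *)
pose mu := Num.min 1 (a / 64).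
have mu0 : 0 < mu by rewrite lt_min ltr01 divr_gt0.
pose eps := eta / (4 * pi) * mu.
have eps0 : 0 < eps by rewrite mulr_gt0// divr_gt0// mulr_gt0.
exists (eps * a / 8 / (@kappa R d * n%:R)).
  by apply: divr_gt0; [apply: divr_gt0 => //|]; apply: mulr_gt0.
move=> N p N0 p1.
have NR0 : 0 < (N%:R : R) by rewrite ltr0n.
pose nu : R := N%:R `^ (n%:R^-1); have nu0 : 0 < nu by rewrite powR_gt0.
have nuN : nu ^+ n = N%:R.
  by rewrite -powR_mulrn ?ltW// -powRrM mulVf ?gt_eqF// powRr1// ltW.
pose h := eps / nu; have h0 : 0 < h by rewrite divr_gt0.
have conE : N%:R * (4 * (4 * pi * h / eta) ^+ n) <= a / 16.
  have -> : 4 * pi * h / eta = mu / nu.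
    have cancel (P e u v : R) : P != 0 -> e != 0 -> v != 0 ->
        4 * P * (e / (4 * P) * u / v) / e = u / v.
      by move=> P0 e0 v0; field; rewrite P0 e0 v0.
    by apply: cancel; rewrite gt_eqF.
  rewrite exprMn exprVn nuN (_ : N%:R * _ = 4 * mu ^+ n); last by field; rewrite gt_eqF.
  have mun : mu ^+ n <= mu.
    case: n n0 => // n' _; rewrite exprS ler_piMr ?(ltW mu0)//.
    by rewrite exprn_ile1 ?(ltW mu0)// ge_min lexx.
  have : mu <= a / 64 by rewrite ge_min lexx orbT.
  by lra.
have := field_lower_bound h0 eta0 p1 etaE conE.
rewrite /field_integral -(integral_bool _ (fun y => enorm y < 1)).
set I := (\int[lam]_y (in_ball y * _)%:E)%E; rewrite -/I -/a => main.
rewrite -(@lee_pmul2l _ (@kappa R d * n%:R)%:E)//; last by rewrite lte_fin mulr_gt0.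
apply: le_trans main; rewrite -EFinM lee_fin; apply: le_of_eq.
have -> : (d%:R - 2) / (d%:R - 1) = 1 - n%:R^-1 :> R.
  by rewrite -natr1 addrK; field; rewrite gt_eqF.
rewrite powRB; last by rewrite (gt_eqF NR0) implybT.
rewrite powRr1 ?(ltW NR0)// -/nu /h.
by field; rewrite !gt_eqF.
Qed.

End lower_bound.

(** * Expansion of the Coulomb kernel *)

Section taylor.
Context {R : realType}.

Lemma expr_sub1_le (k : nat) (u : R) : 0 <= u <= 2 -> `|u ^+ k - 1| <= 4 ^+ k * `|u - 1|.
Proof.
move=> /andP[u0 u2]; elim: k => [|k IH]; first by rewrite !expr0 subrr normr0 mul1r.
rewrite (_ : u ^+ k.+1 - 1 = u * (u ^+ k - 1) + (u - 1)); last by rewrite exprS; ring.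
apply: le_trans (ler_normD _ _) _; rewrite normrM (ger0_norm u0).
have e0 := normr_ge0 (u - 1); have k4 : 1 <= 4 ^+ k :> R by rewrite exprn_ege1// ler1n.
rewrite [4 ^+ _]exprS; move: (4 ^+ k) k4 IH => K k4 IH.
have : u * `|u ^+ k - 1| <= 2 * (K * `|u - 1|) by rewrite ler_pM.
have : `|u - 1| <= K * `|u - 1| by rewrite ler_peMl.
by move: e0; move: (`|u ^+ k - 1|) (`|u - 1|) => A B; lra.
Qed.

Lemma expr_taylor_le (k : nat) (u : R) : 0 <= u <= 2 ->
  `|u ^+ k - 1 - k%:R * (u - 1)| <= 4 ^+ k * (u - 1) ^+ 2.
Proof.
move=> /andP[u0 u2]; elim: k => [|k IH].
  by rewrite !expr0 subrr mul0r subr0 normr0 mul1r sqr_ge0.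
rewrite (_ : _ - _ = u * (u ^+ k - 1 - k%:R * (u - 1)) + k%:R * (u - 1) ^+ 2); last first.
  by rewrite exprS -natr1; ring.
apply: le_trans (ler_normD _ _) _; rewrite normrM (ger0_norm u0).
have e0 := sqr_ge0 (u - 1); rewrite (ger0_norm (mulr_ge0 _ e0))//.
have k4 : k%:R <= 4 ^+ k :> R by rewrite -natrX ler_nat ltnW// ltn_expl.
rewrite [4 ^+ _]exprS; move: (4 ^+ k) k4 IH => K k4 IH.
have : u * `|u ^+ k - 1 - k%:R * (u - 1)| <= 2 * (K * (u - 1) ^+ 2) by rewrite ler_pM.
have : k%:R * (u - 1) ^+ 2 <= K * (u - 1) ^+ 2 by rewrite ler_wpM2r.
have kk : 0 <= k%:R * (u - 1) ^+ 2 by rewrite mulr_ge0.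
by move: kk; move: (k%:R * (u - 1) ^+ 2) (`|_|) ((u - 1) ^+ 2) => A B C; lra.
Qed.

(** Solving [u ^+ 2 * (1 + 2 * w + r ^+ 2) = 1] to first order gives [u = 1 - w]. *)
Lemma invsqrt_taylor_le (u w r : R) : 0 <= u <= 2 -> `|u - 1| <= 2 * r -> `|w| <= r ->
  0 <= r -> u ^+ 2 * (1 + 2 * w + r ^+ 2) = 1 -> `|u - 1 + w| <= 10 * r ^+ 2.
Proof.
move=> u_bound el wl rr E.
set e := u - 1 in el *.
have el1 : `|e| <= 1 by have /andP[? ?] := u_bound; rewrite ler_norml /e; lra.
have ue : u = 1 + e by rewrite /e; ring.
have E2 : 2 * (e + w) = - (e ^+ 2 + r ^+ 2 * u ^+ 2 + 2 * w * (e * (2 + e))).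
  by move: E; rewrite ue => E; lra.
have r2 := sqr_ge0 r.
have e2 : `|e ^+ 2| <= 4 * r ^+ 2.
  rewrite normrX (_ : 4 * r ^+ 2 = (2 * r) ^+ 2); last by ring.
  by apply: lerXn2r => //; rewrite nnegrE//; apply: mulr_ge0.
have u2 : `|r ^+ 2 * u ^+ 2| <= 4 * r ^+ 2.
  rewrite ger0_norm; last by apply: mulr_ge0; exact: sqr_ge0.
  rewrite mulrC ler_wpM2r//; have /andP[u0 u2] := u_bound.
  rewrite (_ : 4 = 2 ^+ 2 :> R); last by ring.
  by apply: lerXn2r; rewrite ?nnegrE.
have w2 : `|2 * w * (e * (2 + e))| <= 12 * r ^+ 2.
  rewrite !normrM normr_nat (_ : 12 * r ^+ 2 = 2 * r * (2 * r * 3)); last by ring.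
  apply: ler_pM; [by apply: mulr_ge0|by apply: mulr_ge0|by rewrite ler_wpM2l|].
  apply: ler_pM => //.
  by apply: le_trans (ler_normD _ _) _; rewrite normr_nat; lra.
have : `|2 * (e + w)| <= 20 * r ^+ 2.
  rewrite E2 normrN; apply: le_trans (ler_normD _ _) _.
  have := ler_normD (e ^+ 2) (r ^+ 2 * u ^+ 2); lra.
by rewrite normrM normr_nat; lra.
Qed.

Context {d : nat}.
Implicit Types z v : 'rV[R]_d.

(** The differential of [kernel ^~ i] at [z]. *)
Definition dkernel z v i : R :=
  v ord0 i / enorm z ^+ d - d%:R * dot z v * z ord0 i / enorm z ^+ d.+2.

Let ratio z v : R := enorm z / enorm (z + v).

Section near.
Variables (z v : 'rV[R]_d).
Hypotheses (z0 : 0 < enorm z) (vz : enorm v <= enorm z / 2).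
Let u := ratio z v.
Let w := dot z v / enorm z ^+ 2.
Let r := enorm v / enorm z.

Let zv_ge : enorm z / 2 <= enorm (z + v).
Proof. by have := enormD_ge z v; move: vz; lra. Qed.

Let zv0 : 0 < enorm (z + v).
Proof. by rewrite (lt_le_trans _ zv_ge)// divr_gt0. Qed.

Let r0 : 0 <= r. Proof. by rewrite divr_ge0 ?enorm_ge0. Qed.

Let u_bound : 0 <= u <= 2.
Proof.
rewrite /u /ratio divr_ge0 ?enorm_ge0//= ler_pdivrMr//.
by have := zv_ge; lra.
Qed.

Let e_le : `|u - 1| <= 2 * r.
Proof.
have -> : u - 1 = (enorm z - enorm (z + v)) / enorm (z + v).
  by rewrite /u /ratio; field; rewrite gt_eqF.
rewrite normrM normfV (gtr0_norm zv0) ler_pdivrMr//.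
have diff : `|enorm z - enorm (z + v)| <= enorm v.
  have := enormD_ge z v; have := enormD z v; rewrite ler_norml => ? ?; lra.
have : 2 * r * (enorm z / 2) <= 2 * r * enorm (z + v)
  by apply: ler_wpM2l => //; apply: mulr_ge0.
have -> : 2 * r * (enorm z / 2) = enorm v by rewrite /r; field; rewrite gt_eqF.
exact: le_trans.
Qed.

Let w_le : `|w| <= r.
Proof.
rewrite /w /r normrM normfV (gtr0_norm (exprn_gt0 2 z0)) ler_pdivrMr ?exprn_gt0//.
rewrite (_ : _ * enorm z ^+ 2 = enorm z * enorm v); first exact: dot_le.
by field; rewrite gt_eqF.
Qed.

Let ew_le : `|u - 1 + w| <= 10 * r ^+ 2.
Proof.
have E : u ^+ 2 * (1 + 2 * w + r ^+ 2) = 1.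
  have := enormB_sq z v; rewrite /u /ratio /w /r => E.
  rewrite expr_div_n E; field.
  by rewrite gt_eqF//= -E expf_neq0// gt_eqF.
exact: invsqrt_taylor_le u_bound e_le w_le r0 E.
Qed.

Let kernelE i : kernel (z + v) i = (z ord0 i + v ord0 i) * u ^+ d / enorm z ^+ d.
Proof.
rewrite /kernel /u /ratio mxE expr_div_n; field.
by rewrite !expf_neq0// gt_eqF.
Qed.

(** In terms of [u], [kernel (z + v) i] is a polynomial of degree [d] in [u]
    times an affine function of [v]. *)
Lemma kernel_lip i : `|kernel (z + v) i - kernel z i| <= 3 * 4 ^+ d * enorm v / enorm z ^+ d.
Proof.
have zd : 0 < enorm z ^+ d by rewrite exprn_gt0.
rewrite kernelE /kernel -mulrBl normrM normfV (gtr0_norm zd) ler_pM2r ?invr_gt0//.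
rewrite (_ : _ - _ = v ord0 i * u ^+ d + z ord0 i * (u ^+ d - 1)); last by ring.
apply: le_trans (ler_normD _ _) _; rewrite !normrM.
have /andP[u0 u2] := u_bound.
have ud : `|u ^+ d| <= 4 ^+ d.
  by rewrite normrX (ger0_norm u0) lerXn2r ?nnegrE//; lra.
have h1 : `|v ord0 i| * `|u ^+ d| <= enorm v * 4 ^+ d by rewrite ler_pM// enorm_coor.
have h2 : `|z ord0 i| * `|u ^+ d - 1| <= enorm z * (4 ^+ d * (2 * r)).
  rewrite ler_pM// ?enorm_coor//; apply: (le_trans (expr_sub1_le _ u_bound)).
  by rewrite ler_wpM2l// exprn_ge0.
have h3 : enorm z * (4 ^+ d * (2 * r)) = 2 * (enorm v * 4 ^+ d).
  by rewrite /r; field; rewrite gt_eqF.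
by lra.
Qed.

Lemma kernel_taylor i : `|kernel (z + v) i - kernel z i - dkernel z v i| <=
  (6 * 4 ^+ d + 10 * d%:R) * enorm v ^+ 2 / enorm z ^+ d.+1.
Proof.
have zd : 0 < enorm z ^+ d by rewrite exprn_gt0.
have -> : kernel (z + v) i - kernel z i - dkernel z v i =
    (v ord0 i * (u ^+ d - 1) + z ord0 i * (u ^+ d - 1 - d%:R * (u - 1) + d%:R * (u - 1 + w)))
     / enorm z ^+ d.
  rewrite kernelE /kernel /dkernel /w !exprS; field.
  by rewrite expf_neq0 ?gt_eqF.
rewrite [enorm z ^+ d.+1]exprS invfM mulrA normrM normfV (gtr0_norm zd) ler_pM2r ?invr_gt0//.
apply: le_trans (ler_normD _ _) _; rewrite !normrM.
have c0 : 0 <= 4 ^+ d :> R by rewrite exprn_ge0.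
have h1 : `|v ord0 i| * `|u ^+ d - 1| <= enorm v * (4 ^+ d * (2 * r)).
  rewrite ler_pM// ?enorm_coor//; apply: (le_trans (expr_sub1_le _ u_bound)).
  by rewrite ler_wpM2l.
have h2 : `|u ^+ d - 1 - d%:R * (u - 1) + d%:R * (u - 1 + w)| <= (4 * 4 ^+ d + 10 * d%:R) * r ^+ 2.
  apply: le_trans (ler_normD _ _) _.
  have t1 := expr_taylor_le d u_bound.
  have t2 : 4 ^+ d * (u - 1) ^+ 2 <= 4 ^+ d * (2 * r) ^+ 2.
    apply: ler_wpM2l => //; rewrite -(real_normK (num_real (u - 1))).
    by apply: lerXn2r => //; rewrite nnegrE//; apply: mulr_ge0.
  have t3 : `|d%:R * (u - 1 + w)| <= d%:R * (10 * r ^+ 2).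
    by rewrite normrM normr_nat ler_wpM2l.
  by rewrite exprMn in t2; lra.
have h3 : `|z ord0 i| * `|u ^+ d - 1 - d%:R * (u - 1) + d%:R * (u - 1 + w)| <=
    enorm z * ((4 * 4 ^+ d + 10 * d%:R) * r ^+ 2) by rewrite ler_pM// enorm_coor.
have -> : (6 * 4 ^+ d + 10 * d%:R) * enorm v ^+ 2 / enorm z =
   enorm v * (4 ^+ d * (2 * r)) + enorm z * ((4 * 4 ^+ d + 10 * d%:R) * r ^+ 2).
  by rewrite /r; field; rewrite gt_eqF.
exact: lerD.
Qed.

End near.
End taylor.

(** * Averages over a cell *)

Section average.
Context {R : realType} {n : nat}.
Local Notation d := n.+1.
Local Notation lam := (@lebesgue_rV R d).
Implicit Types (x y z w : 'rV[R]_d) (f g : 'rV[R]_d -> R).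

Definition avg (Q : set 'rV[R]_d) f : R := (fine (lam Q))^-1 * (\int[lam]_(y in Q) f y)%R.

Variables (Q : set 'rV[R]_d).
Hypotheses (mQ : measurable Q) (Q0 : (0 < lam Q)%E) (Qoo : (lam Q < +oo)%E).

Definition bounded_mfun f :=
  measurable_fun setT f /\ exists M, forall y, Q y -> `|f y| <= M.

Let vol_gt0 : 0 < fine (lam Q).
Proof. by rewrite fine_gt0// Q0. Qed.

Lemma bounded_mfun_integrable f : bounded_mfun f -> lam.-integrable Q (EFin \o f).
Proof.
move=> [mf [M fM]]; apply: measurable_bounded_integrable => //.
- exact: measurable_funTS.
- exists M; split => [|K MK y Qy]; first exact: num_real.
  exact: le_trans (fM y Qy) (ltW MK).
Qed.

Lemma cell_nonempty : exists y, Q y.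
Proof.
apply: contrapT => /forallNP Qe; move: Q0.
by rewrite (_ : Q = set0) ?measure0 ?ltxx//; apply/seteqP; split => // y /Qe.
Qed.

Lemma bounded_mfunD f g : bounded_mfun f -> bounded_mfun g ->
  bounded_mfun (fun y => f y + g y).
Proof.
move=> [mf [M fM]] [mg [N gN]]; split; first exact: mfunD.
exists (M + N) => y Qy; apply: le_trans (ler_normD _ _) _.
by rewrite lerD ?fM ?gN.
Qed.

Lemma bounded_mfunZ c f : bounded_mfun f -> bounded_mfun (fun y => c * f y).
Proof.
move=> [mf [M fM]]; split; first exact: mfunM (mfunC c) mf.
by exists (`|c| * M) => y Qy; rewrite normrM ler_wpM2l// fM.
Qed.

Lemma bounded_mfunC c : bounded_mfun (fun=> c).
Proof. by split; [exact: mfunC|exists `|c|]. Qed.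

Lemma avgD f g : bounded_mfun f -> bounded_mfun g ->
  avg Q (fun y => f y + g y) = avg Q f + avg Q g.
Proof. by move=> bf bg; rewrite /avg RintegralD ?mulrDr//; exact: bounded_mfun_integrable. Qed.

Lemma avgZ c f : bounded_mfun f -> avg Q (fun y => c * f y) = c * avg Q f.
Proof. by move=> bf; rewrite /avg RintegralZl ?bounded_mfun_integrable// mulrCA. Qed.

Lemma avgC c : avg Q (fun=> c) = c.
Proof.
by rewrite /avg Rintegral_cst// mulrCA mulVf ?mulr1// gt_eqF.
Qed.

Lemma avg_ge0 f : (forall y, Q y -> 0 <= f y) -> 0 <= avg Q f.
Proof. by move=> f0; rewrite mulr_ge0 ?invr_ge0 ?(ltW vol_gt0)// Rintegral_ge0. Qed.

Lemma avg_le f (M : R) : bounded_mfun f -> (forall y, Q y -> f y <= M) -> avg Q f <= M.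
Proof.
move=> bf fM; rewrite -subr_ge0.
have <- : avg Q (fun y => M + -1 * f y) = M - avg Q f.
  by rewrite avgD ?avgC ?avgZ ?mulN1r//; [exact: bounded_mfunC|exact: bounded_mfunZ].
by apply: avg_ge0 => y Qy; rewrite mulN1r subr_ge0 fM.
Qed.

Lemma avg_norm_le f (M : R) : bounded_mfun f -> (forall y, Q y -> `|f y| <= M) ->
  `|avg Q f| <= M.
Proof.
move=> bf fM; rewrite ler_norml; apply/andP; split; last first.
  by apply: avg_le => // y Qy; rewrite (le_trans (ler_norm _))// fM.
rewrite lerNl -mulN1r -avgZ//; apply: avg_le; first exact: bounded_mfunZ.
by move=> y Qy; rewrite mulN1r (le_trans _ (fM y Qy))// -normrN ler_norm.
Qed.

Lemma avg_sum (I : Type) (s : seq I) (F : I -> 'rV[R]_d -> R) :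
  (forall i, bounded_mfun (F i)) ->
  bounded_mfun (fun y => \sum_(i <- s) F i y) /\
  avg Q (fun y => \sum_(i <- s) F i y) = \sum_(i <- s) avg Q (F i).
Proof.
move=> bF; elim: s => [|i s [IHb IH]].
  rewrite big_nil; under eq_fun do rewrite big_nil.
  by split; [exact: bounded_mfunC|exact: avgC].
rewrite big_cons -IH; under eq_fun do rewrite big_cons.
by split; [exact: bounded_mfunD|exact: avgD].
Qed.

Definition centroid : 'rV[R]_d := \row_j avg Q (fun y => y ord0 j).

Section bounded_cell.
Variable (L : R).
Hypothesis QL : forall y, Q y -> enorm y <= L.

Lemma bounded_coor j : bounded_mfun (fun y => y ord0 j).
Proof.
split; first exact: measurable_coor.
by exists L => y Qy; rewrite (le_trans (enorm_coor _ _))// QL.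
Qed.

Let bounded_coorM w i : bounded_mfun (fun y => y ord0 i * w ord0 i).
Proof.
have := bounded_mfunZ (w ord0 i) (bounded_coor i).
by under eq_fun do rewrite mulrC.
Qed.

Lemma bounded_dot w : bounded_mfun (fun y => dot y w).
Proof. by have [] := avg_sum (index_enum 'I_d) (bounded_coorM w). Qed.

Lemma dot_centroid w : dot centroid w = avg Q (fun y => dot y w).
Proof.
have [_ ->] := avg_sum (index_enum 'I_d) (bounded_coorM w).
apply: eq_bigr => i _; rewrite mxE mulrC -avgZ//; last exact: bounded_coor.
by under eq_fun do rewrite mulrC.
Qed.

(** Average the inner products with [y - centroid]. *)
Lemma centroid_dist (D : R) y : 0 <= D -> Q y ->
  (forall y', Q y' -> enorm (y - y') <= D) -> enorm (y - centroid) <= D.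
Proof.
move=> D0 Qy yD; have [->|yc0] := eqVneq (enorm (y - centroid)) 0; first by [].
have {}yc0 : 0 < enorm (y - centroid) by rewrite lt_def yc0 enorm_ge0.
rewrite -(ler_pM2l yc0) -expr2 enormE.
have -> : dot (y - centroid) (y - centroid) =
    avg Q (fun y' => dot y (y - centroid) + -1 * dot y' (y - centroid)).
  rewrite (@avgD (fun=> _)); [|exact: bounded_mfunC|by apply: bounded_mfunZ; exact: bounded_dot].
  rewrite avgC avgZ; last exact: bounded_dot.
  by rewrite -dot_centroid mulN1r -dotNl -dotDl.
apply: avg_le.
  by apply: bounded_mfunD; [exact: bounded_mfunC|apply: bounded_mfunZ; exact: bounded_dot].
move=> y' Qy'; rewrite mulN1r -dotNl -dotDl (le_trans (ler_norm _))//.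
by rewrite (le_trans (dot_le _ _))// mulrC ler_wpM2l ?(ltW yc0)// yD.
Qed.

End bounded_cell.

(** The field at [x] of a unit charge spread uniformly over the cell. *)
Definition cell_field i x : R := avg Q (fun y => kernel (y - x) i).

Let mfun_indic d1 (T : measurableType d1) (f : T -> 'rV[R]_d) :
  measurable_fun setT f -> measurable_fun setT (fun t => \1_Q (f t) : R).
Proof. by move=> mf; apply: (measurableT_comp _ mf); exact: measurable_indic. Qed.

Let integral_indic_mul (f : 'rV[R]_d -> R) :
  (\int[lam]_(y in Q) (f y)%:E = \int[lam]_y (\1_Q y * f y)%:E)%E.
Proof.
rewrite integral_mkcond; apply: eq_integral => y _.
by rewrite patchE indicE; case: ifP => _; rewrite ?mul1r ?mul0r.
Qed.

(** The positive and negative parts of the kernel give measurable functions of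
    [x] by Tonelli's theorem. *)
Lemma mfun_cell_field i : measurable_fun setT (cell_field i).
Proof.
pose G s x : \bar R := (\int[lam]_y (\1_Q y * Num.max (s * kernel (y - x) i) 0)%:E)%E.
have mG s : measurable_fun setT (G s).
  apply: (measurable_fun_fubini_tonelli_F (fun q : 'rV[R]_d * 'rV[R]_d =>
    (\1_Q q.2 * Num.max (s * kernel (q.2 - q.1) i) 0)%:E)).
    apply: mfun_EFin; apply: mfunM; first by apply: mfun_indic; meas.
    apply: mfun_max; last by meas.
    by apply: mfunM; [meas|apply: mfun_kernel; meas].
  by move=> q; rewrite lee_fin mulr_ge0// le_max lexx orbT.
apply: mfunM; first exact: mfunC.
rewrite (_ : (fun x => \int[lam]_(y in Q) kernel (y - x) i)%R =
    fun x => fine (G 1%R x - G (- 1)%R x)%E).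
  by apply: (measurableT_comp (fine_measurable measurableT)) => //; exact: emeasurable_funB.
apply/funext => x; rewrite /Rintegral integralE; congr (fine (_ - _)); rewrite /G -integral_indic_mul.
  by apply: eq_integral => y _; rewrite funeposE mul1r EFin_max.
by apply: eq_integral => y _; rewrite funenegE mulN1r EFin_max EFinN.
Qed.

(** The mean over [x] of an average over [Q] is an average of means. *)
Lemma cell_field_tonelli i (W : 'rV[R]_d -> R) (M : R) : measurable_fun setT W ->
  (forall x, 0 <= W x) ->
  (forall y, Q y -> \int[lam]_x (W x * `|kernel (y - x) i|)%:E <= M%:E)%E ->
  (\int[lam]_x (W x * `|cell_field i x|)%:E <= M%:E)%E.
Proof.
move=> mW W0 WM.
have v0 := vol_gt0; set v := fine (lam Q) in v0.
have vE : lam Q = v%:E by rewrite fineK// ge0_fin_numE.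
pose F (q : 'rV[R]_d * 'rV[R]_d) := (\1_Q q.2 * (W q.1 * `|kernel (q.2 - q.1) i|))%:E.
have mF : measurable_fun setT F.
  apply: mfun_EFin; apply: mfunM; first by apply: mfun_indic; meas.
  apply: mfunM; first by apply: (measurableT_comp mW); meas.
  by apply: mfun_norm; apply: mfun_kernel; meas.
have F0 q : (0 <= F q)%E by rewrite lee_fin !mulr_ge0.
have mFx := measurable_fun_fubini_tonelli_F _ mF F0 (m2 := lam).
have mFy := measurable_fun_fubini_tonelli_G _ mF F0 (m1 := lam).
have mWc : measurable_fun setT (fun x => (W x * `|cell_field i x|)%:E).
  by apply: mfun_EFin; apply: mfunM => //; apply: mfun_norm; exact: mfun_cell_field.
apply: (@le_trans _ _ (\int[lam]_x (v^-1%:E * \int[lam]_y F (x, y)))%E).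
  apply: ge0_le_integral => //.
  - by move=> x _; rewrite lee_fin mulr_ge0.
  - apply: emeasurable_funM; first exact: measurable_cst.
    exact: mFx.
  move=> x _; rewrite /F.
  have mk : measurable_fun setT (fun y => kernel (y - x) i) by apply: mfun_kernel; meas.
  have -> : (\int[lam]_y (\1_Q (x, y).2 * (W (x, y).1 * `|kernel ((x, y).2 - (x, y).1) i|))%:E =
      (W x)%:E * \int[lam]_y (\1_Q y * `|kernel (y - x) i|)%:E)%E.
    have mk1 : measurable_fun setT (fun y => (\1_Q y * `|kernel (y - x) i|)%:E).
      by apply: mfun_EFin; apply: mfunM; [apply: mfun_indic; meas|exact: mfun_norm].
    have k0 y : (0 <= (\1_Q y * `|kernel (y - x) i|)%:E)%E by rewrite lee_fin mulr_ge0.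
    rewrite -ge0_integralZl_EFin//.
    by apply: eq_integral => y _; rewrite -EFinM mulrCA.
  rewrite EFinM muleCA; apply: lee_wpmul2l; first by rewrite lee_fin.
  rewrite /cell_field /avg normrM EFinM ger0_norm ?invr_ge0 ?(ltW v0)//.
  apply: lee_wpmul2l; first by rewrite lee_fin invr_ge0 ltW.
  rewrite -integral_indic_mul.
  have := le_abse_integral lam mQ (measurable_funTS (mfun_EFin mk)).
  apply: le_trans; rewrite /Rintegral; by case: (\int[lam]_(y in Q) _)%E => [r| |] /=; rewrite ?normr0 ?leey.
have Fx0 x : (0 <= \int[lam]_y F (x, y))%E by apply: integral_ge0 => y _; exact: F0.
have vi0 : 0 <= v^-1 by rewrite invr_ge0 ltW.
rewrite (ge0_integralZl_EFin lam measurableT (fun x _ => Fx0 x) mFx vi0).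
rewrite (fubini_tonelli F mF F0).
rewrite -(@lee_pmul2l _ v%:E)//.
rewrite muleA -EFinM divff ?gt_eqF// mul1e [X in (_ <= X)%E]muleC -vE -integral_cst//.
rewrite [X in (_ <= X)%E]integral_mkcond; apply: (ge0_le_integral lam measurableT _ mFy).
- by move=> y _; apply: integral_ge0 => x _; exact: (F0 (x, y)).
- by apply/(measurable_restrictT _ mQ); exact: measurable_cst.
move=> y _; rewrite patchE /fubini_G /F /=.
case: ifPn => [|Qy].
  move/set_mem => Qy; under eq_integral do rewrite indicE mem_set// mul1r.
  exact: WM.
by under eq_integral do rewrite indicE (negbTE Qy) mul0r; rewrite integral0.
Qed.

End average.

(** * A point charge against a uniformly charged cell *)

Section cell_estimate.
Context {R : realType} {n : nat}.
Local Notation d := n.+1.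
Local Notation lam := (@lebesgue_rV R d).
Implicit Types x y z q : 'rV[R]_d.

Lemma kernel_sym_le q x i : `|kernel (q - x) i| <= enorm (x - q) / enorm (x - q) ^+ d.
Proof. by rewrite (enormBC x q); exact: kernel_le. Qed.

Lemma integral_kernel_near q (b : R) i : 0 < b ->
  (\int[lam]_x ((enorm (x - q) < b)%R%:R * `|kernel (q - x) i|)%:E <= (@ray_cst R d * b)%:E)%E.
Proof.
move=> b0.
have mk : measurable_fun setT (fun x => kernel (q - x) i) by apply: mfun_kernel; meas.
apply: le_trans (integral_kernel_ball (isT : (0 < d)%N) b0).
rewrite -[X in (_ <= X)%E](integral_shift (- q)); last 2 first.
- by meas.
- by move=> x; rewrite lee_fin !mulr_ge0// ?enorm_ge0// invr_ge0 exprn_ge0 ?enorm_ge0.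
apply: ge0_le_integralT.
- by move=> x; exact: mulr_ge0.
- by apply: mfunM; [meas|exact: mfun_norm].
- by meas.
- by move=> x; rewrite -mulrA ler_wpM2l// kernel_sym_le.
Qed.

Lemma integral_kernel_in_ball q (L : R) i : enorm q <= L ->
  (\int[lam]_x (in_ball x * `|kernel (q - x) i|)%:E <= (@ray_cst R d * (1 + L))%:E)%E.
Proof.
move=> qL.
have mk : measurable_fun setT (fun x => kernel (q - x) i) by apply: mfun_kernel; meas.
apply: le_trans (integral_kernel_at qL).
apply: ge0_le_integralT.
- by move=> x; exact: mulr_ge0.
- by apply: mfun_in_ballM; exact: mfun_norm.
- by apply: mfun_in_ballM; meas.
- by move=> x; rewrite ler_wpM2l// kernel_sym_le.
Qed.

Variables (Q : set 'rV[R]_d) (t D : R).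
Hypotheses (mQ : measurable Q) (Q0 : (0 < lam Q)%E).
Hypothesis Qsub : forall y, Q y -> shell t y.
Hypotheses (t0 : 0 < t) (t1 : t <= 1) (D0 : 0 < D) (tD : t <= D ^+ 2).
Hypothesis diam : forall y y', Q y -> Q y' -> enorm (y - y') <= D.

(** The radii [3 * D] and [3 * D] of the near zones contribute [6], and the tail
    beyond [2 * D] half of [24 * 4 ^+ d + 10 * d%:R]; [10] instead of [6] covers
    the cells of diameter at least [1 / 2]. *)
Definition cell_cst : R := @ray_cst R d * (10 + 12 * 4 ^+ d + 5 * d%:R).

Lemma cell_cst_gt0 : 0 < cell_cst.
Proof.
rewrite mulr_gt0 ?ray_cst_gt0// -addrA ltr_pwDl// addr_ge0// mulr_ge0// exprn_ge0.
Qed.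

Let Qoo : (lam Q < +oo)%E.
Proof.
apply: (@lebesgue_bounded _ _ _ (1 + t) mQ) => y i Qy.
exact: shell_coor (Qsub Qy).
Qed.

Let QL y : Q y -> enorm y <= 2.
Proof. by move=> /Qsub/andP[_ y1]; move: t1 => t1'; lra. Qed.

Let c := centroid Q.

Let e0 : 'rV[R]_d := delta_mx ord0 ord0.

Let e01 : enorm e0 = 1. Proof. exact: enorm_delta. Qed.

Let charge_gap x0 i x : R := `|kernel (x0 - x) i - cell_field Q i x|.

Let mgap x0 i : measurable_fun setT (charge_gap x0 i).
Proof.
apply: mfun_norm; apply: mfunD; first by apply: mfun_kernel; meas.
by apply: mfunN; exact: mfun_cell_field.
Qed.

Let cell_crude i :
  (\int[lam]_x (in_ball x * `|cell_field Q i x|)%:E <= (@ray_cst R d * 3)%:E)%E.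
Proof.
apply: (cell_field_tonelli mQ Q0 Qoo) => //.
  exact: (mfun_in_ball (@measurable_id _ 'rV[R]_d setT)).
move=> y Qy; have := integral_kernel_in_ball i (QL Qy).
by rewrite (_ : 1 + 2 = 3 :> R)//; ring.
Qed.

(** For cells of diameter bounded below, any charge will do. *)
Lemma cell_estimate_large : 1 / 2 <= D -> exists x0, enorm x0 = 1 /\
  forall i, (\int[lam]_x (in_ball x * `|kernel (x0 - x) i - cell_field Q i x|)%:E <=
    (cell_cst * D)%:E)%E.
Proof.
move=> D2; exists e0; split => // i.
have mk : measurable_fun setT (fun x => kernel (e0 - x) i) by apply: mfun_kernel; meas.
have mc := mfun_cell_field mQ i.
have mbk : measurable_fun setT (fun x => in_ball x * `|kernel (e0 - x) i|).
  by apply: mfun_in_ballM; exact: mfun_norm.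
have mbc : measurable_fun setT (fun x => in_ball x * `|cell_field Q i x|).
  by apply: mfun_in_ballM; exact: mfun_norm.
apply: (@le_trans _ _ (\int[lam]_x (in_ball x * `|kernel (e0 - x) i| +
    in_ball x * `|cell_field Q i x|)%:E)%E).
  apply: ge0_le_integralT.
  - by move=> x; exact: mulr_ge0.
  - by apply: mfun_in_ballM; exact: mgap.
  - exact: mfunD.
  - by move=> x; rewrite -mulrDr ler_wpM2l// ler_normB.
rewrite ge0_integralDT//; [|by move=> x; exact: mulr_ge0|by move=> x; exact: mulr_ge0].
have e0le : enorm e0 <= 1 by rewrite e01.
apply: le_trans (leeD (integral_kernel_in_ball i e0le) (cell_crude i)) _.
rewrite -EFinD lee_fin -mulrDr /cell_cst -mulrA ler_wpM2l ?(ltW (ray_cst_gt0 _))//.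
have h4 : 0 <= 12 * 4 ^+ d + 5 * d%:R :> R by rewrite addr_ge0// mulr_ge0// exprn_ge0.
have : 10 * (1 / 2) <= (10 + 12 * 4 ^+ d + 5 * d%:R) * D.
  by apply: ler_pM => //; rewrite -addrA lerDl.
by lra.
Qed.

Let cdist y : Q y -> enorm (y - c) <= D.
Proof.
move=> Qy; apply: (centroid_dist mQ Q0 Qoo QL (ltW D0) Qy) => y' Qy'.
exact: diam.
Qed.

Let c_le : enorm c <= 1 + t.
Proof.
have [->|c0] := eqVneq (enorm c) 0; first by move: t0 => ?; lra.
have {}c0 : 0 < enorm c by rewrite lt_def c0 enorm_ge0.
rewrite -(ler_pM2l c0) -expr2 enormE (dot_centroid mQ Q0 Qoo QL).
apply: (avg_le mQ Q0 Qoo); first exact: (bounded_dot mQ Q0 Qoo QL).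
move=> y Qy; rewrite (le_trans (ler_norm _))// (le_trans (dot_le _ _))// mulrC.
by rewrite ler_wpM2l ?enorm_ge0//; have /andP[_ /ltW] := Qsub Qy.
Qed.

(** [dot y y0 >= 1 - enorm (y - y0) ^+ 2 / 2] for points outside of the ball. *)
Let c_ge y0 : Q y0 -> 1 - D ^+ 2 / 2 <= enorm c * (1 + t).
Proof.
move=> Qy0; apply: (@le_trans _ _ (dot c y0)); last first.
  rewrite (le_trans (ler_norm _))// (le_trans (dot_le _ _))// ler_wpM2l ?enorm_ge0//.
  by have /andP[_ /ltW] := Qsub Qy0.
rewrite (dot_centroid mQ Q0 Qoo QL) -[X in _ <= X]opprK lerNr -mulN1r.
rewrite -(avgZ mQ Qoo); last exact: (bounded_dot mQ Q0 Qoo QL).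
apply: (avg_le mQ Q0 Qoo).
  by apply: bounded_mfunZ; exact: (bounded_dot mQ Q0 Qoo QL).
move=> y Qy; have := enormB_sq y (- y0); rewrite enormN dotNr => E.
have h : enorm (y - y0) ^+ 2 <= D ^+ 2.
  by apply: lerXn2r; rewrite ?nnegrE ?enorm_ge0 ?(ltW D0)// diam.
have sq1 y' : Q y' -> 1 <= enorm y' ^+ 2.
  by move=> /Qsub/andP[y1 _]; rewrite exprn_ege1.
by have := sq1 _ Qy; have := sq1 _ Qy0; lra.
Qed.

Section far.
Variable x : 'rV[R]_d.
Hypotheses (far : 2 * D <= enorm (c - x)) (far3 : enorm (c - x) <= 3).
Let z := c - x.

Let z0 : 0 < enorm z.
Proof. by rewrite (lt_le_trans _ far)// mulr_gt0. Qed.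

Let vz (v : 'rV[R]_d) : enorm v <= D -> enorm v <= enorm z / 2.
Proof. by move: far; rewrite -/z => far2 vD; lra. Qed.

Let yxE y : y - x = z + (y - c).
Proof. by rewrite /z [RHS]addrC addrA subrK. Qed.

Let bounded_kernel i : bounded_mfun Q (fun y => kernel (y - x) i).
Proof.
split; first by apply: mfun_kernel; meas.
exists (`|kernel z i| + 3 * 4 ^+ d * D / enorm z ^+ d) => y Qy.
have := kernel_lip z0 (vz (cdist Qy)) i; rewrite -yxE => lip.
rewrite -[kernel (y - x) i](subrK (kernel z i)) addrC (le_trans (ler_normD _ _))//.
rewrite lerD2l (le_trans lip)// ler_wpM2r ?invr_ge0 ?exprn_ge0 ?enorm_ge0//.
by rewrite ler_wpM2l ?mulr_ge0 ?exprn_ge0// cdist.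
Qed.

Let dkernelE i y : dkernel z (y - c) i =
  (enorm z ^+ d)^-1 * y ord0 i + (- (d%:R * z ord0 i / enorm z ^+ d.+2) * dot y z +
  (d%:R * dot c z * z ord0 i / enorm z ^+ d.+2 - c ord0 i / enorm z ^+ d)).
Proof.
by rewrite /dkernel (dotC z) dotDl dotNl !mxE; ring.
Qed.

Let avg_dkernel i : bounded_mfun Q (fun y => dkernel z (y - c) i) /\ avg Q (fun y => dkernel z (y - c) i) = 0.
Proof.
have b1 := bounded_mfunZ (enorm z ^+ d)^-1 (bounded_coor QL i).
have b2 := bounded_mfunZ (- (d%:R * z ord0 i / enorm z ^+ d.+2)) (bounded_dot mQ Q0 Qoo QL z).
have b3 := @bounded_mfunC R n Q (d%:R * dot c z * z ord0 i / enorm z ^+ d.+2 - c ord0 i / enorm z ^+ d).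
under eq_fun do rewrite dkernelE.
split; first exact: bounded_mfunD b1 (bounded_mfunD b2 b3).
rewrite (avgD mQ Qoo b1 (bounded_mfunD b2 b3)) (avgD mQ Qoo b2 b3) (avgC mQ Q0 Qoo).
rewrite (avgZ mQ Qoo _ (bounded_coor QL i)) (avgZ mQ Qoo _ (bounded_dot mQ Q0 Qoo QL z)).
rewrite -(dot_centroid mQ Q0 Qoo QL) -/c.
by rewrite (_ : avg Q _ = c ord0 i) ?mxE//; ring.
Qed.

(** The linear term of the expansion around the centroid averages to zero. *)
Lemma cell_field_far i : `|cell_field Q i x - kernel z i| <=
  (6 * 4 ^+ d + 10 * d%:R) * D ^+ 2 / enorm z ^+ d.+1.
Proof.
have [bd d0] := avg_dkernel i; have bk := bounded_kernel i.
have bC := @bounded_mfunC R n Q (- kernel z i).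
have bN := bounded_mfunZ (- 1) bd.
have -> : cell_field Q i x - kernel z i =
    avg Q (fun y => kernel (y - x) i + (- kernel z i + -1 * dkernel z (y - c) i)).
  rewrite (avgD mQ Qoo bk (bounded_mfunD bC bN)) (avgD mQ Qoo bC bN) (avgC mQ Q0 Qoo).
  by rewrite (avgZ mQ Qoo _ bd) d0 mulr0 addr0.
apply: (avg_norm_le mQ Q0 Qoo); first exact: bounded_mfunD bk (bounded_mfunD bC bN).
move=> y Qy; have := kernel_taylor z0 (vz (cdist Qy)) i; rewrite -yxE mulN1r addrA => tay.
apply: (le_trans tay); rewrite ler_wpM2r ?invr_ge0 ?exprn_ge0 ?enorm_ge0//.
rewrite ler_wpM2l ?addr_ge0 ?mulr_ge0 ?exprn_ge0//.
by apply: lerXn2r; rewrite ?nnegrE ?enorm_ge0 ?(ltW D0)// cdist.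
Qed.

Lemma cell_gap_far x0 i : enorm (x0 - c) <= D -> enorm (x0 - c) <= 2 * D ^+ 2 ->
  charge_gap x0 i x <= (24 * 4 ^+ d + 10 * d%:R) * D ^+ 2 / enorm z ^+ d.+1.
Proof.
move=> x0D x0D2; rewrite /charge_gap.
have lip := kernel_lip z0 (vz x0D) i; rewrite -yxE in lip.
have far' := cell_field_far i; rewrite distrC in far'.
have zd : 0 < enorm z ^+ d.+1 by rewrite exprn_gt0.
have -> : kernel (x0 - x) i - cell_field Q i x =
    (kernel (x0 - x) i - kernel z i) + (kernel z i - cell_field Q i x) by ring.
apply: (le_trans (ler_normD _ _)); apply: (le_trans (lerD lip far')).
rewrite -lerBrDr -mulrBl ler_pdivlMr//.
rewrite (_ : _ / enorm z ^+ d * _ = 3 * 4 ^+ d * enorm (x0 - c) * enorm z); last first.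
  by rewrite [enorm z ^+ d.+1]exprS; field; rewrite expf_neq0// gt_eqF.
have c0 : 0 <= 4 ^+ d :> R by rewrite exprn_ge0.
have : enorm (x0 - c) * enorm z <= 2 * D ^+ 2 * 3.
  by apply: ler_pM => //; exact: enorm_ge0.
move=> /(ler_wpM2l (mulr_ge0 (ler0n R 3) c0)); rewrite mulrA => h.
by apply: (le_trans h); apply: le_of_eq; ring.
Qed.

End far.

(** The charge is placed at the radial projection of the centroid, which moves the
    centroid by at most [2 * D ^+ 2]: a cell of the thin shell is flat to second
    order.  Far from the cell the gap is then of second order in [D], near the cell
    both fields are bounded separately. *)
Lemma cell_estimate_small : D <= 1 / 2 -> exists x0, enorm x0 = 1 /\
  forall i, (\int[lam]_x (in_ball x * `|kernel (x0 - x) i - cell_field Q i x|)%:E <=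
    (cell_cst * D)%:E)%E.
Proof.
move=> D2.
have [y0 Qy0] := cell_nonempty Q0.
have Dsq : D ^+ 2 <= D / 2 by rewrite expr2 ler_pM2l//; lra.
have cge : 1 - 7 / 4 * D ^+ 2 <= enorm c.
  have h1 := c_ge Qy0; have h2 := c_le.
  have h3 : enorm c * t <= (1 + t) * t by rewrite ler_wpM2r// ltW.
  have h4 : t * t <= 1 / 4 * t by rewrite ler_wpM2r ?(ltW t0)//; move: tD; lra.
  by move: tD; lra.
have c0 : 0 < enorm c by lra.
pose x0 := (enorm c)^-1 *: c.
have x0c : enorm (x0 - c) <= 2 * D ^+ 2.
  have -> : x0 - c = ((enorm c)^-1 - 1) *: c by rewrite scalerBl scale1r.
  rewrite enormZ -{2}(gtr0_norm c0) -normrM mulrBl mul1r mulVf ?gt_eqF//.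
  rewrite ler_norml; have := c_le; move: tD; have := sqr_ge0 D; lra.
have x0D : enorm (x0 - c) <= D by rewrite (le_trans x0c)//; lra.
exists x0; split.
  by rewrite enormZ gtr0_norm ?invr_gt0// mulVf// gt_eqF.
move=> i; pose CT : R := (24 * 4 ^+ d + 10 * d%:R) * D ^+ 2.
have CT0 : 0 <= CT by rewrite mulr_ge0 ?sqr_ge0// addr_ge0// mulr_ge0// exprn_ge0.
pose tail x : R := ((2 * D <= enorm x) && (enorm x < 3))%R%:R * (enorm x)^-1 / enorm x ^+ d.
have mk : measurable_fun setT (fun x => kernel (x0 - x) i) by apply: mfun_kernel; meas.
have mc := mfun_cell_field mQ i.
have mf1 : measurable_fun setT (fun x => (enorm (x - x0) < 3 * D)%R%:R * `|kernel (x0 - x) i|).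
  by apply: mfunM; [meas|exact: mfun_norm].
have mf2 : measurable_fun setT (fun x => (enorm (x - c) < 2 * D)%R%:R * `|cell_field Q i x|).
  by apply: mfunM; [meas|exact: mfun_norm].
have mtail d1 (T : measurableType d1) (f : T -> 'rV[R]_d) : measurable_fun setT f ->
    measurable_fun setT (fun t => tail (f t)) by move=> mf; rewrite /tail; meas.
have mf3 : measurable_fun setT (fun x => CT * tail (x - c)).
  by apply: mfunM; [meas|apply: mtail; meas].
have tail0 x : 0 <= tail x.
  by rewrite !mulr_ge0// ?invr_ge0 ?exprn_ge0// enorm_ge0.
have f10 x : 0 <= (enorm (x - x0) < 3 * D)%R%:R * `|kernel (x0 - x) i| by exact: mulr_ge0.
have f20 x : 0 <= (enorm (x - c) < 2 * D)%R%:R * `|cell_field Q i x| by exact: mulr_ge0.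
have f30 x : 0 <= CT * tail (x - c) by exact: mulr_ge0.
apply: (@le_trans _ _ (\int[lam]_x ((enorm (x - x0) < 3 * D)%R%:R * `|kernel (x0 - x) i| +
   ((enorm (x - c) < 2 * D)%R%:R * `|cell_field Q i x| + CT * tail (x - c)))%:E)%E).
  apply: ge0_le_integralT.
  - by move=> x; exact: mulr_ge0.
  - by apply: mfun_in_ballM; exact: mgap.
  - by apply: mfunD => //; exact: mfunD.
  move=> x; have := f10 x; have := f20 x; have := f30 x.
  rewrite /in_ball; case: (ltP (enorm x) 1) => [x1|_]; last by rewrite mul0r => *; rewrite !addr_ge0.
  (* [x0] is within [D] of [c], so the ball of radius [2 * D] around [c] is
     contained in that of radius [3 * D] around [x0]. *)
  rewrite mul1r => g3 g2 g1; have [near|far] := ltP (enorm (x - c)) (2 * D).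
    have -> : enorm (x - x0) < 3 * D.
      have := enormD (x - c) (c - x0); rewrite addrA subrK (enormBC c x0); lra.
    by rewrite !mul1r addrA (le_trans (ler_normB _ _))// lerDl.
  rewrite enormBC in far.
  have far3 : enorm (c - x) < 3.
    have := enormB c x; have := c_le; move: t1; lra.
  apply: (le_trans (cell_gap_far far (ltW far3) i x0D x0c)).
  rewrite mul0r add0r; apply: ler_wpDl => //.
  rewrite /tail (enormBC x c) far far3 /= mul1r -/CT [_ ^+ d.+1]exprS invfM.
  by [].
rewrite ge0_integralDT//; last 2 first.
- by move=> x; rewrite addr_ge0.
- exact: mfunD.
rewrite ge0_integralDT//.
have I1 := @integral_kernel_near x0 (3 * D) i (mulr_gt0 (ltr0n R 3) D0).
have I2 : (\int[lam]_x ((enorm (x - c) < 2 * D)%R%:R * `|cell_field Q i x|)%:E <= (@ray_cst R d * (3 * D))%:E)%E.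
  apply: (cell_field_tonelli mQ Q0 Qoo) => //; first by meas.
  move=> y Qy; apply: le_trans (@integral_kernel_near y (3 * D) i (mulr_gt0 (ltr0n R 3) D0)).
  have mky : measurable_fun setT (fun x => kernel (y - x) i) by apply: mfun_kernel; meas.
  apply: ge0_le_integralT.
  - by move=> x; exact: mulr_ge0.
  - by apply: mfunM; [meas|exact: mfun_norm].
  - by apply: mfunM; [meas|exact: mfun_norm].
  move=> x; rewrite ler_wpM2r//; have [near|//] := ltP (enorm (x - c)) (2 * D).
  have -> // : enorm (x - y) < 3 * D.
  have := enormD (x - c) (c - y); rewrite addrA subrK (enormBC c y); have := cdist Qy; lra.
have I3 : (\int[lam]_x (CT * tail (x - c))%:E <= (CT * (@ray_cst R d * (2 * D)^-1))%:E)%E.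
  rewrite -(integral_shift c); last 2 first.
  - exact: mfun_EFin.
  - by move=> x; rewrite lee_fin.
  under eq_integral do rewrite addrK EFinM.
  rewrite ge0_integralZl_EFin//; [|by move=> x _; rewrite lee_fin|].
    2: by apply: mfun_EFin; apply: (mtail _ _ (fun x => x)); meas.
  rewrite [X in (_ <= X)%E]EFinM; apply: lee_wpmul2l; first by rewrite lee_fin.
  by apply: integral_kernel_tail => //; [exact: mulr_gt0|lra].
apply: le_trans (leeD I1 (leeD I2 I3)) _.
rewrite -!EFinD lee_fin /cell_cst /CT.
have cr := @ray_cst_gt0 R d isT.
have total (k F G : R) : k * (3 * D) + (k * (3 * D) + (24 * F + 10 * G) * D ^+ 2 *
    (k * (2 * D)^-1)) = k * (6 + 12 * F + 5 * G) * D by field; rewrite gt_eqF.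
rewrite total.
by rewrite ler_wpM2r ?(ltW D0)// ler_wpM2l ?(ltW cr)// !lerD2r; lra.
Qed.

Lemma cell_estimate : exists x0, enorm x0 = 1 /\
  forall i, (\int[lam]_x (in_ball x * `|kernel (x0 - x) i - cell_field Q i x|)%:E <=
    (cell_cst * D)%:E)%E.
Proof.
have [D2|D2] := leP (1 / 2) D; first exact: cell_estimate_large.
exact/cell_estimate_small/ltW.
Qed.

End cell_estimate.

(** * Cutting a region into cells of equal volume *)

Section cut.
Context {R : realType} {n : nat}.
Local Notation d := n.+1.
Local Notation lam := (@lebesgue_rV R d).
Implicit Types (x y z : 'rV[R]_d) (Q : set 'rV[R]_d).

Definition bounded2 Q := forall y j, Q y -> `|y ord0 j| <= 2.

Section cut_coordinate.
Variables (Q : set 'rV[R]_d) (j : 'I_d) (v : R).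
Hypotheses (mQ : measurable Q) (Q2 : bounded2 Q) (Qv : lam Q = v%:E).

Let below s : set 'rV[R]_d := Q `&` [set y | y ord0 j <= s].
Let slice a b : set 'rV[R]_d := Q `&` [set y | (a < y ord0 j) && (y ord0 j <= b)].

Let mbelow s : measurable (below s).
Proof. by apply: measurableI => //; apply: mset_bool; meas. Qed.

Let mslice a b : measurable (slice a b).
Proof. by apply: measurableI => //; apply: mset_bool; meas. Qed.

Let sub_fin S : measurable S -> S `<=` Q -> (lam S < +oo)%E.
Proof.
move=> mS SQ; apply: (@lebesgue_bounded _ _ S 2 mS) => y i /SQ; exact: Q2.
Qed.

Let G s : R := fine (lam (below s)).

Let GE s : lam (below s) = (G s)%:E.
Proof.
rewrite fineK// ge0_fin_numE// sub_fin// => y; by case.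
Qed.

Let below_slice a b : a <= b -> below b = below a `|` slice a b.
Proof.
move=> ab; apply/seteqP; split => y /=; rewrite /below /slice /=.
  by move=> [Qy yb]; have [ya|ya] := leP (y ord0 j) a; [left|right]; rewrite ?ya.
by case=> -[Qy]; [move=> /le_trans -> //|move=> /andP[_ yb]].
Qed.

Let disj_slice a b : [disjoint below a & slice a b].
Proof.
apply/disj_set2P; apply/seteqP; split => // y [[_ /= ya] [_ /= /andP[ay _]]].
by move: ay; rewrite ltNge ya.
Qed.

Let slice_vol a b : a <= b -> lam (slice a b) = (G b - G a)%:E.
Proof.
move=> ab.
have : lam (below b) = (lam (below a) + lam (slice a b))%E.
  rewrite (below_slice ab) measureU//.
  exact/disj_set2P/disj_slice.
have fS : lam (slice a b) \is a fin_num.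
  by rewrite ge0_fin_numE// sub_fin// => y; case.
rewrite !GE -(fineK fS) -EFinD => -[->]; congr (_%:E); lra.
Qed.

Let K : R := \prod_(l < d | l != j) 4.

Let slice_le a b : a <= b -> (lam (slice a b) <= (K * (b - a))%:E)%E.
Proof.
move=> ab.
pose A (l : 'I_d) : set R := if l == j then `]a, b]%classic else `[- 2, 2]%classic.
have mA l : measurable (A l) by rewrite /A; case: ifP.
apply: (@le_trans _ _ (lam [set y | forall l, A l (y ord0 l)])).
  apply: measure_le => //; first exact: (measurable_box mA).
  move=> y [Qy /= yab] l; rewrite /A; case: eqP => [->|_] /=; rewrite in_itv//=.
  by rewrite -ler_norml Q2.
rewrite (lebesgue_rV_box mA) (bigD1 j)//= /A eqxx.
rewrite (eq_bigr (fun=> 4%:E)); last first.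
  move=> l /negbTE ->; rewrite lebesgue_measure_itv/= lte_fin ifT; last lra.
  by rewrite -EFinB; congr (_%:E); lra.
rewrite prodEFin -/K lebesgue_measure_itv/= lte_fin muleC.
move: ab; rewrite le_eqVlt => /predU1P[->|ab]; first by rewrite ltxx mule0 subrr mulr0.
by rewrite ab -EFinB -EFinM.
Qed.

Let K0 : 0 <= K. Proof. exact: prodr_ge0. Qed.

Let G_lip a b : a <= b -> 0 <= G b - G a <= K * (b - a).
Proof.
move=> ab; have := slice_le ab; rewrite (slice_vol ab) lee_fin => ->; rewrite andbT.
by rewrite -lee_fin -(slice_vol ab).
Qed.

Let G_cont : continuous G.
Proof.
move=> x; apply/cvgrPdist_lt => e e0.
have K1 : 0 < K + 1 by rewrite ltr_wpDl.
near=> y.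
have xy : `|x - y| < e / (K + 1).
  by near: y; apply: cvgr_dist_lt; rewrite ?divr_gt0.
have bound : `|G x - G y| <= K * `|x - y|.
  have [xy'|yx] := leP x y.
    have /andP[g0 gK] := G_lip xy'; rewrite distrC ger0_norm// distrC ger0_norm ?subr_ge0//.
  have /andP[g0 gK] := G_lip (ltW yx); rewrite ger0_norm// ger0_norm ?subr_ge0//.
  exact: ltW.
apply: (le_lt_trans bound); move: xy; rewrite ltr_pdivlMr// => xy.
apply: le_lt_trans xy; rewrite mulrC mulrDr mulr1 lerDl.
exact: normr_ge0.
Unshelve. all: by end_near. Qed.

Let G_lo : G (- 3) = 0.
Proof.
rewrite /G (_ : below _ = set0) ?measure0//; apply/seteqP; split => // y [Qy /= y3].
by have := Q2 j Qy; rewrite ler_norml => /andP[+ _]; lra.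
Qed.

Let G_hi : G 3 = v.
Proof.
rewrite /G (_ : below _ = Q) ?Qv//; apply/seteqP; split => [y [] //|y Qy]; split => //=.
by have := Q2 j Qy; rewrite ler_norml => /andP[_ +]; lra.
Qed.

(** The volume below a level is continuous in the level, so it takes all the
    values [i * v / m]. *)
Lemma cut_coordinate (m : nat) : (0 < m)%N -> 0 < v ->
  exists (C : 'I_m -> set 'rV[R]_d) (w : 'I_m -> R),
  [/\ forall i, [/\ measurable (C i), C i `<=` Q & lam (C i) = (v / m%:R)%:E],
      forall i, 0 <= w i,
      forall i y y', C i y -> C i y' -> `|y ord0 j - y' ord0 j| <= w i,
      \sum_i w i = 6 &
      forall f : 'rV[R]_d -> R, measurable_fun setT f -> (forall y, 0 <= f y) ->
        (\sum_i \int[lam]_(y in C i) (f y)%:E = \int[lam]_(y in Q) (f y)%:E)%E].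
Proof.
move=> m0 v0; have mR : 0 < (m%:R : R) by rewrite ltr0n.
(* Levels [-3] and [3] lie strictly outside of the range of the coordinate. *)
have /choice[s sP] (i : nat) : exists s, (i <= m)%N ->
    [/\ - 3 <= s <= 3, G s = i%:R * (v / m%:R), i = 0 -> s = - 3 & i = m -> s = 3].
  have [im|im] := leqP i m; last by exists 0.
  have [->|i0] := eqVneq i 0.
    by exists (- 3) => _; rewrite G_lo mul0r; split => // [|m0']; [lra|rewrite -m0' in m0].
  have [->|inm] := eqVneq i m.
    exists 3 => _; rewrite G_hi mulrC divfK ?gt_eqF//; split => //; first lra.
    by move=> m0'; rewrite m0' in m0.
  have /IVT : - 3 <= (3 : R) by lra.
  move=> /(_ G (i%:R * (v / m%:R)) (continuous_subspaceT G_cont)).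
  rewrite G_lo G_hi min_l ?(ltW v0)// max_r ?(ltW v0)//.
  case.
    rewrite mulr_ge0 ?divr_ge0 ?(ltW v0)//= mulrCA ler_piMr ?(ltW v0)//.
    by rewrite ler_pdivrMr// mul1r ler_nat.
  move=> c; rewrite in_itv/= => cI Gc; exists c => _; split => //.
    by move=> i0'; rewrite i0' eqxx in i0.
  by move=> inm'; rewrite inm' eqxx in inm.
have sG i : (i <= m)%N -> G (s i) = i%:R * (v / m%:R) by move=> /sP[].
have s_mono i : (i < m)%N -> s i <= s i.+1.
  move=> im; rewrite leNgt; apply/negP => /ltW/G_lip/andP[+ _].
  rewrite (sG _ (ltnW im)) (sG _ im) -mulrBl -natr1.
  have : 0 < v / m%:R by rewrite divr_gt0.
  by rewrite opprD addrA subrr add0r mulN1r; lra.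
have s0 : s 0 = - 3 by have [] := sP 0 (leq0n m); auto.
have sm : s m = 3 by have [] := sP m (leqnn m); auto.
exists (fun i : 'I_m => slice (s i) (s i.+1)), (fun i : 'I_m => s i.+1 - s i); split.
- move=> i; split => //; first by move=> y [].
  rewrite slice_vol ?s_mono// (sG _ (ltnW (ltn_ord i))) (sG _ (ltn_ord i)).
  by congr (_%:E); rewrite -natr1; ring.
- by move=> i; rewrite subr_ge0 s_mono.
- move=> i y y' [_ /= /andP[y1 y2]] [_ /= /andP[y1' y2']].
  by rewrite ler_norml; lra.
- rewrite -(big_mkord xpredT (fun i => s i.+1 - s i)) telescope_sumr// s0 sm; lra.
move=> f mf f0.
have step k : (k <= m)%N -> (\sum_(i < k) \int[lam]_(y in slice (s i) (s i.+1)) (f y)%:E =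
    \int[lam]_(y in below (s k)) (f y)%:E)%E.
  elim: k => [_|k IH km].
    rewrite big_ord0 s0 (_ : below _ = set0) ?integral_set0//.
    apply/seteqP; split => // y [Qy /= y3].
    by have := Q2 j Qy; rewrite ler_norml => /andP[+ _]; lra.
  rewrite big_ord_recr/= IH ?(ltnW km)// (below_slice (s_mono _ km)) ge0_integral_setU//.
    exact: measurable_funTS (mfun_EFin mf).
  by move=> y _; rewrite lee_fin.
rewrite (step m (leqnn m)) sm; congr (integral _ _ _).
apply/seteqP; split => [y [] //|y Qy]; split => //=.
by have := Q2 j Qy; rewrite ler_norml => /andP[_ +]; lra.
Qed.

End cut_coordinate.

(** Cutting successively along the coordinates of [js]: at each stage the
    pieces of one cell are disjoint slabs, so their widths add up to at most the
    width of the region, whatever the shape of the cells. *)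
Lemma cut_region Q (v : R) (m : nat) (js : seq 'I_d) : measurable Q -> bounded2 Q ->
  lam Q = v%:E -> 0 < v -> (0 < m)%N ->
  exists (I : finType) (C : I -> set 'rV[R]_d) (w : I -> R),
  [/\ #|I| = (m ^ size js)%N,
      forall a, [/\ measurable (C a), C a `<=` Q & lam (C a) = (v / m%:R ^+ size js)%:E],
      forall a, 0 <= w a,
      forall a y y', C a y -> C a y' -> \sum_(j <- js) `|y ord0 j - y' ord0 j| <= w a &
      (\sum_a w a) * m%:R <= 6 * (size js)%:R * m%:R ^+ size js /\
      forall f : 'rV[R]_d -> R, measurable_fun setT f -> (forall y, 0 <= f y) ->
        (\sum_a \int[lam]_(y in C a) (f y)%:E = \int[lam]_(y in Q) (f y)%:E)%E].
Proof.
move=> mQ Q2 Qv v0 m0; have mR : 0 < (m%:R : R) by rewrite ltr0n.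
elim: js => [|j js [I [C [w [cardI CP w0 Cw [wsum Cint]]]]]].
  exists 'I_1, (fun=> Q), (fun=> 0); split => //=.
  - by rewrite card_ord.
  - by move=> _; split => //; rewrite expr0 divr1.
  - by move=> _ y y' _ _; rewrite big_nil.
  split; first by rewrite big1// mul0r mulr0 mul0r.
  by move=> f _ _; rewrite big_ord1.
set k := size js in cardI CP wsum.
have vk0 : 0 < v / m%:R ^+ k by rewrite divr_gt0// exprn_gt0.
have /choice[C1 /choice[w1 P1]] (a : I) : exists C1, exists w1 : 'I_m -> R,
  [/\ forall i : 'I_m, [/\ measurable (C1 i), C1 i `<=` C a & lam (C1 i) = (v / m%:R ^+ k / m%:R)%:E],
      forall i, 0 <= w1 i,
      forall i y y', C1 i y -> C1 i y' -> `|y ord0 j - y' ord0 j| <= w1 i,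
      \sum_i w1 i = 6 &
      forall f : 'rV[R]_d -> R, measurable_fun setT f -> (forall y, 0 <= f y) ->
        (\sum_i \int[lam]_(y in C1 i) (f y)%:E = \int[lam]_(y in C a) (f y)%:E)%E].
  have [mC CQ Cv] := CP a.
  have Ca2 : bounded2 (C a) by move=> y i /CQ; exact: Q2.
  exact: (@cut_coordinate (C a) j _ mC Ca2 Cv m m0 vk0).
exists (I * 'I_m)%type, (fun q => C1 q.1 q.2), (fun q => w q.1 + w1 q.1 q.2); split.
- by rewrite card_prod card_ord cardI -expnSr.
- move=> [a i] /=; have [/(_ i)[mC CC Cv] _ _ _ _] := P1 a; have [_ CQ _] := CP a; split => //.
    exact: subset_trans CC CQ.
  by rewrite Cv exprSr invfM mulrA.
- by move=> [a i] /=; have [_ /(_ i) w10 _ _ _] := P1 a; rewrite addr_ge0.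
- move=> [a i] y y' /= Cy Cy'; have [/(_ i)[_ CC _] _ /(_ i y y' Cy Cy') wj _ _] := P1 a.
  rewrite big_cons addrC lerD//; apply: Cw; exact: CC.
split.
  rewrite -(pair_bigA _ (fun a i => w a + w1 a i))/=.
  have -> : \sum_a \sum_i (w a + w1 a i) = (\sum_a w a) * m%:R + 6 * m%:R ^+ k.
    have E a : \sum_i (w a + w1 a i) = w a * m%:R + 6.
      rewrite big_split/= sumr_const card_ord mulr_natr; congr (_ + _).
      by have [_ _ _ ->] := P1 a.
    rewrite (eq_bigr _ (fun a _ => E a)) big_split/= -mulr_suml sumr_const cardI.
    by rewrite -[6 *+ _]mulr_natr natrX.
  rewrite exprSr -[(size js).+1%:R]natr1 -/k.
  have : (\sum_a w a) * m%:R * m%:R <= 6 * k%:R * m%:R ^+ k * m%:R by rewrite ler_wpM2r// ltW.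
  have E (A B M K' : R) : A * M * M <= 6 * K' * B * M ->
    (A * M + 6 * B) * M <= 6 * (K' + 1) * (B * M) by lra.
  exact: E.
move=> f mf f0; rewrite -Cint//.
rewrite -(pair_bigA _ (fun a i => \int[lam]_(y in C1 a i) (f y)%:E)%E)/=.
by apply: eq_bigr => a _; have [_ _ _ _ ->] := P1 a.
Qed.

End cut.

(** * The faces of a thin shell *)

Section faces.
Context {R : realType} {n : nat}.
Local Notation d := n.+1.
Local Notation lam := (@lebesgue_rV R d).
Implicit Types (x y z : 'rV[R]_d) (f : 'I_d * bool).

(** A hyperplane lies in arbitrarily thin slabs. *)
Lemma hyperplane_null p : p != 0 -> lam [set y | shell 1 y && (dot p y == 0)] = 0%E.
Proof.
move=> p0; have np : 0 < enorm p by rewrite lt_def enorm_eq0 p0 enorm_ge0.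
have u1 : enorm ((enorm p)^-1 *: p) = 1.
  by rewrite enormZ gtr0_norm ?invr_gt0// mulVf// gt_eqF.
have msh := @mfun_shell R d 1 _ _ (fun y => y) (@measurable_id _ _ _).
have mdot : measurable_fun setT (fun y => dot p y) by rewrite /dot; meas.
have mH : measurable [set y | shell 1 y && (dot p y == 0)].
  by apply: mset_bool; apply: mfun_and => //; apply: measurable_fun_eqr => //; meas.
apply/eqP; rewrite -measure_le0; apply/lee_addgt0Pr => e e0; rewrite add0e.
pose K : R := 2 * d%:R * 4 ^+ n.
have K0 : 0 < K by rewrite !mulr_gt0// exprn_gt0.
apply: (@le_trans _ _ (\int[lam]_x ((shell 1 x)%:R *
    (`|dot ((enorm p)^-1 *: p) x| < e / K)%R%:R)%:E)%E); last first.
  apply: le_trans (slab_le _ u1) _; first exact: divr_gt0.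
  by rewrite lee_fin -/K mulrC divfK// gt_eqF.
rewrite -[X in (X <= _)%E]mul1e -integral_cst// [X in (X <= _)%E]integral_mkcond.
apply: ge0_le_integral => //.
- by move=> y _; rewrite patchE; case: ifP.
- by apply/(measurable_restrictT _ mH); exact: measurable_cst.
- apply: mfun_EFin; apply: mfunM; first exact: mfun_bool.
  by apply: mfun_bool; rewrite /dot; meas.
move=> y _; rewrite patchE; case: ifPn => [/set_mem /= /andP[-> /eqP py]|_].
  by rewrite dotZl py mulr0 normr0 divr_gt0// mul1r.
by rewrite lee_fin mulr_ge0.
Qed.

(** The radial projection to the shell of the open face of a cube orthogonal to
    the axis [f.1]; the bit [f.2] is the sign of its outer normal. *)
Definition face (t : R) f : set 'rV[R]_d := [set y | [/\ shell t y,
  0 < (-1) ^+ f.2 * y ord0 f.1 &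
  forall j, j != f.1 -> `|y ord0 j| < (-1) ^+ f.2 * y ord0 f.1]].

Lemma face_sub t f : face t f `<=` [set y | shell t y].
Proof. by move=> y []. Qed.

Lemma measurable_face t f : measurable (face t f).
Proof.
rewrite (_ : face t f = [set y | shell t y && (0 < (-1) ^+ f.2 * y ord0 f.1)] `&`
   \bigcap_(j in [set j | j != f.1]) [set y | `|y ord0 j| < (-1) ^+ f.2 * y ord0 f.1]).
  apply: measurableI.
    apply: mset_bool; apply: mfun_and; last by meas.
    exact: (@mfun_shell R d t _ _ (fun y => y) (@measurable_id _ _ _)).
  apply: fin_bigcap_measurable; first exact: finite_finset.
  by move=> j _; apply: mset_bool; meas.
apply/seteqP; split => y.
  by move=> [ty y0 fy]; split => [|j]; [apply/andP|exact: fy].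
by move=> [/andP[ty y0] fy]; split => // j; exact: fy.
Qed.

Lemma face_disjoint t : trivIset setT (face t).
Proof.
move=> [i b] [i' b'] _ _ [y [[_ /= y0 yi] [_ /= y0' yi']]].
have [ii'|ii'] := eqVneq i i'; last first.
  have := yi i'; rewrite eq_sym ii' => /(_ isT) lt1; have := yi' i ii' => lt2.
  have b1 (c : bool) (r : R) : (-1) ^+ c * r <= `|r|.
    by rewrite (le_trans (ler_norm _))// normrM normr_sign mul1r.
  have := lt_le_trans lt1 (b1 b (y ord0 i)); have := lt_le_trans lt2 (b1 b' (y ord0 i')).
  by move=> h1 h2; have := lt_trans h1 h2; rewrite ltxx.
subst i'; congr (_, _); move: y0 y0'; case: b {yi}; case: b' {yi'} => //=;
  rewrite expr0 expr1 ?mul1r ?mulN1r; lra.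
Qed.

(** Off the hyperplanes where two coordinates agree up to sign, a single
    coordinate has the largest absolute value. *)
Lemma face_cover t : t <= 1 ->
  lam.-negligible ([set y | shell t y] `\` \bigcup_f face t f).
Proof.
move=> t1.
pose v (q : 'I_d * 'I_d * bool) : 'rV[R]_d :=
  delta_mx ord0 q.1.1 - (-1) ^+ q.2 *: delta_mx ord0 q.1.2.
have dotv q y : dot (v q) y = y ord0 q.1.1 - (-1) ^+ q.2 * y ord0 q.1.2.
  have dd j : dot (delta_mx ord0 j) y = y ord0 j.
    rewrite /dot (bigD1 j)//= mxE !eqxx mul1r big1 ?addr0// => l lj.
    by rewrite mxE (negbTE lj) andbF mul0r.
  by rewrite dotDl dotNl dotZl !dd.
pose H q := [set y | shell 1 y && (dot (v q) y == 0)].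
pose H' k : set 'rV[R]_d := if unpickle k is Some q then
  (if q.1.1 == q.1.2 :> 'I_d then set0 else H q) else set0.
have H'0 k : lam.-negligible (H' k).
  rewrite /H'; case: unpickle => [q|]; last exact: negligible_set0.
  case: eqP => q12; first exact: negligible_set0.
  have vq0 : v q != 0.
    apply/eqP => /rowP/(_ q.1.1); rewrite !mxE !eqxx/=.
    case: eqP => // _; rewrite mulr0 subr0 => /eqP; exact/negP/oner_neq0.
  exists (H q); split => //; last exact: hyperplane_null.
  apply: mset_bool; apply: mfun_and.
    exact: (@mfun_shell R d 1 _ _ (fun y => y) (@measurable_id _ _ _)).
  by apply: measurable_fun_eqr; rewrite /dot; meas.
apply: negligibleS (negligible_bigcup H'0) => y [/= ty nf].
have y1 : shell 1 y.
  by move: ty; rewrite /shell => /andP[-> /lt_le_trans ->//]; rewrite lerD2l.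
pose i := [arg max_(l > ord0) `|y ord0 l|]%O.
have imax l : `|y ord0 l| <= `|y ord0 i| by rewrite /i; case: arg_maxP => // k _; exact.
have yi0 : 0 < `|y ord0 i|.
  rewrite normr_gt0; apply/eqP => yi; have : y = 0.
    by apply/rowP => l; apply/eqP; have := imax l; rewrite yi normr0 normr_le0 mxE.
  by move=> yE; move: ty; rewrite yE /shell enorm0 ler10.
pose b := y ord0 i < 0.
have yb : (-1) ^+ b * y ord0 i = `|y ord0 i| by rewrite -real_normrEsign ?num_real.
apply: contrapT => nH; apply: nf; exists (i, b) => //; split => //=; rewrite ?yb//.
move=> j ji; rewrite lt_def imax andbT eq_sym; apply/eqP => yji; apply: nH.
exists (pickle (j, i, b (+) (y ord0 j < 0))) => //; rewrite /H' pickleK /= (negbTE ji).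
rewrite /H /= y1 dotv/= signr_addb mulrAC yb -yji mulrC.
by rewrite mulr_sign_norm subrr.
Qed.

Lemma face_integral t (g : 'rV[R]_d -> R) : t <= 1 -> measurable_fun setT g ->
  (forall y, 0 <= g y) ->
  (\sum_f \int[lam]_(y in face t f) (g y)%:E = \int[lam]_(y in [set y | shell t y]) (g y)%:E)%E.
Proof.
move=> t1 mg g0; have mge := mfun_EFin mg.
rewrite -ge0_integral_bigsetU//=; first last.
- by move=> y _; rewrite lee_fin.
- exact: measurable_funTS.
- by move=> f f' _ _; exact: face_disjoint.
- exact: index_enum_uniq.
- exact: measurable_face.
set U := (X in (\int[_]_(x in X) _)%E); set S := [set y | shell t y].
have mU : measurable U by apply: bigsetU_measurable => f _; exact: measurable_face.
have mS : measurable S := @measurable_shell R d t.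
have US : U `<=` S by rewrite /U; elim/big_ind: _ => // [A B AS BS y []|f _]; [exact: AS|exact: BS|exact: face_sub].
have mSU : measurable (S `\` U) by exact: measurableD.
have -> : S = U `|` (S `\` U) by rewrite setDUK.
rewrite ge0_integral_setU//.
- rewrite [X in _ = (_ + X)%E]null_set_integral ?adde0//; first exact: measurable_funTS.
  apply: measure_negligible => //; apply: negligibleS (face_cover t1).
  by move=> y [Sy nUy]; split => // -[f _ fy]; apply: nUy; rewrite /U (bigD1 f)//=; left.
- exact: measurable_funTS.
- by move=> y _; rewrite lee_fin.
- by apply/disj_set2P; rewrite setDE setICA setICr setI0.
Qed.

(** Transposing two coordinates, and reflecting if the signs differ, maps one
    face to the other. *)
Lemma face_measure_eq t f f' : lam (face t f) = lam (face t f').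
Proof.
pose e : R := (-1) ^+ f.2 * (-1) ^+ f'.2.
have e1 : `|e| = 1 by rewrite normrM !normr_sign mul1r.
have phiE y : affine_perm (tperm f.1 f'.1) (fun=> e) (fun=> 0) y =
    e *: col_perm (tperm f.1 f'.1) y by apply/rowP => j; rewrite !mxE addr0.
have -> : face t f = affine_perm (tperm f.1 f'.1) (fun=> e) (fun=> 0) @^-1` face t f'.
  have sgn y : (-1) ^+ f'.2 * (e *: col_perm (tperm f.1 f'.1) y) ord0 f'.1 =
      (-1) ^+ f.2 * y ord0 f.1.
    by rewrite !mxE tpermR mulrA mulrCA -expr2 sqrr_sign mulr1.
  apply/seteqP; split => y; rewrite /face/= phiE sgn /shell enormZ e1 mul1r enorm_col_perm.
    move=> [ty y0 yj]; split => // j jf'; rewrite !mxE normrM e1 mul1r; apply: yj.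
    by apply: contra_neq jf' => /(canRL (tpermK _ _)); rewrite tpermL.
  move=> [ty y0 yj]; split => // j jf; have := yj (tperm f.1 f'.1 j).
  rewrite !mxE tpermK normrM e1 mul1r; apply.
  by apply: contra_neq jf => /(canRL (tpermK _ _)); rewrite tpermR.
rewrite lebesgue_rV_affine ?big1 ?invr1 ?mul1e//; last exact: measurable_face.
by move=> _; rewrite -normr_eq0 e1 oner_neq0.
Qed.

Lemma face_vol t f : 0 < t -> t <= 1 ->
  lam (face t f) = (fine (lam [set y | shell t y]) / (2 * d%:R))%:E.
Proof.
move=> t0 t1; have d0 : 0 < (d%:R : R) by [].
have fin f' : lam (face t f') \is a fin_num.
  rewrite ge0_fin_numE//; apply: le_lt_trans (shell_fin t).
  by apply: measure_le; [exact: measurable_face|exact: measurable_shell|exact: face_sub].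
have := face_integral t1 (mfunC 1) (fun _ => ler01).
have E f' : (\int[lam]_(y in face t f') 1%:E = lam (face t f))%E.
  by rewrite integral_cst ?mul1e; [exact: face_measure_eq|exact: measurable_face].
rewrite (eq_bigr _ (fun f' _ => E f')).
rewrite integral_cst ?mul1e; last exact: measurable_shell.
rewrite -(fineK (fin f)) sumEFin sumr_const card_prod card_ord card_bool => <- /=.
by rewrite -[fine _ *+ _]mulr_natr natrM [2 * _]mulrC mulfK// mulf_neq0 ?gt_eqF.
Qed.

Lemma face_coor t f y : face t f y ->
  1 <= d%:R * ((-1) ^+ f.2 * y ord0 f.1) /\
  forall j, `|y ord0 j| <= (-1) ^+ f.2 * y ord0 f.1.
Proof.
move=> [/andP[y1 _] y0 yj]; set a := _ * _ in y0 yj *.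
have le_a j : `|y ord0 j| <= a.
  have [->|/yj/ltW//] := eqVneq j f.1.
  by rewrite -(gtr0_norm y0) normrM normr_sign mul1r.
split => //; apply: (le_trans y1); apply: (le_trans (enorm_le_sum y)).
apply: (le_trans (ler_sum _ (fun j _ => le_a j))).
by rewrite sumr_const card_ord mulr_natl.
Qed.

(** On a face the largest coordinate is a Lipschitz function of the others and
    of the radius, because it stays away from [0]. *)
Lemma face_diam t f y y' : 0 < t -> t <= 1 -> face t f y -> face t f y' ->
  enorm (y - y') <= 2 * (\sum_(j < d | j != f.1) `|y ord0 j - y' ord0 j|) + 2 * d%:R * t.
Proof.
move=> t0 t1 fy fy'; have [ay yj] := face_coor fy; have [ay' yj'] := face_coor fy'.
move: (fy) (fy') => [/andP[y1 y1t] y0 _] [/andP[y1' y1t'] y0' _].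
set s := (-1) ^+ f.2 in ay yj ay' yj' y0 y0'; set i := f.1 in ay yj ay' yj' y0 y0' *.
set a := s * y ord0 i in ay yj y0; set a' := s * y' ord0 i in ay' yj' y0'.
set sg := \sum_(j < d | j != i) _.
have sE : `|y ord0 i - y' ord0 i| = `|a - a'|.
  by rewrite -mulrBr normrM /s normr_sign mul1r.
apply: (le_trans (enorm_le_sum _)); rewrite (bigD1 i)//=.
under eq_bigr do rewrite !mxE.
rewrite !mxE -/sg sE; suff : `|a - a'| <= sg + 2 * d%:R * t by lra.
have sq (z : 'rV[R]_d) : enorm z ^+ 2 = (s * z ord0 i) ^+ 2 + \sum_(j < d | j != i) z ord0 j ^+ 2.
  rewrite enormE /dot (bigD1 i)//= exprMn /s sqrr_sign mul1r expr2; congr (_ + _).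
have aa : 0 < a + a' by rewrite addr_gt0.
have diff : a ^+ 2 - a' ^+ 2 = (enorm y ^+ 2 - enorm y' ^+ 2) -
    \sum_(j < d | j != i) (y ord0 j ^+ 2 - y' ord0 j ^+ 2).
  have E (A B S T : R) : A - B = (A + S - (B + T)) - (S - T) by ring.
  by rewrite !sq sumrB; exact: E.
have rad : `|enorm y ^+ 2 - enorm y' ^+ 2| <= 3 * t.
  have h (u : R) : 1 <= u -> u < 1 + t -> 1 <= u ^+ 2 <= 1 + 3 * t by move=> *; nra.
  have := h _ y1 y1t; have := h _ y1' y1t'.
  by rewrite ler_norml; lra.
have oth : `|\sum_(j < d | j != i) (y ord0 j ^+ 2 - y' ord0 j ^+ 2)| <= (a + a') * sg.
  apply: (le_trans (ler_norm_sum _ _ _)); rewrite mulr_sumr; apply: ler_sum => j _.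
  rewrite subr_sqr normrM mulrC ler_wpM2r// (le_trans (ler_normD _ _))//.
  by rewrite lerD.
have main : `|a - a'| * (a + a') <= (sg + 2 * d%:R * t) * (a + a').
  rewrite -{1}(gtr0_norm aa) -normrM -subr_sqr diff.
  apply: (le_trans (ler_normB _ _)); apply: (le_trans (lerD rad oth)).
  have : 2 * t <= (d%:R * a + d%:R * a') * t by rewrite ler_wpM2r ?(ltW t0)//; lra.
  have E (D A A' T S : R) : 0 < T -> 2 * T <= (D * A + D * A') * T ->
    3 * T + (A + A') * S <= (S + 2 * D * T) * (A + A') by lra.
  exact: E.
by rewrite ler_pM2r in main.
Qed.

End faces.

(** * Cells of a thin shell *)

Section cells.
Context {R : realType} {n : nat}.
Local Notation d := n.+1.
Local Notation lam := (@lebesgue_rV R d).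
Implicit Types (x y z : 'rV[R]_d) (f : 'I_d * bool).

Lemma enum_bijective (I : finType) k : #|I| = k -> exists e : 'I_k -> I, bijective e.
Proof.
move=> cardI; exists (fun a => enum_val (cast_ord (esym cardI) a)).
apply: (bij_comp (@enum_val_bij I)).
by exists (cast_ord cardI) => a; rewrite ?cast_ordK ?cast_ordKV.
Qed.

(** The [n] coordinates other than [f.1] are each cut in [m] parts.  The term
    [2 * d%:R / m%:R] in [D] absorbs the thickness of the shell and ensures
    [t <= D a ^+ 2]. *)
Lemma face_cells (m : nat) f : (0 < m)%N -> let t : R := m%:R ^- 2 in
  exists (C : 'I_(m ^ n) -> set 'rV[R]_d) (D : 'I_(m ^ n) -> R),
  [/\ forall a, [/\ measurable (C a), C a `<=` [set y | shell t y] &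
        lam (C a) = (fine (lam [set y | shell t y]) / (2 * d%:R) / m%:R ^+ n)%:E],
      forall a, 0 < D a /\ t <= D a ^+ 2,
      forall a y y', C a y -> C a y' -> enorm (y - y') <= D a,
      (\sum_a D a) * m%:R <= 14 * d%:R * m%:R ^+ n &
      forall g : 'rV[R]_d -> R, measurable_fun setT g -> (forall y, 0 <= g y) ->
        (\sum_a \int[lam]_(y in C a) (g y)%:E = \int[lam]_(y in face t f) (g y)%:E)%E].
Proof.
move=> m0 t; have mR : 0 < (m%:R : R) by rewrite ltr0n.
have t0 : 0 < t by rewrite invr_gt0 exprn_gt0.
have m1 : 1 <= (m%:R : R) by rewrite ler1n.
have dR : 0 < (d%:R : R) by [].
have t1 : t <= 1 by rewrite invf_le1 ?exprn_gt0// exprn_ege1.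
pose v := fine (lam [set y | shell t y]) / (2 * d%:R).
have v0 : 0 < v by rewrite divr_gt0 ?mulr_gt0// fine_gt0// shell_fin andbT; exact: shell_gt0.
have face2 : bounded2 (face t f).
  by move=> y j /face_sub/(shell_coor j)/le_trans; apply; move: t1; lra.
pose js := [seq j <- enum 'I_d | j != f.1].
have sjs : size js = n.
  have := count_predC (pred1 f.1) (enum 'I_d).
  by rewrite /js size_filter count_uniq_mem ?enum_uniq// mem_enum size_enum_ord => -[].
have sumjs (F : 'I_d -> R) : \sum_(j <- js) F j = \sum_(j < d | j != f.1) F j.
  by rewrite big_filter big_enum_cond.
have [I [C [w [cardI CP w0 Cw [wsum Cint]]]]] :=
  cut_region js (measurable_face t f) face2 (face_vol f t0 t1) v0 m0.
rewrite sjs in cardI CP wsum.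
have [e e_bij] := enum_bijective cardI.
exists (C \o e), (fun a => 2 * w (e a) + 2 * d%:R / m%:R); split.
- by move=> a; have [mC Csub Cv] := CP (e a); split => //; apply: subset_trans Csub (@face_sub _ _ _ _).
- move=> a; have D0 : 0 < 2 * d%:R / m%:R :> R by rewrite divr_gt0// mulr_gt0.
  split; first by rewrite ltr_wpDl// mulr_ge0.
  rewrite /t -exprVn ler_pXn2r ?nnegrE ?invr_ge0 ?(ltW mR)//; last first.
    by rewrite addr_ge0 ?(ltW D0)// mulr_ge0.
  rewrite -[leLHS]add0r lerD ?mulr_ge0//.
  by rewrite ler_peMl ?invr_ge0 ?(ltW mR)// -natrM ler1n.
- move=> a y y' Cy Cy'; have [_ Csub _] := CP (e a).
  apply: (le_trans (face_diam t0 t1 (Csub _ Cy) (Csub _ Cy'))).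
  rewrite -sumjs lerD ?ler_wpM2l ?Cw ?mulr_ge0//.
  by rewrite /t -exprVn expr2 ler_piMl ?invr_ge0 ?(ltW mR)// invf_le1.
- have sum_e : \sum_a w (e a) = \sum_i w i by rewrite [RHS](reindex e)//; exact: onW_bij.
  rewrite big_split/= sumr_const card_ord -mulr_sumr sum_e.
  rewrite -[_ / _ *+ _]mulr_natr natrX mulrDl [X in _ + X](_ : _ = 2 * d%:R * m%:R ^+ n); last first.
    by field; rewrite gt_eqF.
  have nd : 6 * n%:R * m%:R ^+ n <= 6 * d%:R * m%:R ^+ n :> R.
    by rewrite ler_wpM2r ?exprn_ge0 ?(ltW mR)// ler_wpM2l// ler_nat.
  have E (S M k k' P : R) : S * M <= 6 * k * P -> 6 * k * P <= 6 * k' * P ->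
    2 * S * M + 2 * k' * P <= 14 * k' * P by lra.
  exact: E wsum nd.
by move=> g mg g0; rewrite -Cint// [RHS](reindex e)//; exact: onW_bij.
Qed.

(** As the faces have equal volumes, so do all the cells. *)
Lemma shell_cells (m : nat) : (0 < m)%N -> let t : R := m%:R ^- 2 in
  exists (v : R) (C : 'I_(2 * d * m ^ n) -> set 'rV[R]_d) (D : 'I_(2 * d * m ^ n) -> R),
  [/\ 0 < v,
      forall a, [/\ measurable (C a), C a `<=` [set y | shell t y] & lam (C a) = v%:E],
      forall a, [/\ 0 < D a, t <= D a ^+ 2 &
        forall y y', C a y -> C a y' -> enorm (y - y') <= D a],
      (\sum_a D a) * m%:R <= 28 * d%:R ^+ 2 * m%:R ^+ n &
      forall g : 'rV[R]_d -> R, measurable_fun setT g -> (forall y, 0 <= g y) ->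
        (\sum_a \int[lam]_(y in C a) (g y)%:E = \int[lam]_(y in [set y | shell t y]) (g y)%:E)%E].
Proof.
move=> m0 t; have mR : 0 < (m%:R : R) by rewrite ltr0n.
have t0 : 0 < t by rewrite invr_gt0 exprn_gt0.
have t1 : t <= 1 by rewrite invf_le1 ?exprn_gt0// exprn_ege1// ler1n.
have /choice[C /choice[D CP]] := fun f => face_cells f m0.
have cardF : #|{: ('I_d * bool) * 'I_(m ^ n)}| = (2 * d * m ^ n)%N.
  by rewrite !card_prod !card_ord card_bool (mulnC d).
have [e e_bij] := enum_bijective cardF.
exists (fine (lam [set y | shell t y]) / (2 * d%:R) / m%:R ^+ n).
exists (fun a => C (e a).1 (e a).2), (fun a => D (e a).1 (e a).2); split.
- rewrite !divr_gt0 ?mulr_gt0 ?exprn_gt0// fine_gt0// shell_fin andbT; exact: shell_gt0.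
- by move=> a; have [/(_ (e a).2)] := CP (e a).1.
- by move=> a; have [_ /(_ (e a).2)[D0 tD] Cd _ _] := CP (e a).1; split => // y y'; exact: Cd.
- have -> : \sum_a D (e a).1 (e a).2 = \sum_q D q.1 q.2.
    by rewrite [RHS](reindex e)//; exact: onW_bij.
  rewrite -(pair_bigA _ (fun f a => D f a))/= mulr_suml.
  apply: (@le_trans _ _ (\sum_(f : 'I_d * bool) 14 * d%:R * m%:R ^+ n)).
    by apply: ler_sum => f _; have [] := CP f.
  rewrite sumr_const card_prod card_ord card_bool -[_ *+ _]mulr_natr natrM.
  by apply: le_of_eq; ring.
move=> g mg g0; rewrite -(face_integral t1 mg g0).
transitivity (\sum_q \int[lam]_(y in C q.1 q.2) (g y)%:E)%E.
  by rewrite [RHS](reindex e)//; exact: onW_bij.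
rewrite -(pair_bigA _ (fun f a => \int[lam]_(y in C f a) (g y)%:E)%E)/=.
by apply: eq_bigr => f _; have [_ _ _ _ ->] := CP f.
Qed.

End cells.

(** * Upper bound *)

Section upper_bound.
Context {R : realType} {n : nat}.
Local Notation d := n.+1.
Local Notation lam := (@lebesgue_rV R d).
Implicit Types (x y z : 'rV[R]_d).

(** For nonnegative functions this is the partition of the integral; the general
    case follows by writing [g] as a difference of two such functions. *)
Lemma avg_cells (I : finType) (C : I -> set 'rV[R]_d) (S : set 'rV[R]_d) (v : R)
    (g : 'rV[R]_d -> R) : measurable S -> (0 < lam S)%E -> (lam S < +oo)%E ->
  (forall a, [/\ measurable (C a), C a `<=` S & lam (C a) = v%:E]) ->
  (forall h : 'rV[R]_d -> R, measurable_fun setT h -> (forall y, 0 <= h y) ->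
    (\sum_a \int[lam]_(y in C a) (h y)%:E = \int[lam]_(y in S) (h y)%:E)%E) ->
  bounded_mfun S g -> \sum_a avg (C a) g = fine (lam S) / v * avg S g.
Proof.
move=> mS S0 Soo CP part bg.
have sub h a : bounded_mfun S h -> bounded_mfun (C a) h.
  by move=> [mh [M hM]]; split => //; exists M => y Cy; apply: hM; have [_ CS _] := CP a; exact: CS.
have Coo a : (lam (C a) < +oo)%E by have [_ _ ->] := CP a; exact: ltry.
have nonneg h : bounded_mfun S h -> (forall y, 0 <= h y) ->
    \sum_a avg (C a) h = fine (lam S) / v * avg S h.
  move=> bh h0; have mh := bh.1; have mhe := mfun_EFin mh.
  have [_ [M hM]] := bh.
  have fin Q : measurable Q -> Q `<=` S -> (\int[lam]_(y in Q) (h y)%:E)%E \is a fin_num.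
    move=> mQ QS; have bQ : bounded_mfun Q h by split => //; exists M => y /QS/hM.
    apply: integrable_fin_num => //; apply: bounded_mfun_integrable => //.
    by apply: le_lt_trans Soo; exact: measure_le.
  rewrite /avg mulrA [_ / v * _]mulrAC divff ?mul1r; last by rewrite gt_eqF// fine_gt0// S0.
  transitivity (\sum_a v^-1 * fine (\int[lam]_(y in C a) (h y)%:E)%E).
    by apply: eq_bigr => a _; have [_ _ ->] := CP a.
  rewrite -mulr_sumr; congr (_ * _); apply: EFin_inj.
  rewrite /Rintegral -sumEFin fineK ?fin// -part//; apply: eq_bigr => a _.
  by have [mC CS _] := CP a; rewrite fineK// fin.
pose h s y : R := Num.max (s * g y) 0.
have bh s : bounded_mfun S (h s).
  have [mg [M gM]] := bg; split; first by apply: mfun_max; [exact: mfunM (mfunC s) mg|exact: mfunC].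
  exists (`|s| * M) => y Sy; apply: (@le_trans _ _ `|s * g y|).
    by rewrite ger0_norm ?le_max ?lexx ?orbT// ge_max normr_ge0 ler_norm.
  by rewrite normrM ler_wpM2l// gM.
have h0 s y : 0 <= h s y by rewrite le_max lexx orbT.
have gE : g = fun y => h 1 y + -1 * h (-1) y.
  apply/funext => y; rewrite /h mul1r !mulN1r.
  by case: (leP (g y) 0) => gy; [rewrite max_l ?oppr_ge0// opprK add0r|rewrite max_r ?oppr_le0 ?(ltW gy)// subr0].
have avgE Q : measurable Q -> (lam Q < +oo)%E -> bounded_mfun Q (h 1) ->
    bounded_mfun Q (h (-1)) -> avg Q g = avg Q (h 1) + -1 * avg Q (h (-1)).
  by move=> mQ Qoo b1 b2; rewrite {1}gE avgD ?avgZ//; exact: bounded_mfunZ.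
rewrite (avgE S)// mulrDr [_ * (-1 * _)]mulrCA -(nonneg _ (bh 1))// -(nonneg _ (bh (-1)))//.
rewrite mulr_sumr -big_split/=.
by apply: eq_bigr => a _; have [mC _ _] := CP a; rewrite avgE//; exact: sub.
Qed.

Lemma bounded_kernel_shell (t : R) x i : t <= 1 -> enorm x < 1 ->
  bounded_mfun [set y | shell t y] (fun y => kernel (y - x) i).
Proof.
move=> t1 x1; split; first by apply: mfun_kernel; meas.
exists (3 / (1 - enorm x) ^+ d) => y /andP[y1 yt].
have yx : 1 - enorm x <= enorm (y - x).
  by have := enormD_ge y (- x); rewrite enormN; apply: le_trans; rewrite lerD2r.
have x0 : 0 < 1 - enorm x by rewrite subr_gt0.
apply: (le_trans (kernel_le _ _)); apply: ler_pM; rewrite ?enorm_ge0 ?invr_ge0 ?exprn_ge0 ?enorm_ge0//.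
  by have := enormB y x; lra.
rewrite lef_pV2 ?posrE ?exprn_gt0//; last exact: lt_le_trans yx.
by rewrite ler_pXn2r ?nnegrE ?enorm_ge0// ltW.
Qed.

(** The sum is a multiple of the field of the whole shell. *)
Lemma cell_fields_cancel (I : finType) (C : I -> set 'rV[R]_d) (t v : R) x i :
  0 < t -> t <= 1 -> enorm x < 1 ->
  (forall a, [/\ measurable (C a), C a `<=` [set y | shell t y] & lam (C a) = v%:E]) ->
  (forall h : 'rV[R]_d -> R, measurable_fun setT h -> (forall y, 0 <= h y) ->
    (\sum_a \int[lam]_(y in C a) (h y)%:E = \int[lam]_(y in [set y | shell t y]) (h y)%:E)%E) ->
  \sum_a cell_field (C a) i x = 0.
Proof.
move=> t0 t1 x1 CP part.
rewrite (avg_cells (@measurable_shell R d t) (shell_gt0 _ t0) (shell_fin _) CP part)//.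
  by rewrite /avg /Rintegral newton// mulr0 mulr0.
exact: bounded_kernel_shell.
Qed.

Lemma efield_coor N (p : 'I_N -> 'rV[R]_d) x i :
  efield p x ord0 i = \sum_k kernel (p k - x) i.
Proof. by rewrite summxE; apply: eq_bigr => k _; rewrite mxE mulrC. Qed.

Lemma field_integral_le N (p : 'I_N -> 'rV[R]_d) (B : R) :
  (forall i, \int[lam]_x (in_ball x * `|\sum_k kernel (p k - x) i|)%:E <= B%:E)%E ->
  (field_integral p <= (d%:R * B)%:E)%E.
Proof.
move=> pB.
apply: (@le_trans _ _ (\sum_(i < d) B%:E)%E); last first.
  by rewrite sumEFin sumr_const card_ord [d%:R * _]mulr_natl.
apply: (le_trans _ (lee_sum _ (fun i _ => pB i))).
have mk i : measurable_fun setT (fun x => \sum_k kernel (p k - x) i).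
  by apply: mfun_sum => k; apply: mfun_kernel; meas.
have mF i : measurable_fun setT (fun x => in_ball x * `|\sum_k kernel (p k - x) i|).
  by apply: mfun_in_ballM; exact: mfun_norm.
have F0 i x : 0 <= in_ball x * `|\sum_k kernel (p k - x) i| by rewrite mulr_ge0.
rewrite -ge0_integral_sum//; last 2 first.
- by move=> i; exact: mfun_EFin.
- by move=> i x _; rewrite lee_fin.
under [X in (_ <= X)%E]eq_integral do rewrite sumEFin.
rewrite /field_integral -(integral_bool _ (fun x => enorm x < 1)).
apply: ge0_le_integralT.
- by move=> x; rewrite mulr_ge0// enorm_ge0.
- apply: mfun_in_ballM.
  by apply: mfun_enorm; apply: mfun_rV => i; under eq_fun do rewrite efield_coor; exact: mk.
- exact: mfun_sum.
move=> x; rewrite -mulr_sumr ler_wpM2l//; apply: (le_trans (enorm_le_sum _)).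
by apply: le_of_eq; apply: eq_bigr => i _; rewrite efield_coor.
Qed.

(** Fields that cancel inside the ball may be subtracted from the charges at no
    cost; the remaining charges are estimated one by one. *)
Lemma charges_le M r (p : 'I_(M + r) -> 'rV[R]_d) (F : 'I_M -> 'rV[R]_d -> R)
    (E : 'I_M -> R) i :
  (forall a, measurable_fun setT (F a)) ->
  (forall x, enorm x < 1 -> \sum_a F a x = 0) ->
  (forall a, (\int[lam]_x (in_ball x * `|kernel (p (lshift r a) - x) i - F a x|)%:E
    <= (E a)%:E)%E) ->
  (forall k, enorm (p (rshift M k)) <= 1) ->
  (\int[lam]_x (in_ball x * `|\sum_k kernel (p k - x) i|)%:E <=
    (\sum_a E a + r%:R * (@ray_cst R d * 2))%:E)%E.
Proof.
move=> mF F0 FE p1.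
have mk q : measurable_fun setT (fun x => kernel (q - x) i) by apply: mfun_kernel; meas.
have mgap a : measurable_fun setT (fun x => in_ball x * `|kernel (p (lshift r a) - x) i - F a x|).
  by apply: mfun_in_ballM; apply: mfun_norm; apply: mfunD; [exact: mk|exact: mfunN].
have mrest k : measurable_fun setT (fun x => in_ball x * `|kernel (p (rshift M k) - x) i|).
  by apply: mfun_in_ballM; apply: mfun_norm; exact: mk.
apply: (@le_trans _ _ (\int[lam]_x ((\sum_a in_ball x * `|kernel (p (lshift r a) - x) i - F a x|) +
    \sum_k in_ball x * `|kernel (p (rshift M k) - x) i|)%:E)%E).
  apply: ge0_le_integralT.
  - by move=> x; rewrite mulr_ge0.
  - by apply: mfun_in_ballM; apply: mfun_norm; exact: mfun_sum.
  - by apply: mfunD; exact: mfun_sum.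
  move=> x; rewrite -!mulr_sumr -mulrDr /in_ball.
  have [x1|_] := ltP (enorm x) 1; last by rewrite !mul0r.
  rewrite !mul1r big_split_ord/=.
  have -> : \sum_a kernel (p (lshift r a) - x) i = \sum_a (kernel (p (lshift r a) - x) i - F a x).
    by rewrite sumrB F0// subr0.
  by apply: (le_trans (ler_normD _ _)); rewrite lerD// ler_norm_sum.
rewrite ge0_integralDT; first last.
- exact: mfun_sum.
- by move=> x; apply: sumr_ge0 => k _; rewrite mulr_ge0.
- exact: mfun_sum.
- by move=> x; apply: sumr_ge0 => k _; rewrite mulr_ge0.
have int_sum (J : finType) (G : J -> 'rV[R]_d -> R) (B : J -> R) :
    (forall a, measurable_fun setT (G a)) -> (forall a x, 0 <= G a x) ->
    (forall a, \int[lam]_x (G a x)%:E <= (B a)%:E)%E ->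
    (\int[lam]_x (\sum_a G a x)%:E <= (\sum_a B a)%:E)%E.
  move=> mG G0 GB; under eq_integral do rewrite -sumEFin.
  rewrite ge0_integral_sum//; last 2 first.
  - by move=> a; exact: mfun_EFin.
  - by move=> a x _; rewrite lee_fin.
  by rewrite -sumEFin; apply: lee_sum.
rewrite EFinD; apply: leeD; first by apply: int_sum => // a x; rewrite mulr_ge0.
rewrite (_ : r%:R * _ = \sum_(k < r) @ray_cst R d * (1 + 1)); last first.
  by rewrite sumr_const card_ord mulr_natl.
apply: int_sum => // [a x|k]; first by rewrite mulr_ge0.
exact: integral_kernel_in_ball.
Qed.

Let pole : 'rV[R]_d := delta_mx ord0 ord0.

Let pole1 : enorm pole = 1. Proof. exact: enorm_delta. Qed.

Lemma coinciding_charges N : exists2 p : 'I_N -> 'rV[R]_d, (forall k, enorm (p k) = 1) &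
  (field_integral p <= (d%:R * (N%:R * (@ray_cst R d * 2)))%:E)%E.
Proof.
exists (fun=> pole) => //; apply: field_integral_le => i.
have := @charges_le 0 N (fun=> pole) (fun _ _ => 0) (fun=> 0) i.
rewrite big1// add0r; apply => //; first by case.
by rewrite pole1.
Qed.

(** One charge for each cell of the shell of thickness [m%:R ^- 2]; the
    other [r] charges are put at a pole. *)
Lemma balanced_charges m r : (0 < m)%N ->
  exists2 p : 'I_(2 * d * m ^ n + r) -> 'rV[R]_d, (forall k, enorm (p k) = 1) &
  (field_integral p <= (d%:R * (@cell_cst R n * (28 * d%:R ^+ 2 * m%:R ^+ n / m%:R) +
     r%:R * (@ray_cst R d * 2)))%:E)%E.
Proof.
move=> m0; have mR : 0 < (m%:R : R) by rewrite ltr0n.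
pose t : R := m%:R ^- 2.
have t0 : 0 < t by rewrite invr_gt0 exprn_gt0.
have t1 : t <= 1 by rewrite invf_le1 ?exprn_gt0// exprn_ege1// ler1n.
have [v [C [D [v0 CP DP Dsum part]]]] := @shell_cells R n m m0; rewrite -/t in DP CP part.
have /choice[q qP] a : exists x0 : 'rV[R]_d, enorm x0 = 1 /\
    forall i, (\int[lam]_x (in_ball x * `|kernel (x0 - x) i - cell_field (C a) i x|)%:E <=
      (@cell_cst R n * D a)%:E)%E.
  have [mC CS Cv] := CP a; have [D0 tD Cd] := DP a.
  have Cpos : (0 < lam (C a))%E by rewrite Cv lte_fin.
  exact: (@cell_estimate R n (C a) t (D a) mC Cpos CS t0 t1 D0 tD Cd).
pose p (k : 'I_(2 * d * m ^ n + r)) := if fintype.split k is inl a then q a else pole.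
have pl a : p (lshift r a) = q a by rewrite /p -[lshift r a]/(unsplit (inl a)) unsplitK.
have pr k : p (rshift _ k) = pole by rewrite /p -[rshift _ k]/(unsplit (inr k)) unsplitK.
exists p; first by move=> k; rewrite /p; case: (fintype.split k) => // a; have [] := qP a.
apply: field_integral_le => i.
apply: (@le_trans _ _ (\sum_a (@cell_cst R n * D a) + r%:R * (@ray_cst R d * 2))%:E).
  apply: (charges_le (F := fun a => cell_field (C a) i)) => //.
  - by move=> a; have [mC _ _] := CP a; exact: mfun_cell_field.
  - by move=> x x1; exact: (cell_fields_cancel i t0 t1 x1 CP part).
  - by move=> a; rewrite pl; have [_] := qP a.
  - by move=> k; rewrite pr pole1.
rewrite lee_fin lerD2r -mulr_sumr; apply: ler_wpM2l; first exact/ltW/cell_cst_gt0.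
by rewrite ler_pdivlMr.
Qed.

(** The mean value bound [m.+1 ^ k - m ^ k <= (2 ^ k - 1) * m ^ k.-1], multiplied
    by [m]. *)
Lemma exprS_natr_le (m k : nat) : (0 < m)%N ->
  m%:R * m.+1%:R ^+ k <= m%:R * m%:R ^+ k + (2 ^+ k - 1) * m%:R ^+ k :> R.
Proof.
move=> m0; elim: k => [|k IH]; first by rewrite !expr0 subrr mul0r addr0.
rewrite !exprS -natr1; move: IH; rewrite -[m.+1%:R]natr1.
have m1 : 1 <= (m%:R : R) by rewrite ler1n.
have T1 : 0 <= 2 ^+ k - 1 :> R by rewrite subr_ge0 exprn_ege1 ?ler1n.
have B0 : 0 <= (m%:R : R) ^+ k by rewrite exprn_ge0.
have E (M A B T : R) : 1 <= M -> 0 <= T - 1 -> 0 <= B -> M * A <= M * B + (T - 1) * B ->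
  M * ((M + 1) * A) <= M * (M * B) + (2 * T - 1) * (M * B).
  move=> M1 T1' B0' h.
  have h1 : (M + 1) * (M * A) <= (M + 1) * (M * B + (T - 1) * B) by rewrite ler_wpM2l//; lra.
  have h2 : 0 <= (M - 1) * ((T - 1) * B) by rewrite !mulr_ge0//; lra.
  by lra.
exact: E.
Qed.

(** Take the largest [m] for which there are enough charges.  Both the total
    diameter of the cells and the number of remaining charges are of order
    [m%:R ^+ n.-1], and [N] is of order [m ^ n]. *)
Lemma field_integral_upper_bound : (0 < n)%N -> exists2 K : R, 0 < K &
  forall N, (0 < N)%N -> exists2 p : 'I_N -> 'rV[R]_d, (forall k, enorm (p k) = 1) &
    (field_integral p <= (K * N%:R `^ ((d%:R - 2) / (d%:R - 1)))%:E)%E.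
Proof.
move=> n0; have nR : 0 < (n%:R : R) by rewrite ltr0n.
have d0 : 0 < (d%:R : R) by [].
have cr0 : 0 < @ray_cst R d by apply: ray_cst_gt0.
have cc0 : 0 < @cell_cst R n by exact: cell_cst_gt0.
pose K1 : R := d%:R * (@cell_cst R n * (28 * d%:R ^+ 2) + 2 * d%:R * 2 ^+ n * (@ray_cst R d * 2)).
pose K2 : R := d%:R * (2 * d%:R * (@ray_cst R d * 2)).
have K10 : 0 < K1.
  apply: mulr_gt0 => //; apply: addr_gt0; do ?apply: mulr_gt0 => //; do ?apply: exprn_gt0 => //.
have K20 : 0 < K2 by do ?apply: mulr_gt0 => //.
exists (K1 + K2); first exact: addr_gt0.
move=> N N0; set P := N%:R `^ _; have NR : 0 < (N%:R : R) by rewrite ltr0n.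
pose X : R := N%:R `^ n%:R^-1; have X0 : 0 < X by rewrite powR_gt0.
have XN : X ^+ n = N%:R.
  by rewrite -powR_mulrn ?ltW// -powRrM mulVf ?gt_eqF// powRr1// ltW.
have PE : P = X ^+ n.-1.
  rewrite /P (_ : (d%:R - 2) / (d%:R - 1) = 1 - n%:R^-1 :> R); last first.
    by rewrite -natr1 addrK; field; rewrite gt_eqF.
  rewrite powRB; last by rewrite (gt_eqF NR) implybT.
  rewrite powRr1 ?(ltW NR)// -/X -XN -{1}(prednK n0) exprS mulrC mulKf// gt_eqF//.
have mX m : (m ^ n <= N)%N -> m%:R ^+ n.-1 <= P.
  move=> mN; rewrite PE lerXn2r ?nnegrE ?(ltW X0)//.
  by rewrite -(ler_pXn2r n0) ?nnegrE ?(ltW X0)// XN -natrX ler_nat.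
have [N2d|N2d] := ltnP N (2 * d).
  have [p p1 pN] := coinciding_charges N; exists p => //; apply: (le_trans pN).
  rewrite lee_fin; apply: (@le_trans _ _ K2).
    rewrite /K2; apply: ler_wpM2l => //; apply: ler_wpM2r; first by rewrite mulr_ge0// ltW.
    by rewrite -natrM ler_nat ltnW.
  have P1 := mX 1%N; rewrite exp1n expr1n in P1.
  apply: (@le_trans _ _ (K2 * P)); first by rewrite ler_peMr ?(ltW K20)// P1.
  by rewrite ler_wpM2r ?powR_ge0// lerDr ltW.
have ex : exists m, (2 * d * m ^ n <= N)%N by exists 1%N; rewrite exp1n muln1.
have ub m : (2 * d * m ^ n <= N)%N -> (m <= N)%N.
  apply: leq_trans; case: m => // m; rewrite -{1}[m.+1]expn1.
  by apply: leq_trans (leq_pmull _ _); rewrite ?leq_pexp2l.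
case: (ex_maxnP ex ub) => m mN mmax.
have m0 : (0 < m)%N by apply: mmax; rewrite exp1n muln1.
have mR : 0 < (m%:R : R) by rewrite ltr0n.
have [r rE] : exists r, N = (2 * d * m ^ n + r)%N by exists (N - 2 * d * m ^ n)%N; rewrite subnKC.
have rlt : (N < 2 * d * m.+1 ^ n)%N by rewrite ltnNge; apply/negP => /mmax; rewrite ltnn.
have mP : m%:R ^+ n / m%:R <= P.
  rewrite -{1}(prednK n0) exprS mulrC mulKf ?gt_eqF// mX// (leq_trans _ mN)// leq_pmull//.
have rP : r%:R <= 2 * d%:R * 2 ^+ n * P.
  apply: (@le_trans _ _ (2 * d%:R * 2 ^+ n * (m%:R ^+ n / m%:R))); last first.
    by rewrite ler_wpM2l// mulr_ge0// exprn_ge0.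
  rewrite mulrA ler_pdivlMr//.
  have : (N%:R : R) <= 2 * d%:R * m.+1%:R ^+ n by rewrite -natrX -!natrM ler_nat ltnW.
  rewrite rE natrD !natrM natrX => h.
  have h1 := exprS_natr_le n m0.
  have E (r' M A B T D' : R) : 0 < M -> 0 < D' -> 0 <= B -> 2 * D' * B + r' <= 2 * D' * A ->
      M * A <= M * B + (T - 1) * B -> r' * M <= 2 * D' * T * B.
    move=> M0 D0 B0 g1 g2.
    have g3 : (2 * D' * B + r') * M <= 2 * D' * A * M by rewrite ler_wpM2r// ltW.
    have g4 : D' * (M * A) <= D' * (M * B + (T - 1) * B) by rewrite ler_wpM2l// ltW.
    have g5 : 0 <= D' * B by rewrite mulr_ge0// ltW.
    by lra.
  exact: E h h1.
have [p p1 pN] := balanced_charges r m0.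
suff : exists2 p : 'I_(2 * d * m ^ n + r) -> 'rV[R]_d, (forall k, enorm (p k) = 1) &
    (field_integral p <= ((K1 + K2) * P)%:E)%E by rewrite -rE.
exists p => //; apply: (le_trans pN); rewrite lee_fin.
apply: (@le_trans _ _ (K1 * P)); last by rewrite ler_wpM2r ?powR_ge0// lerDl ltW.
rewrite /K1 -[leRHS]mulrA; apply: ler_wpM2l => //; rewrite [(_ + _) * P]mulrDl; apply: lerD.
  rewrite -[leRHS]mulrA; apply: ler_wpM2l; first exact: ltW.
  by rewrite -[leLHS]mulrA; apply: ler_wpM2l => //; rewrite mulr_ge0// exprn_ge0.
by rewrite [leRHS]mulrAC; apply: ler_wpM2r => //; rewrite mulr_ge0// ltW.
Qed.

End upper_bound.

Theorem corollary1p2 (R : realType) :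
  [/\ forall d : nat, (2 <= d)%N ->
        exists2 c : R, 0 < c &
          forall n : nat, (1 <= n)%N ->
          forall p : 'I_n -> 'rV[R]_d, (forall k, unit_sphere R d (p k)) ->
            ((c * n%:R `^ ((d%:R - 2) / (d%:R - 1)))%:E
               <= field_integral p)%E,
      forall d : nat, (2 <= d)%N ->
        exists2 C : R, 0 < C &
          forall n : nat, (1 <= n)%N ->
          exists2 p : 'I_n -> 'rV[R]_d, (forall k, unit_sphere R d (p k)) &
            (field_integral p
               <= (C * n%:R `^ ((d%:R - 2) / (d%:R - 1)))%:E)%E
    & exists c C : R, [/\ 0 < c, 0 < C &
        forall n : nat, (1 <= n)%N ->
          let I := ereal_inf [set field_integral p | p in
                     [set p : 'I_n -> 'rV[R]_3 |
                       forall k, unit_sphere R 3 (p k)]] in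
          ((c * Num.sqrt n%:R)%:E <= I)%E /\
          (I <= (C * Num.sqrt n%:R)%:E)%E]].
Proof.
have lower d : (2 <= d)%N -> exists2 c : R, 0 < c &
    forall n : nat, (1 <= n)%N ->
    forall p : 'I_n -> 'rV[R]_d, (forall k, unit_sphere R d (p k)) ->
      ((c * n%:R `^ ((d%:R - 2) / (d%:R - 1)))%:E <= field_integral p)%E.
  case: d => // n n1; have [c c0 cP] := @field_integral_lower_bound R n n1.
  by exists c => // N N0 p p1; exact: cP.
have upper d : (2 <= d)%N -> exists2 C : R, 0 < C &
    forall n : nat, (1 <= n)%N ->
    exists2 p : 'I_n -> 'rV[R]_d, (forall k, unit_sphere R d (p k)) &
      (field_integral p <= (C * n%:R `^ ((d%:R - 2) / (d%:R - 1)))%:E)%E.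
  by case: d => // n n1; exact: field_integral_upper_bound.
split => //.
have [c c0 cP] := lower 3 isT; have [C C0 CP] := upper 3 isT.
have e3 : (3%:R - 2) / (3%:R - 1) = 2^-1 :> R by field.
exists c, C; split => // n n1 /=; split.
  apply/ereal_infP => _ [p p1 <-].
  by have := cP n n1 p p1; rewrite e3 powR12_sqrt.
have [p p1 pC] := CP n n1; rewrite e3 powR12_sqrt// in pC.
by apply: ge_ereal_inf; exists (field_integral p) => //; exists p.
Qed.
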